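(* Let $$G_1(\delta_\dagger,\zeta,\alpha)=m\int_{\delta_\dagger}^\alpha s^{-m-1}[h(s)-rK_1]\,ds+r(K_1+K)\delta_\dagger^{-m}-rK\zeta^{-m},$$ $$G_2(\delta_\dagger,\zeta,\alpha)=-n\int_{\delta_\dagger}^\alpha s^{-n-1}[h(s)-rK_1]\,ds-r(K_1+K)\delta_\dagger^{-n}+rK\zeta^{-n},$$ and consider the system of equations $$\int_{\delta_\dagger}^\infty s^{-n-1}[h(s)+rK]\,ds=0,\qquad G_1(\delta_\dagger,\zeta,\alpha)=0,\qquad G_2(\delta_\dagger,\zeta,\alpha)=0\qquad(\ast)$$ for $(\delta_\dagger,\zeta,\alpha)$; the equation $$G_2\big(\delta_\dagger,\delta_\dagger,\alpha(K_1);K_1\big)=0\qquad(\ast\ast)$$ for $K_1$, in which the dependence of $\alpha$ and $G_2$ on $K_1$ is made explicit ($\delta_\dagger$ does not depend on $K_1$); the equation $$m\hat x^m\int_{\hat x}^\alpha s^{-m-1}[h(s)-rK_1]\,ds-n\hat x^n\int_{\hat x}^\alpha s^{-n-1}[h(s)-rK_1]\,ds=0\qquad(\ast\!\ast\!\ast)$$ for $\hat x$; and the point $$K_0^\dagger=-K_1-\frac{n\hat x^n}{r}\int_{\hat x}^\alpha s^{-n-1}[h(s)-rK_1]\,ds.$$ Let also $$A=-\tfrac1{\sigma^2(n-m)}\int_0^{\delta_\dagger}s^{-m-1}[h(s)+rK]\,ds,$$ $$\Delta_1=A+\tfrac1{\sigma^2(n-m)}\int_0^\alpha s^{-m-1}[h(s)-rK_1]\,ds=\tfrac{rK\zeta^{-m}}{\sigma^2m(n-m)},$$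 $$\Delta_2=\tfrac1{\sigma^2(n-m)}\int_\alpha^\infty s^{-n-1}[h(s)-rK_1]\,ds=-\tfrac{rK\zeta^{-n}}{\sigma^2n(n-m)},$$ $$w_1(x)=\begin{cases}-K,&x\le\delta_\dagger,\\ Ax^m+R_h(x),&x\ge\delta_\dagger,\end{cases}\qquad w_0(x)=\begin{cases}-K,&x\le\zeta,\\ \Delta_1x^m+\Delta_2x^n,&\zeta\le x\le\alpha,\\ Ax^m+R_h(x)-K_1,&x\ge\alpha.\end{cases}$$ The system $(\ast)$ has a unique solution $(\delta_\dagger,\zeta,\alpha)$ such that $0<\delta_\dagger\wedge\zeta\le\delta_\dagger\vee\zeta<\alpha$. If $h(\delta_\dagger)<0$, then there exists a unique solution $K_1^\dagger>0$ to $(\ast\ast)$ that depends on all of the problem data except $K_1$, $K_0$. If $h(\delta_\dagger)<0$ and $K_1<K_1^\dagger$, then equation $(\ast\!\ast\!\ast)$ has a unique solution $\hat x\in(\delta_\dagger,\alpha)$ and the point $K_0^\dagger>0$ depends on all of the problem data except $K_0$. Furthermore, $\lim_{K_1\uparrow K_1^\dagger}K_0^\dagger(K_1)=0$, and the free-boundary points $\zeta$ and $\delta_\dagger$, which do not depend on $K_0$, are such that $$0<\zeta<\delta_\dagger\ \text{ if }h(\delta_\dagger)<0\text{ and }K_1<K_1^\dagger,$$ $$0<\zeta=\delta_\dagger\ \text{ if }h(\delta_\dagger)<0\text{ and }K_1=K_1^\dagger,$$ $$0<\delta_\dagger<\zeta\ \text{ if }h(\delta_\dagger)\ge0\text{ or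 }\big(h(\delta_\dagger)<0\text{ and }K_1>K_1^\dagger\big).$$ The functions $w_1,w_0$, with $A>0$, $\Delta_1>0$, $\Delta_2>0$ given by the formulas above, are increasing and satisfy the HJB equation (stated in the context) if and only if $$K<0,\quad h(0)<-rK$$ and one of the following holds: $-rK_0\le h(0)$; or ($h(0)<-rK_0$ and $h(\delta_\dagger)\ge0$); or ($h(0)<-rK_0$, $h(\delta_\dagger)<0$ and $K_1\ge K_1^\dagger$); or ($h(0)<-rK_0$, $h(\delta_\dagger)<0$, $K_1<K_1^\dagger$ and $K_0\ge K_0^\dagger$).
   Context: Let $b\in\mathbb R$, $\sigma\ne0$, $r>0$ be constants, $W$ a standard one-dimensional Brownian motion and, for $x>0$, let $X$ solve $dX_t=bX_t\,dt+\sqrt2\,\sigma X_t\,dW_t$, $X_0=x$. Standing assumption: $h:(0,\infty)\to\mathbb R$ is right-continuous and increasing (''increasing'' does not mean strictly increasing), $\lim_{x\to\infty}h(x)=\infty$, $\mathbb E[\int_0^\infty e^{-rt}|h(X_t)|\,dt]<\infty$ for every $x>0$; $K_1,K_0>0$, $K\in\mathbb R$. Put $h(0):=\lim_{x\downarrow0}h(x)$. The constants $m<0<n$ are $m,n=\frac1{2\sigma^2}\big[\sigma^2-b\mp\sqrt{(b-\sigma^2)^2+4\sigma^2r}\big]$, and $$R_h(x)=\frac1{\sigma^2(n-m)}\Big[x^m\int_0^xs^{-m-1}h(s)\,ds+x^n\int_x^\infty s^{-n-1}h(s)\,ds\Big]=\mathbb E\Big[\int_0^\infty e^{-rs}h(X_s)\,ds\Big].$$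 HJB equation: the coupled quasi-variational inequalities $$\max\{\sigma^2x^2w_1''(x)+bxw_1'(x)-rw_1(x)+h(x),\ w_0(x)-w_1(x)-K_0,\ -w_1(x)-K\}=0,$$ $$\max\{\sigma^2x^2w_0''(x)+bxw_0'(x)-rw_0(x),\ w_1(x)-w_0(x)-K_1,\ -w_0(x)-K\}=0$$ on $(0,\infty)$; the solutions $w_1,w_0$ are $C^1$ as well as $C^2$ outside a finite set, and satisfy these equations in the classical sense. Notation: $a\wedge b=\min\{a,b\}$, $a\vee b=\max\{a,b\}$.
   Formalization: Existence, uniqueness and ordering claims assume K<0 and h(0)<-rK (otherwise (∗) has no such solution); C² and the HJB equation are required off a finite set together with the jumps of h (w_1'' jumps with h); X is given by its explicit geometric Brownian motion formula. *)

(* Defs.v *)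
(* MathComp-Analysis; all real numbers live in an arbitrary R : realType. *)
From HB Require Import structures.
From mathcomp Require Import all_boot all_order all_algebra.
From mathcomp Require Import all_classical all_reals all_analysis.

Set Implicit Arguments.
Unset Strict Implicit.
Unset Printing Implicit Defensive.

Import Order.TTheory GRing.Theory Num.Theory.
Import numFieldNormedType.Exports.

Local Open Scope classical_set_scope.
Local Open Scope ring_scope.

Section StandingAssumptions.
Context {R : realType}.

(* Times are the t >= 0; W t is unconstrained for t < 0. Mutual independence
   of the increments is the product rule below: since any B i may be setT,
   it covers every subfamily. *)
Definition brownian_motion d (T : measurableType d) (P : probability T R)
    (W : R -> {RV P >-> R}) : Prop :=
  [/\ {ae P, forall w, W 0 w = 0},
      forall s t : R, 0 <= s -> s < t ->
        forall B : set R, measurable B ->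
          P [set w | B (W t w - W s w)] = normal_prob 0 (Num.sqrt (t - s)) B,
      forall (k : nat) (t : nat -> R) (B : nat -> set R),
        0 <= t 0%N -> (forall i, t i <= t i.+1) ->
        (forall i, measurable (B i)) ->
        P (\bigcap_(i < k) [set w | B i (W (t i.+1) w - W (t i) w)]) =
        (\prod_(i < k) P [set w | B i (W (t i.+1) w - W (t i) w)%R])%E
    & forall w, {within `[0, +oo[, continuous (fun t => W t w)}].

(* The strong solution, in closed form, of
   dX = b X dt + sqrt 2 * sigma X dW, X_0 = x. *)
Definition gbm (b sigma x : R) {T : Type} (W : R -> T -> R) (t : R) (w : T)
    : R :=
  x * expR ((b - sigma ^+ 2) * t + Num.sqrt 2 * sigma * W t w).

(* h is a total function on R; only its values on ]0, +oo[ are ever used. *)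
Definition increasing_on_pos (h : R -> R) : Prop :=
  forall x y : R, 0 < x -> x <= y -> h x <= h y.

Definition running_payoff (b sigma r : R) d (T : measurableType d)
    (P : probability T R) (W : R -> {RV P >-> R}) (h : R -> R) : Prop :=
  [/\ forall x : R, 0 < x -> h y @[y --> x^'+] --> h x,
      increasing_on_pos h,
      h x @[x --> +oo] --> +oo
    & forall x : R, 0 < x ->
        (\int[P]_w \int[lebesgue_measure]_(t in `[0%R, +oo[)
           (expR (- r * t) * `|h (gbm b sigma x W t w)|)%:E < +oo)%E].

(* h(0) is an extended real: it may be -oo. *)
Definition h_zero (h : R -> R) : \bar R := lim ((h x)%:E @[x --> 0^'+]).

End StandingAssumptions.

Section Objects.
Context {R : realType}.
Variables (b sigma r : R) (h : R -> R) (K : R).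

Local Notation mu := (@lebesgue_measure R).

Definition exp_m : R :=
  (sigma ^+ 2 - b - Num.sqrt ((b - sigma ^+ 2) ^+ 2 + 4 * sigma ^+ 2 * r))
  / (2 * sigma ^+ 2).

Definition exp_n : R :=
  (sigma ^+ 2 - b + Num.sqrt ((b - sigma ^+ 2) ^+ 2 + 4 * sigma ^+ 2 * r))
  / (2 * sigma ^+ 2).

Local Notation m := exp_m.
Local Notation n := exp_n.

Definition R_h (x : R) : R :=
  (sigma ^+ 2 * (n - m))^-1 *
  (x `^ m * (\int[mu]_(s in `]0, x]) (s `^ (- m - 1) * h s)) +
   x `^ n * (\int[mu]_(s in `[x, +oo[) (s `^ (- n - 1) * h s))).

Definition G1 (K1 delta zeta alpha : R) : R :=
  m * (\int[mu]_(s in `[delta, alpha]) (s `^ (- m - 1) * (h s - r * K1)))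
  + r * (K1 + K) * delta `^ (- m) - r * K * zeta `^ (- m).

Definition G2 (K1 delta zeta alpha : R) : R :=
  - n * (\int[mu]_(s in `[delta, alpha]) (s `^ (- n - 1) * (h s - r * K1)))
  - r * (K1 + K) * delta `^ (- n) + r * K * zeta `^ (- n).

Definition solves_system (K1 delta zeta alpha : R) : Prop :=
  [/\ 0 < Num.min delta zeta, Num.max delta zeta < alpha,
      \int[mu]_(s in `[delta, +oo[) (s `^ (- n - 1) * (h s + r * K)) = 0,
      G1 K1 delta zeta alpha = 0
    & G2 K1 delta zeta alpha = 0].

Definition solves_xhat (K1 alpha x : R) : Prop :=
  m * x `^ m *
    (\int[mu]_(s in `[x, alpha]) (s `^ (- m - 1) * (h s - r * K1)))
  - n * x `^ n *
    (\int[mu]_(s in `[x, alpha]) (s `^ (- n - 1) * (h s - r * K1))) = 0.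

Definition K0_dagger (K1 alpha x : R) : R :=
  - K1 - n * x `^ n / r *
    (\int[mu]_(s in `[x, alpha]) (s `^ (- n - 1) * (h s - r * K1))).

Definition coef_A (delta : R) : R :=
  - (sigma ^+ 2 * (n - m))^-1 *
    (\int[mu]_(s in `]0, delta]) (s `^ (- m - 1) * (h s + r * K))).

Definition Delta1 (K1 delta alpha : R) : R :=
  coef_A delta + (sigma ^+ 2 * (n - m))^-1 *
    (\int[mu]_(s in `]0, alpha]) (s `^ (- m - 1) * (h s - r * K1))).

Definition Delta2 (K1 alpha : R) : R :=
  (sigma ^+ 2 * (n - m))^-1 *
    (\int[mu]_(s in `[alpha, +oo[) (s `^ (- n - 1) * (h s - r * K1))).

Definition w1 (delta x : R) : R :=
  if x <= delta then - K else coef_A delta * x `^ m + R_h x.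

Definition w0 (K1 delta zeta alpha x : R) : R :=
  if x <= zeta then - K
  else if x <= alpha then
    Delta1 K1 delta alpha * x `^ m + Delta2 K1 alpha * x `^ n
  else coef_A delta * x `^ m + R_h x - K1.

Definition C1_on_pos (u : R -> R) : Prop :=
  forall x : R, 0 < x -> derivable u x 1 /\ {for x, continuous (derive1 u)}.

Definition C2_off (E : set R) (u : R -> R) : Prop :=
  (forall x : R, 0 < x -> ~ E x -> derivable (derive1 u) x 1) /\
  {within [set x | 0 < x] `\` E, continuous (derive1 (derive1 u))}.

(* A solution of the first equation cannot be twice differentiable where h
   jumps in the region where the ODE is active, so the points of discontinuity
   of h (at most countably many, as h is monotone) are excluded along with the
   finite set F. If h has finitely many jumps then E is again a finite set. *)
Definition solves_HJB (K1 K0 : R) (v1 v0 : R -> R) : Prop :=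
  C1_on_pos v1 /\ C1_on_pos v0 /\
  exists2 F : set R, finite_set F &
    let E := F `|` [set x | ~ {for x, continuous h}] in
    [/\ C2_off E v1, C2_off E v0
      & forall x : R, 0 < x -> ~ E x ->
        Num.max (sigma ^+ 2 * x ^+ 2 * derive1 (derive1 v1) x
                   + b * x * derive1 v1 x - r * v1 x + h x)
          (Num.max (v0 x - v1 x - K0) (- v1 x - K)) = 0 /\
        Num.max (sigma ^+ 2 * x ^+ 2 * derive1 (derive1 v0) x
                   + b * x * derive1 v0 x - r * v0 x)
          (Num.max (v1 x - v0 x - K1) (- v0 x - K)) = 0].

End Objects.

(* Main.v *)
(* With A_c(x) = int_0^x s^(-m-1) (h(s) - c) ds, B_c(x) = int_x^oo s^(-n-1) (h(s) - c) ds
   and N = sigma^2 (n - m), all the functions involved (N times w1, w0 and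
   w0 - w1 on their pieces, up to a sign) have the form
   S(x) = x^m (a - A_0(x)) + x^n (b - B_0(x)). If S'(z) = 0 and S(z) = N v, then
   S(y) - S(z) is the integral between z and y of h + r v against a kernel that
   is positive on both sides of z; so h(z) + r v >= 0 at a minimum and <= 0 at a
   maximum even though h may jump, and this replaces the maximum principle.
   G1 = G2 = 0 says that w0 - w1 has value -K1 and slope 0 at alpha. Eliminating
   zeta leaves one equation for alpha, solved by the intermediate value theorem.
   Since the pasted homogeneous solution w0 decreases in zeta, comparing two
   solutions shows that zeta determines K1 and increases with it; K1-dagger is
   minus the minimum of w0 - w1 for zeta = delta, and K0-dagger, the maximum of
   w0 - w1, lies between 0 and K1-dagger - K1. The HJB equation amounts to
   w0 - w1 <= K0.
   The integrability of s^(-m-1) h at 0 and of s^(-n-1) h at infinity comes from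
   the expected payoff: by Tonelli, the discounted occupation measure of
   [k, k+1) by the drifted Brownian motion log X is at least C e^(-n k). *)

(* The level c in A_c and B_c is free: changing it adds an explicit power of x. Each sign argument
   therefore picks the c (r kap, r K1, -r v, or the value of h at the point considered) for which h
   - c keeps one sign on the interval at hand. Monotonicity of h gives that sign, and
   right-continuity carries a strict upper bound on h a little to the right. The unknown zeta enters
   the system only through zeta^(-m) and zeta^(-n). The inequality n e^(mt) - m e^(nt) >= n - m,
   with equality at t = 0, is what links these two numbers; it supplies one of the two signs for the
   intermediate value theorem. The alternative -r K0 <= h(0) is a case of its own because h(xhat) <
   -r K0-dagger, so it already forces K0-dagger <= K0. For the occupation measure, a drift v in
   place of nu absorbs the discount. A process with drift v is near level k around time k/v, and for
   a time of order sqrt k its density there is of order 1/sqrt k, so the product has no power of k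
   left. *)
Require Import Defs.
From HB Require Import structures.
From mathcomp Require Import all_boot all_order all_algebra.
From mathcomp Require Import all_classical all_reals all_analysis.
From mathcomp Require Import measurable_realfun ring lra.

Set Implicit Arguments.
Unset Strict Implicit.
Unset Printing Implicit Defensive.

Import Order.TTheory GRing.Theory Num.Theory.
Import numFieldNormedType.Exports.

Local Open Scope classical_set_scope.
Local Open Scope ring_scope.

(** * Integrals of powers *)

Section integral_generalities.
Context {R : realType}.
Local Notation mu := (@lebesgue_measure R).

(** A vanishing integral of a nonnegative function would make [f] zero almost everywhere, whereas
    the open interval on which it is positive has measure [b - a]. *)
Lemma Rintegral_gt0 (D : set R) (a b : R) (f : R -> R) :
  measurable D -> mu.-integrable D (EFin \o f) -> a < b -> `]a, b[ `<=` D ->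
  (forall s, D s -> 0 <= f s) -> (forall s, a < s < b -> 0 < f s) ->
  0 < \int[mu]_(s in D) f s.
Proof.
move=> mD intf ab sub f0 fpos.
rewrite lt0r Rintegral_ge0// andbT; apply/negP => /eqP int0.
have mf := measurable_int _ intf.
have /(ae_eq_integral_abs mu mD mf) : (\int[mu]_(x in D) `|(EFin \o f) x| = 0)%E.
  rewrite (@eq_integral _ _ _ mu D (EFin \o f)); last first.
    by move=> x /[!inE] Dx; rewrite /= ger0_norm// f0.
  by rewrite -[LHS]fineK ?integrable_fin_num// [X in X%:E]int0.
case=> N [mN N0 subN].
have : (mu `]a, b[%classic <= mu N)%E.
  apply: le_measure; rewrite ?inE// => x xab; apply: subN => /= /(_ (sub _ xab)) /=.
  move=> [] fx0; move: xab; rewrite /= in_itv/= => /fpos.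
  by rewrite fx0 ltxx.
by rewrite N0 lebesgue_measure_itv/= lte_fin ab -EFinD lee_fin leNgt subr_gt0 ab.
Qed.

Lemma integral_bigcup_le (F : (set R)^nat) (f : R -> \bar R) (C : \bar R) :
  nondecreasing_seq F -> (forall i, measurable (F i)) ->
  (forall i, measurable_fun (F i) f) -> (forall i x, F i x -> (0 <= f x)%E) ->
  (forall i, (\int[mu]_(x in F i) f x <= C)%E) ->
  (\int[mu]_(x in \bigcup_i F i) f x <= C)%E.
Proof.
move=> ndF mF mf f0 FC.
have cv := @ge0_nondecreasing_set_cvg_integral _ (measurableTypeR R) R F f mu ndF mF mf f0.
rewrite -(cvg_lim _ cv)//; apply: lime_le; last exact: nearW.
by apply/cvg_ex; eexists; exact: cv.
Qed.

Lemma powR_continuous (x p : R) : 0 < x -> {for x, continuous (fun s : R => s `^ p)}.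
Proof.
move=> x0; apply: differentiable_continuous; apply/derivable1_diffP.
by apply: derivable_powR; rewrite in_itv/= andbT.
Qed.

Lemma powR_within_continuous (a b p : R) : 0 < a ->
  {within `[a, b], continuous (fun s : R => s `^ p)}.
Proof.
move=> a0; apply: continuous_in_subspaceT => x /[!inE] /=.
by rewrite in_itv/= => /andP[ax _]; exact/powR_continuous/(lt_le_trans a0).
Qed.

Lemma powR_integrable (a b p : R) : 0 < a ->
  mu.-integrable `[a, b] (EFin \o (fun s : R => s `^ p)).
Proof.
move=> a0; apply: continuous_compact_integrable; first exact: segment_compact.
exact: powR_within_continuous.
Qed.

Lemma integral_powR (a b p : R) : 0 < a -> a <= b -> p != 0 ->
  (\int[mu]_(s in `[a, b]) (s `^ (p - 1))%:E = ((b `^ p - a `^ p) / p)%:E)%E.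
Proof.
move=> a0; rewrite le_eqVlt => /predU1P[<- p0|ab p0].
  by rewrite set_itv1 integral_set1 subrr mul0r.
have derp x : a <= x -> is_derive x 1 (fun s : R => p^-1 * s `^ p) (x `^ (p - 1)).
  move=> ax; have x0 : 0 < x by rewrite (lt_le_trans a0).
  apply: is_derive_eq (is_deriveZ p^-1 (is_derive1_powR p x0)) _.
  by rewrite /GRing.scale /= mulrA mulVf// mul1r.
have cF x : a <= x -> {for x, continuous (fun s : R => p^-1 * s `^ p)}.
  move=> ax; apply: differentiable_continuous; apply/derivable1_diffP.
  by have [] := derp _ ax.
rewrite (@continuous_FTC2 _ _ (fun s => p^-1 * s `^ p))//.
- by rewrite -EFinB -mulrBr mulrC.
- exact: powR_within_continuous.
- split => [x /[!in_itv]/= /andP[/ltW ax _]||].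
  + by have [] := derp _ ax.
  + exact/cvg_at_right_filter/cF.
  + exact/cvg_at_left_filter/cF/ltW.
- move=> x /[!in_itv]/= /andP[/ltW ax _].
  by rewrite derive1E; have [_ ->] := derp _ ax.
Qed.

(** The pieces stay away from the singularity at [0]: the fundamental theorem of calculus applies on
    each, and monotone convergence passes to the union. *)
Lemma bigcup_itvNy (x : R) : 0 < x ->
  `]0, x]%classic = \bigcup_i `[x / (i.+1%:R), x]%classic.
Proof.
move=> x0; apply/seteqP; split => [y|y [i _]] /=; rewrite !in_itv/=.
  move=> /andP[y0 yx]; exists (Num.truncn (x / y)) => //=.
  rewrite in_itv/= yx andbT ler_pdivrMr// mulrC -ler_pdivrMr//.
  by rewrite ltW// Num.Theory.truncnS_gt.
by move=> /andP[iy ->]; rewrite andbT (lt_le_trans _ iy)// divr_gt0.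
Qed.

Lemma bigcup_itvcy (x : R) : `[x, +oo[%classic = \bigcup_i `[x, x + i%:R]%classic.
Proof.
apply/seteqP; split => [y|y [i _]] /=; rewrite !in_itv/= ?andbT; last first.
  by case/andP.
move=> xy; exists (Num.truncn (y - x)).+1 => //=; rewrite in_itv/= xy/=.
by rewrite -lerBlDl ltW// Num.Theory.truncnS_gt.
Qed.

Lemma nondecreasing_itvNy (x : R) : 0 <= x ->
  nondecreasing_seq (fun i => `[x / (i.+1%:R), x]%classic).
Proof.
move=> x0 i j ij; apply/subsetPset => y /=; rewrite !in_itv/= => /andP[+ ->].
rewrite andbT; apply: le_trans.
by rewrite ler_wpM2l// lef_pV2 ?posrE// ler_nat.
Qed.

Lemma nondecreasing_itvcy (x : R) :
  nondecreasing_seq (fun i => `[x, x + i%:R]%classic).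
Proof.
move=> i j ij; apply/subsetPset => y /=; rewrite !in_itv/= => /andP[-> /=] yi.
by rewrite (le_trans yi)// lerD2l ler_nat.
Qed.

Lemma integral_powR0 (x p : R) : 0 < x -> 0 < p ->
  (\int[mu]_(s in `]0%R, x]) (s `^ (p - 1))%:E <= (x `^ p / p)%:E)%E.
Proof.
move=> x0 p0; rewrite bigcup_itvNy//; apply: integral_bigcup_le => //.
- exact/nondecreasing_itvNy/ltW.
- by move=> i; apply/measurable_EFinP; apply: measurable_funTS; exact: measurable_powR.
- by move=> i s _; rewrite lee_fin powR_ge0.
- move=> i; rewrite integral_powR ?divr_gt0// ?lt0r_neq0//; last first.
    by rewrite ler_pdivrMr// ler_peMr ?ler1n ?ltW//.
  by rewrite lee_fin ler_pM2r ?invr_gt0// lerBlDr lerDl powR_ge0.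
Qed.

Lemma powR_integrable0 (x p : R) : 0 < x -> 0 < p ->
  mu.-integrable `]0, x] (EFin \o (fun s : R => s `^ (p - 1))).
Proof.
move=> x0 p0; apply/integrableP; split.
  by apply/measurable_EFinP; apply: measurable_funTS; exact: measurable_powR.
under eq_integral do rewrite /= ger0_norm ?powR_ge0//.
by apply: (le_lt_trans (integral_powR0 x0 p0)); rewrite ltry.
Qed.

Lemma integral_powRy (x p : R) : 0 < x -> p < 0 ->
  (\int[mu]_(s in `[x, +oo[) (s `^ (p - 1))%:E <= (x `^ p / - p)%:E)%E.
Proof.
move=> x0 p0; rewrite bigcup_itvcy; apply: integral_bigcup_le => //.
- exact/nondecreasing_itvcy.
- by move=> i; apply/measurable_EFinP; apply: measurable_funTS; exact: measurable_powR.
- by move=> i s _; rewrite lee_fin powR_ge0.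
- move=> i; rewrite integral_powR ?lerDl// ?ltr0_neq0//.
  rewrite lee_fin -mulrNN -invrN opprB ler_pM2r ?invr_gt0 ?oppr_gt0//.
  by rewrite lerBlDr lerDl powR_ge0.
Qed.

Lemma powR_integrabley (x p : R) : 0 < x -> p < 0 ->
  mu.-integrable `[x, +oo[ (EFin \o (fun s : R => s `^ (p - 1))).
Proof.
move=> x0 p0; apply/integrableP; split.
  by apply/measurable_EFinP; apply: measurable_funTS; exact: measurable_powR.
under eq_integral do rewrite /= ger0_norm ?powR_ge0//.
by apply: (le_lt_trans (integral_powRy x0 p0)); rewrite ltry.
Qed.

End integral_generalities.

(** * Power weights against a monotone function *)

Section powR_facts.
Context {R : realType}.
Local Notation mu := (@lebesgue_measure R).

Lemma integrable_scale (D : set R) (f : R -> R) (k : R) : measurable D ->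
  mu.-integrable D (EFin \o f) -> mu.-integrable D (EFin \o (fun s => k * f s)).
Proof.
move=> mD intf.
rewrite (_ : EFin \o _ = (fun s => k%:E * (EFin \o f) s)%E).
  exact: integrableZl.
by apply/funext => s; rewrite /= EFinM.
Qed.

Lemma integrable_add (D : set R) (f g : R -> R) : measurable D ->
  mu.-integrable D (EFin \o f) -> mu.-integrable D (EFin \o g) ->
  mu.-integrable D (EFin \o (fun s => f s + g s)).
Proof.
move=> mD intf intg.
rewrite (_ : EFin \o _ = (EFin \o f) \+ (EFin \o g))%E.
  exact: integrableD.
by apply/funext => s; rewrite /= EFinD.
Qed.

Lemma integrable_setU (A B : set R) (f : R -> R) : measurable A -> measurable B ->
  [disjoint A & B] -> mu.-integrable A (EFin \o f) ->
  mu.-integrable B (EFin \o f) -> mu.-integrable (A `|` B) (EFin \o f).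
Proof.
move=> mA mB AB /integrableP[mfA fA] /integrableP[mfB fB].
have mf : measurable_fun (A `|` B) (EFin \o f) by exact/measurable_funU.
apply/integrableP; split => //.
rewrite ge0_integral_setU//; last exact: measurableT_comp.
exact: lte_add_pinfty.
Qed.

Lemma powR_cvg0n (x p : R) : 0 < x -> 0 < p ->
  (x / i.+1%:R) `^ p @[i --> \oo] --> (0 : R).
Proof.
move=> x0 p0; have /cvg_at_rightP := powR_cvg0 p0; apply; split.
  by move=> i; rewrite divr_gt0.
have -> : (0 : R) = x * 0 by rewrite mulr0.
by apply: cvgMr; exact: (@cvg_harmonic R).
Qed.

Lemma Rintegral_powR0 (x p : R) : 0 < x -> 0 < p ->
  \int[mu]_(s in `]0, x]) (s `^ (p - 1)) = x `^ p / p.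
Proof.
move=> x0 p0; rewrite /Rintegral bigcup_itvNy//.
rewrite -(cvg_lim _ (@ge0_nondecreasing_set_cvg_integral _ (measurableTypeR R) R
  (fun i => `[x / i.+1%:R, x]%classic) (EFin \o (fun s => s `^ (p - 1))) mu _ _ _ _))//;
  last 3 first.
- exact/nondecreasing_itvNy/ltW.
- by move=> i; apply/measurable_EFinP; apply: measurable_funTS; exact: measurable_powR.
- by move=> i s _; rewrite lee_fin powR_ge0.
rewrite (_ : (fun i => _) = (EFin \o (fun i => (x `^ p - (x / i.+1%:R) `^ p) / p))); last first.
  apply/funext => i /=; rewrite integral_powR ?divr_gt0 ?lt0r_neq0//.
  by rewrite ler_pdivrMr// ler_peMr ?ler1n ?ltW.
rewrite (cvg_lim _ (cvg_EFin _ (_ : _ --> x `^ p / p)))//; first exact: nearW.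
have -> : x `^ p / p = (x `^ p - 0) / p by rewrite subr0.
by apply: cvgMl; apply: cvgB; [exact: cvg_cst|exact: powR_cvg0n].
Qed.

Lemma powRB1 (s p : R) : 0 < s -> s `^ (- p - 1) = (s `^ p)^-1 * s^-1.
Proof.
move=> s0; have sn0 : s != 0 by rewrite gt_eqF.
by rewrite powRD ?sn0 ?implybT// !powRN powRr1// ltW.
Qed.

Lemma powR_ltp (s y p : R) : 0 < p -> 0 < s -> s < y -> s `^ p < y `^ p.
Proof.
move=> p0 s0 sy; apply: gt0_ltr_powR; rewrite ?nnegrE// ?ltW//.
exact: lt_trans sy.
Qed.

Lemma powR_ltn (s y p : R) : p < 0 -> 0 < s -> s < y -> y `^ p < s `^ p.
Proof.
move=> p0 s0 sy; rewrite -(opprK p) powRN [ltRHS]powRN.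
have y0 := lt_trans s0 sy.
by rewrite ltf_pV2 ?posrE ?powR_gt0// powR_ltp// oppr_gt0.
Qed.

Lemma powR_lep (s y p : R) : 0 < p -> 0 < s -> s <= y -> s `^ p <= y `^ p.
Proof. by move=> p0 s0; rewrite le_eqVlt => /predU1P[->//|sy]; exact/ltW/powR_ltp. Qed.

Lemma powR_len (s y p : R) : p < 0 -> 0 < s -> s <= y -> y `^ p <= s `^ p.
Proof. by move=> p0 s0; rewrite le_eqVlt => /predU1P[->//|sy]; exact/ltW/powR_ltn. Qed.

Lemma powR_large (p C M : R) : 0 < p -> exists x, [/\ M <= x, 0 < x & C < x `^ p].
Proof.
move=> p0; have C1 : 0 < Num.max C 1 by rewrite lt_max ltr01 orbT.
exists (Num.max (Num.max M 1) ((Num.max C 1 + 1) `^ p^-1)); split.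
- by rewrite !le_max lexx.
- by rewrite !lt_max ltr01 orbT.
apply: (@lt_le_trans _ _ (((Num.max C 1 + 1) `^ p^-1) `^ p)).
  rewrite -powRrM mulVf ?gt_eqF// powRr1 ?addr_ge0 ?ltW//.
  by rewrite ltr_pwDr// le_max lexx.
by apply: powR_lep => //; rewrite ?powR_gt0 ?addr_gt0// le_max lexx orbT.
Qed.

End powR_facts.

Section weighted_integrals.
Context {R : realType} (m n : R) (h : R -> R).
Local Notation mu := (@lebesgue_measure R).
Hypotheses (m0 : m < 0) (n0 : 0 < n) (h_inc : increasing_on_pos h).
Hypothesis int0 : mu.-integrable `]0, 1] (EFin \o (fun s : R => s `^ (- m - 1) * h s)).
Hypothesis inty : mu.-integrable `[1, +oo[ (EFin \o (fun s : R => s `^ (- n - 1) * h s)).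

(** Among positive reals the superlevel sets of [h] are intervals by monotonicity. The restriction
    to positive [D] matters because [h] is arbitrary elsewhere. *)
Lemma measurable_pos (D : set R) : measurable D -> D `<=` `]0, +oo[%classic ->
  measurable_fun D h.
Proof.
move=> mD D0; apply: (measurability (@RGenCInfty.G R)) => [|/= _ [_] [c] -> <-].
  exact: RGenCInfty.measurableE.
rewrite (_ : _ `&` _ = D `&` [set x | 0 < x /\ c <= h x]); last first.
  apply/seteqP; split => x [Dx] /=; rewrite in_itv/= andbT; last by case.
  by move=> hx; split=> //; split => //; have := D0 _ Dx; rewrite /= in_itv/= andbT.
apply: measurableI => //; apply: is_interval_measurable => s t/= [s0 cs] [t0 ct].
move=> u /andP[su ut]; have u0 := lt_le_trans s0 su.
by split => //; rewrite (le_trans cs)// h_inc.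
Qed.

Lemma powRh_integrable (a b p : R) : 0 < a ->
  mu.-integrable `[a, b] (EFin \o (fun s : R => s `^ p * h s)).
Proof.
move=> a0; rewrite (_ : _ \o _ = ((EFin \o (fun s : R => (s `^ p)%R)) \* (EFin \o h))%E).
  apply: integrableMl => //; first exact: powR_integrable.
    by apply: measurable_pos => // x /=; rewrite !in_itv/= andbT => /andP[/(lt_le_trans a0)].
  exists (Num.max `|h a| `|h b|); split; first exact: num_real.
  move=> M Mh x /=; rewrite in_itv/= => /andP[ax xb]; apply: le_trans (ltW Mh).
  have ha := h_inc a0 ax; have hb := h_inc (lt_le_trans a0 ax) xb.
  have Ba : `|h a| <= Num.max `|h a| `|h b| by rewrite le_max lexx.
  have Bb : `|h b| <= Num.max `|h a| `|h b| by rewrite le_max lexx orbT.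
  have := ler_norm (- h a); rewrite normrN => ha'; have hb' := ler_norm (h b).
  by rewrite ler_norml; apply/andP; split; lra.
by apply/funext => s; rewrite /= EFinM.
Qed.

Lemma powRh_integrable0 (x : R) : 0 < x ->
  mu.-integrable `]0, x] (EFin \o (fun s : R => s `^ (- m - 1) * h s)).
Proof.
move=> x0; apply: (@integrableS _ (measurableTypeR R) R mu (`]0, 1] `|` `]1, x])) => //.
- exact: measurableU.
- move=> y /=; rewrite !in_itv/= => /andP[y0 yx]; rewrite y0 yx andbT/=.
  by case: leP => _; [left|right].
- apply: integrable_setU => //.
    by apply/disj_setPS => y [/=]; rewrite !in_itv/= => /andP[_ y1] /andP[]; rewrite ltNge y1.
  by apply: integrableS (powRh_integrable x _ ltr01) => //; exact: subset_itv_oc_cc.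
Qed.

Lemma powRh_integrabley (x : R) : 0 < x ->
  mu.-integrable `[x, +oo[ (EFin \o (fun s : R => s `^ (- n - 1) * h s)).
Proof.
move=> x0; apply: (@integrableS _ (measurableTypeR R) R mu (`[x, 1] `|` `]1, +oo[)) => //.
- exact: measurableU.
- move=> y /=; rewrite !in_itv/= !andbT => xy; rewrite xy/=.
  by case: leP => _; [left|right].
- apply: integrable_setU => //.
  + by apply/disj_setPS => y [/=]; rewrite !in_itv/= => /andP[_ y1] /andP[]; rewrite ltNge y1.
  + exact: powRh_integrable.
  + by apply: integrableS inty => //; apply: subset_itvr; rewrite bnd_simp.
Qed.

Definition Am (c x : R) := \int[mu]_(s in `]0, x]) (s `^ (- m - 1) * (h s - c)).
Definition Bn (c x : R) := \int[mu]_(s in `[x, +oo[) (s `^ (- n - 1) * (h s - c)).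

Lemma shiftE (p c : R) : (fun s : R => s `^ p * (h s - c)) =
  (fun s : R => s `^ p * h s + (- c) * s `^ p).
Proof. by apply/funext => s; rewrite mulrBr mulNr (mulrC c). Qed.

Lemma integrable_shift (D : set R) p c : measurable D ->
  mu.-integrable D (EFin \o (fun s : R => s `^ p * h s)) ->
  mu.-integrable D (EFin \o (fun s : R => s `^ p)) ->
  mu.-integrable D (EFin \o (fun s : R => s `^ p * (h s - c))).
Proof.
move=> mD ih ip; rewrite shiftE; apply: integrable_add => //; exact: integrable_scale.
Qed.

Lemma Rintegral_shift (D : set R) p c : measurable D ->
  mu.-integrable D (EFin \o (fun s : R => s `^ p * h s)) ->
  mu.-integrable D (EFin \o (fun s : R => s `^ p)) ->
  \int[mu]_(s in D) (s `^ p * (h s - c)) =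
  \int[mu]_(s in D) (s `^ p * h s) - c * \int[mu]_(s in D) (s `^ p).
Proof.
move=> mD ih ip; rewrite shiftE RintegralD//; last first.
  exact: integrable_scale.
by rewrite RintegralZl// mulNr.
Qed.

Lemma Am_integrable (c x : R) : 0 < x ->
  mu.-integrable `]0, x] (EFin \o (fun s : R => s `^ (- m - 1) * (h s - c))).
Proof.
move=> x0; apply: integrable_shift => //; first exact: powRh_integrable0.
by apply: powR_integrable0; rewrite ?oppr_gt0.
Qed.

Lemma Bn_integrable (c x : R) : 0 < x ->
  mu.-integrable `[x, +oo[ (EFin \o (fun s : R => s `^ (- n - 1) * (h s - c))).
Proof.
move=> x0; apply: integrable_shift => //; first exact: powRh_integrabley.
by apply: powR_integrabley; rewrite ?oppr_lt0.
Qed.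

Lemma itv_integrable (a b p c : R) : 0 < a ->
  mu.-integrable `[a, b] (EFin \o (fun s : R => s `^ p * (h s - c))).
Proof.
move=> a0; apply: integrable_shift => //; first exact: powRh_integrable.
exact: powR_integrable.
Qed.

Lemma Am_itv (c a b : R) : 0 < a -> a <= b ->
  \int[mu]_(s in `[a, b]) (s `^ (- m - 1) * (h s - c)) = Am c b - Am c a.
Proof.
move=> a0 ab; rewrite /Am Rintegral_itvB ?bnd_simp//.
- rewrite Rintegral_itv_obnd_cbnd//.
  apply: integrableS (itv_integrable b _ c a0) => //.
  exact: subset_itv_oc_cc.
- exact/Am_integrable/(lt_le_trans a0).
- exact: ltW.
Qed.

Lemma Bn_itv (c a b : R) : 0 < a -> a <= b ->
  \int[mu]_(s in `[a, b]) (s `^ (- n - 1) * (h s - c)) = Bn c a - Bn c b.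
Proof.
move=> a0 ab; have b0 := lt_le_trans a0 ab.
have := @Rintegral_itvB R (fun s : R => s `^ (- n - 1) * (h s - c)) (BLeft a) (BInfty _ false) b (Bn_integrable c a0).
rewrite !bnd_simp => /(_ ab isT).
rewrite [in RHS]Rintegral_itv_obnd_cbnd//; last first.
  apply: integrableS (Bn_integrable c b0) => //.
  by apply: subset_itvr; rewrite bnd_simp.
by rewrite /Bn => <-; rewrite subKr.
Qed.

(** Since [m < 0], the weight s^(-m-1) has a primitive that vanishes at [0]. This formula and [BnE]
    are what allow the level [c] to be chosen afresh at every use. *)
Lemma AmE (c c' x : R) : 0 < x -> Am c x = Am c' x + (c - c') * x `^ (- m) / m.
Proof.
move=> x0; rewrite /Am !Rintegral_shift//; try exact: powRh_integrable0;
  try by apply: powR_integrable0; rewrite ?oppr_gt0.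
rewrite Rintegral_powR0 ?oppr_gt0// invrN.
ring.
Qed.

Lemma BnE (c c' x : R) : 0 < x -> Bn c x = Bn c' x - (c - c') * x `^ (- n) / n.
Proof.
move=> x0; have n'0 : - n < 0 by rewrite oppr_lt0.
rewrite /Bn !Rintegral_shift//; try exact: powRh_integrabley;
  try exact: powR_integrabley.
suff -> : \int[mu]_(s in `[x, +oo[) (s `^ (- n - 1)) = 0 - (- n)^-1 * x `^ (- n).
  by rewrite sub0r invrN; ring.
apply: (@Rintegral_ge0_continuous_FTC2y _ _ (fun s => (- n)^-1 * s `^ (- n))) => //.
- by move=> y _; exact: powR_ge0.
- apply: continuous_in_subspaceT => y /[!inE] /=; rewrite in_itv/= andbT => xy.
  exact/powR_continuous/(lt_le_trans x0).
- rewrite -[X in _ --> X](mulr0 (- n)^-1); apply: cvgMr.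
  apply/cvgrPdist_lt => e e0.
  have [M [_ M0 Me]] := powR_large e^-1 0 n0.
  near=> y; have yM : M <= y by near: y; apply: nbhs_pinfty_ge; exact: num_real.
  have y0 := lt_le_trans M0 yM.
  rewrite sub0r normrN powRN ger0_norm ?invr_ge0 ?powR_ge0//.
  rewrite -[ltRHS]invrK ltf_pV2 ?posrE ?invr_gt0 ?powR_gt0//.
  by rewrite (lt_le_trans Me)// powR_lep.
- move=> y xy; apply: derivableZ; apply: derivable_powR.
  by rewrite in_itv/= andbT (lt_trans x0).
- by apply: cvg_at_right_filter; apply: cvgMr; exact: powR_continuous.
- move=> y; rewrite in_itv/= andbT => xy.
  have y0 := lt_trans x0 xy.
  have d := is_deriveZ (- n)^-1 (is_derive1_powR (- n) y0).
  by rewrite derive1E (@derive_val _ _ _ _ _ _ _ d) /GRing.scale/= mulrA mulVf ?mul1r// oppr_eq0 gt_eqF.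
Unshelve. all: by end_near. Qed.

(** The Green kernel and its derivative, with their outer point frozen, are combinations of these
    two powers, with [be] and [ga] depending on that point. *)
Lemma combE (a b be ga c : R) : 0 < a -> a <= b ->
  \int[mu]_(s in `[a, b]) ((be * s `^ (- n - 1) + ga * s `^ (- m - 1)) * (h s - c)) =
  be * (Bn c a - Bn c b) + ga * (Am c b - Am c a).
Proof.
move=> a0 ab.
rewrite (_ : (fun s : R => _) = (fun s : R => be * (s `^ (- n - 1) * (h s - c)) +
   ga * (s `^ (- m - 1) * (h s - c)))); last first.
  by apply/funext => s; rewrite mulrDl !mulrA.
have iB := itv_integrable b (- n - 1) c a0.
have iA := itv_integrable b (- m - 1) c a0.
rewrite RintegralD//; last 2 first.
- exact: integrable_scale.
- exact: integrable_scale.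
by rewrite !RintegralZl// Am_itv// Bn_itv.
Qed.

Lemma comb_integrable (a b be ga c : R) : 0 < a -> mu.-integrable `[a, b]
  (EFin \o (fun s : R => (be * s `^ (- n - 1) + ga * s `^ (- m - 1)) * (h s - c))).
Proof.
move=> a0.
rewrite (_ : (fun s : R => _) = (fun s : R => be * (s `^ (- n - 1) * (h s - c)) +
   ga * (s `^ (- m - 1) * (h s - c)))); last first.
  by apply/funext => s; rewrite mulrDl !mulrA.
by apply: integrable_add => //; apply: integrable_scale => //; exact: itv_integrable.
Qed.

Lemma comb_oo (a b be ga c : R) : 0 < a -> a <= b ->
  \int[mu]_(s in `]a, b[) ((be * s `^ (- n - 1) + ga * s `^ (- m - 1)) * (h s - c)) =
  be * (Bn c a - Bn c b) + ga * (Am c b - Am c a).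
Proof.
move=> a0 ab; rewrite -combE//.
have int := comb_integrable b be ga c a0.
rewrite Rintegral_itv_bndo_bndc.
  rewrite Rintegral_itv_obnd_cbnd//; apply: integrableS int => //.
  exact: subset_itv_oc_cc.
by apply: integrableS int => //; exact: subset_itv_oo_cc.
Qed.

(** The sign is asked on the open interval only, so a jump of [h] at an endpoint is harmless, and
    without the common positive factor 1/s of the two weights. *)
Lemma comb_ge0 (a b be ga c : R) : 0 < a -> a <= b ->
  (forall s, a < s < b -> 0 <= (be * s `^ (- n) + ga * s `^ (- m)) * (h s - c)) ->
  0 <= be * (Bn c a - Bn c b) + ga * (Am c b - Am c a).
Proof.
move=> a0 ab pos; rewrite -comb_oo//; apply: Rintegral_ge0 => s /=.
rewrite in_itv/= => /[dup] /andP[sa sb] /pos; have s0 := lt_trans a0 sa.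
rewrite !powRB1// !powRN 2!mulrA -mulrDl mulrAC => p.
by rewrite mulr_ge0// invr_ge0 ltW.
Qed.

Lemma comb_gt0 (a b be ga c s1 s2 : R) : 0 < a -> a <= s1 -> s1 < s2 -> s2 <= b ->
  (forall s, a < s < b -> 0 <= (be * s `^ (- n) + ga * s `^ (- m)) * (h s - c)) ->
  (forall s, s1 < s < s2 -> 0 < (be * s `^ (- n) + ga * s `^ (- m)) * (h s - c)) ->
  0 < be * (Bn c a - Bn c b) + ga * (Am c b - Am c a).
Proof.
move=> a0 as1 s12 s2b pos spos.
have ab : a < b by rewrite (le_lt_trans as1)// (lt_le_trans s12).
rewrite -comb_oo//; last exact: ltW.
have E s : a < s -> (be * s `^ (- n - 1) + ga * s `^ (- m - 1)) * (h s - c) =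
   (be * s `^ (- n) + ga * s `^ (- m)) * (h s - c) * s^-1.
  move=> sa; have s0 := lt_trans a0 sa.
  by rewrite !powRB1// !powRN 2!mulrA -mulrDl mulrAC.
apply: (@Rintegral_gt0 _ _ s1 s2) => //.
- by apply: integrableS (comb_integrable b be ga c a0) => //; exact: subset_itv_oo_cc.
- by apply: subset_itv; rewrite bnd_simp.
- move=> s /=; rewrite in_itv/= => /[dup] /andP[sa sb] /pos p.
  by rewrite E// mulr_ge0// invr_ge0 (le_trans (ltW a0))// ltW.
- move=> s /[dup] /andP[/(le_lt_trans as1) sa sb] /spos p.
  by rewrite E// mulr_gt0// invr_gt0 (lt_trans a0).
Qed.

Lemma Bn_gt0 (c x : R) : 0 < x -> (exists2 M, x <= M & c < h M) -> c <= h x ->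
  0 < Bn c x.
Proof.
move=> x0 [M xM cM] cx; apply: (@Rintegral_gt0 _ _ M (M + 1)) => //.
- exact: Bn_integrable.
- by rewrite ltrDl.
- by apply: subset_itv; rewrite bnd_simp.
- move=> s /=; rewrite in_itv/= andbT => xs.
  by rewrite mulr_ge0// ?powR_ge0// subr_ge0 (le_trans cx)// h_inc.
- move=> s /andP[Ms _]; have M0 := lt_le_trans x0 xM.
  rewrite mulr_gt0 ?powR_gt0 ?(lt_trans M0 Ms)// subr_gt0 (lt_le_trans cM)//.
  by rewrite h_inc// ltW.
Qed.

Lemma Am_lt0 (c x : R) : 0 < x -> h x < c -> Am c x < 0.
Proof.
move=> x0 hx; rewrite -oppr_gt0 -mulN1r /Am -RintegralZl//; last exact: Am_integrable.
apply: (@Rintegral_gt0 _ _ 0 x) => //.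
- by apply: integrable_scale => //; exact: Am_integrable.
- exact: subset_itv_oo_oc.
- move=> s /=; rewrite in_itv/= => /andP[s0 sx].
  rewrite mulrCA mulr_ge0// ?powR_ge0// mulN1r opprB subr_ge0 ltW//.
  by rewrite (le_lt_trans _ hx)// h_inc.
- move=> s /andP[s0 sx].
  rewrite mulrCA mulr_gt0// ?powR_gt0// mulN1r opprB subr_gt0//.
  by rewrite (le_lt_trans _ hx)// h_inc// ltW.
Qed.

(** Beyond a point [M0] where [h] is nonnegative, monotone convergence of the integrals over the
    intervals from [M0] to [M0 + i] leaves an arbitrarily small tail. *)
Lemma Bn_small (e M : R) : h x @[x --> +oo] --> +oo -> 0 < e ->
  exists2 x, M <= x /\ 0 < x & Bn 0 x < e.
Proof.
move=> hy e0.
have [M0 [M1 M2 hM]] : exists M0, [/\ M <= M0, 0 < M0 & forall s, M0 <= s -> 0 <= h s].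
  have /cvgryPge/(_ 0)[N [_ HN]] := hy.
  exists (Num.max (Num.max M 1) (N + 1)); split; rewrite ?le_max ?lt_max ?lexx ?ltr01 ?orbT//.
  move=> s; rewrite ge_max => /andP[_ Ns]; apply: HN.
  by rewrite (lt_le_trans _ Ns)// ltrDl.
have := @ge0_nondecreasing_set_cvg_integral _ (measurableTypeR R) R
  (fun i => `[M0, M0 + i%:R]%classic) (EFin \o (fun s => s `^ (- n - 1) * (h s - 0))) mu
  (@nondecreasing_itvcy _ M0).
rewrite -bigcup_itvcy => /(_ _)/wrap[]//.
have mf D : measurable D -> D `<=` `[M0, +oo[%classic ->
    measurable_fun D (EFin \o (fun s => s `^ (- n - 1) * (h s - 0))).
  move=> mD DM; apply: (measurable_funS _ DM) => //.
  exact: measurable_int (Bn_integrable 0 M2).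
move=> /(_ _)/wrap[].
  by move=> i; apply: mf => // x /=; rewrite !in_itv/= andbT => /andP[].
move=> /(_ _)/wrap[].
  move=> i x /=; rewrite in_itv/= => /andP[/hM hx _].
  by rewrite lee_fin subr0 mulr_ge0// powR_ge0.
rewrite (_ : (fun i => _) = EFin \o (fun i => Bn 0 M0 - Bn 0 (M0 + i%:R))); last first.
  apply/funext => i; rewrite /= -Bn_itv ?lerDl// /Rintegral fineK//.
  apply: integrable_fin_num => //.
  exact: itv_integrable.
rewrite -[X in _ --> X]fineK; last first.
  apply: integrable_fin_num => //; exact: Bn_integrable.
move=> /fine_cvg /cvgrPdist_lt/(_ _ e0)[N _ /(_ N (leqnn _))] /=.
rewrite -/(Rintegral _ _ _) -/(Bn 0 M0) opprB addrCA subrr addr0 => /ltr_normlW ?.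
exists (M0 + N%:R) => //; split; first by rewrite (le_trans M1)// lerDl.
by rewrite ltr_wpDr.
Qed.

End weighted_integrals.

(** * One-dimensional calculus *)

Section calculus.
Context {R : realType}.
Implicit Types (f g : R -> R) (x d : R).

(** A bound on the increment replaces the limit of the difference quotient; such a bound can be
    checked separately on the two sides of a junction, which is what pasting needs. *)
Lemma is_derive_near f x d :
  (forall e, 0 < e -> \forall y \near x, `|f y - f x - d * (y - x)| <= e * `|y - x|) ->
  is_derive x 1 f d.
Proof.
move=> H.
have cv : (fun k : R => k^-1 *: (f (k *: (1 : R) + x) - f x)) @ 0^' --> d.
  apply/cvgrPdist_le => e e0; have [eps eps0 He] := H _ e0.
  exists eps => // k; rewrite /ball_ /= sub0r normrN => ke k0.
  rewrite /GRing.scale /= mulr1.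
  have := He (k + x); rewrite /ball/= opprD addrCA subrr addr0 normrN addrK => /(_ ke) Hk.
  have -> : d - k^-1 * (f (k + x) - f x) = - (k^-1 * (f (k + x) - f x - d * k)) by field.
  by rewrite normrN normrM normfV mulrC ler_pdivrMr// normr_gt0.
split; first by apply/cvg_ex; exists d.
exact/cvg_lim.
Qed.

Lemma near_is_derive f x d : is_derive x 1 f d ->
  forall e, 0 < e -> \forall y \near x, `|f y - f x - d * (y - x)| <= e * `|y - x|.
Proof.
move=> [/cvg_ex[l cl] dE] e e0.
have ld : l = d by rewrite -dE; apply/esym/cvg_lim.
move: cl; rewrite ld => /cvgrPdist_le/(_ e e0) H.
case: H => eps eps0 He; exists eps => // y; rewrite /ball/= distrC => yx.
have [->|k0] := eqVneq y x; first by rewrite !subrr mulr0 subrr normr0 mulr0.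
have := He (y - x); rewrite /= sub0r normrN subr_eq0 => /(_ yx k0).
rewrite /GRing.scale /= mulr1 subrK => Hk; rewrite -subr_eq0 in k0.
have -> : f y - f x - d * (y - x) = - ((y - x) * (d - (y - x)^-1 * (f y - f x))) by field.
by rewrite normrN normrM mulrC ler_wpM2r.
Qed.

Lemma is_derive_glue f g x d : is_derive x 1 f d -> is_derive x 1 g d -> f x = g x ->
  is_derive x 1 (fun y => if y <= x then f y else g y) d.
Proof.
move=> /near_is_derive Hf /near_is_derive Hg fg; apply: is_derive_near => e e0.
have He := Hf _ e0; have Ge := Hg _ e0; near=> y; rewrite lexx.
have Fy : `|f y - f x - d * (y - x)| <= e * `|y - x| by near: y.
have Gy : `|g y - g x - d * (y - x)| <= e * `|y - x| by near: y.
by case: (leP y x) => yx; [exact: Fy|rewrite fg; exact: Gy].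
Unshelve. all: by end_near. Qed.

Lemma continuous_glue f g x : {for x, continuous f} -> {for x, continuous g} ->
  f x = g x -> {for x, continuous (fun y => if y <= x then f y else g y)}.
Proof.
move=> cf cg fg; apply/cvgrPdist_le => e e0; rewrite lexx.
move/cvgrPdist_le : cf => /(_ e e0) Hf; move/cvgrPdist_le : cg => /(_ e e0) Hg.
near=> y; have Fy : `|f x - f y| <= e by near: y; exact: Hf.
have Gy : `|g x - g y| <= e by near: y; exact: Hg.
by case: (leP y x) => yx; [exact: Fy|rewrite fg; exact: Gy].
Unshelve. all: by end_near. Qed.

Lemma is_derive_continuous f x d : is_derive x 1 f d -> {for x, continuous f}.
Proof.
by move=> [df _]; apply: differentiable_continuous; apply/derivable1_diffP.
Qed.

Lemma is_derive_ext f g x d : (\forall y \near x, f y = g y) ->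
  is_derive x 1 f d -> is_derive x 1 g d.
Proof.
move=> fg /near_is_derive Hf; apply: is_derive_near => e e0.
near=> y; have <- : f y = g y by near: y.
by rewrite -(nbhs_singleton fg); near: y; exact: Hf.
Unshelve. all: by end_near. Qed.

Lemma continuous_ext f g x : (\forall y \near x, f y = g y) ->
  {for x, continuous f} -> {for x, continuous g}.
Proof.
move=> fg cf; rewrite /prop_for /continuous_at -(nbhs_singleton fg).
by apply: cvg_trans cf; apply: near_eq_cvg; apply: filterS fg => y ->.
Qed.

Lemma is_derive_gt0_right f x d b : is_derive x 1 f d -> 0 < d -> x < b ->
  exists2 y, x < y < b & f x < f y.
Proof.
move=> /near_is_derive H d0 xb.
have d2 : 0 < d / 2 by rewrite divr_gt0.
have [y [xy Hy]] : exists y, x < y < b /\ `|f y - f x - d * (y - x)| <= d / 2 * `|y - x|.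
  have [e e0 He] := H _ d2.
  pose y := x + Num.min (e / 2) ((b - x) / 2).
  have m0 : 0 < Num.min (e / 2) ((b - x) / 2) by rewrite lt_min !divr_gt0// subr_gt0.
  exists y; split.
    have : Num.min (e / 2) ((b - x) / 2) <= (b - x) / 2 by rewrite ge_min lexx orbT.
    by rewrite /y; move: m0 xb; set k := Num.min _ _ => *; apply/andP; split; lra.
  apply: He; rewrite /ball/= /y opprD addNKr normrN gtr0_norm//.
  have : Num.min (e / 2) ((b - x) / 2) <= e / 2 by rewrite ge_min lexx.
  by move: e0; set k := Num.min _ _ => /= *; lra.
exists y => //; move: xy Hy => /andP[xy _].
rewrite (gtr0_norm (_ : 0 < y - x)) ?subr_gt0// ler_norml => /andP[+ _].
have : 0 < d / 2 * (y - x) by rewrite mulr_gt0// subr_gt0.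
lra.
Qed.

Lemma is_derive_lt0_right f x d b : is_derive x 1 f d -> d < 0 -> x < b ->
  exists2 y, x < y < b & f y < f x.
Proof.
move=> df d0 xb.
have dN : is_derive x 1 (- f) (- d) by exact: is_deriveN.
have nd : 0 < - d by rewrite oppr_gt0.
have [y xy fxy] := is_derive_gt0_right dN nd xb.
by exists y => //; rewrite -ltrN2.
Qed.

Lemma is_derive_homo f df a b : a < b ->
  (forall x, a <= x <= b -> is_derive x 1 f (df x)) ->
  (forall x, a < x < b -> 0 < df x) -> f a < f b.
Proof.
move=> ab D pos.
have [||x xab fba] := @MVT _ f df a b ab.
- by move=> x /[!in_itv]/= /andP[xa xb]; apply: D; rewrite !ltW.
- apply: continuous_in_subspaceT => x /[!inE] /=; rewrite in_itv/= => xab.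
  exact: is_derive_continuous (D _ xab).
by rewrite -subr_gt0 fba mulr_gt0 ?subr_gt0// pos//; move: xab; rewrite in_itv.
Qed.

End calculus.

(** * Potential of a drifted Brownian motion *)

Section joint_measurability.
Context d (T : measurableType d) (R : realType).
Local Notation mu := (@lebesgue_measure R).

(** Truncation to a natural number gives [0] on negative reals, hence the limit [Num.max 0 t]. This
    suits the paths, which are controlled at nonnegative times only. *)
Lemma truncn_div_cvg (t : R) :
  (Num.truncn (t * i.+1%:R))%:R / i.+1%:R @[i --> \oo] --> Num.max 0 t.
Proof.
apply/cvgrPdist_lt => e e0.
near=> i.
have ei : i.+1%:R^-1 < e by near: i; exact: (near_infty_natSinv_lt (PosNum e0)).
have i0 : 0 < i.+1%:R :> R by [].
case: (leP 0 t) => t0; last first.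
  rewrite (_ : Num.truncn _ = 0%N) ?mul0r ?subr0 ?normr0//.
  apply/Num.Theory.truncn0Pn; rewrite -ltNge (le_lt_trans _ ltr01)//.
  by rewrite nmulr_rle0// ltW.
have /andP[le_t lt_t] := @Num.Theory.truncn_itv R (t * i.+1%:R) (mulr_ge0 t0 (ltW i0)).
rewrite -ler_pdivrMr// in le_t; rewrite -ltr_pdivlMr// -natr1 mulrDl mul1r in lt_t.
by rewrite ger0_norm ?subr_ge0// ltrBlDl (lt_trans lt_t)// ltrD2l.
Unshelve. all: by end_near. Qed.

(** The path is the pointwise limit of its values at the grid times [j / (i + 1)], and preimages
    under such a step process are countable unions of measurable rectangles. *)
Lemma measurable_path (X : R -> T -> R) :
  (forall t, measurable_fun setT (X t)) ->
  (forall w, {within `[0, +oo[, continuous (fun t => X t w)}) ->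
  measurable_fun setT (fun z : T * R => X (Num.max 0 z.2) z.1).
Proof.
move=> mX cX.
pose Y (i : nat) (z : T * R) := X ((Num.truncn (z.2 * i.+1%:R))%:R / i.+1%:R) z.1.
apply: (@measurable_fun_cvg _ _ _ _ Y).
- move=> i _ B mB; rewrite setTI.
  have -> : Y i @^-1` B = \bigcup_j
      ((X (j%:R / i.+1%:R) @^-1` B) `*` [set t : R | Num.truncn (t * i.+1%:R) = j]).
    apply/seteqP; split => [z Bz|z [j _ [/= + Ej]]]; last by rewrite /Y /= Ej.
    by exists (Num.truncn (z.2 * i.+1%:R)).
  apply: bigcupT_measurable => j; apply: measurableX.
    by rewrite -[X in measurable X]setTI; exact: mX.
  apply: is_interval_measurable => s t /= sj tj u /andP[su ut].
  by apply/eqP; rewrite eqn_leq -{1}tj -sj !Num.Theory.le_truncn// ler_pM2r.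
- move=> -[w t] _; rewrite /Y /=.
  have lim := @truncn_div_cvg t.
  have ge0 : forall i, 0 <= (Num.truncn (t * i.+1%:R))%:R / i.+1%:R :> R.
    by move=> i; rewrite divr_ge0.
  move/continuous_within_itvcyP : (cX w) => [cin c0].
  have m0 : 0 <= Num.max 0 t by rewrite le_max lexx.
  (* The grid times are nonnegative, so they converge within the half-line on which the path is
     continuous, also when the limit is its endpoint [0]. *)
  apply: (@cvg_comp _ _ _ _ (fun x => X x w) _ (within (fun u : R => 0 <= u) (nbhs (Num.max 0 t)))).
    move=> A wA; have [N _ HN] := lim _ wA; exists N => // i Ni.
    exact: (HN i Ni (ge0 i)).
  move: m0; rewrite le_eqVlt => /predU1P[<-|m0].
    exact: cvg_at_right_within.
  apply: cvg_within_filter; apply: cin.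
  by rewrite in_itv/= andbT.
Qed.

End joint_measurability.

Section normal_lower_bound.
Context {R : realType}.
Local Notation mu := (@lebesgue_measure R).

Lemma normal_prob_ball (s z0 rad p : R) (B : set R) : measurable B ->
  0 < rad -> 0 <= p -> (forall z, `|z - z0| < rad -> B z /\ p <= normal_pdf 0 s z) ->
  ((p * (rad *+ 2))%:E <= normal_prob 0 s B)%E.
Proof.
move=> mB rad0 p0 sub; rewrite /normal_prob.
have mpdf D : measurable_fun D (fun x : R => (normal_pdf 0 s x)%:E).
  by apply/measurable_EFinP; apply: measurable_funTS; exact: measurable_normal_pdf.
apply: (@le_trans _ _ (\int[mu]_(x in ball z0 rad) (normal_pdf 0 s x)%:E)%E); last first.
  apply: ge0_subset_integral => //.
  - exact: measurable_ball.
  - exact: mpdf.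
  - by move=> x _; rewrite lee_fin normal_pdf_ge0.
  - move=> x; rewrite /ball/= distrC => /sub[]//.
apply: (@le_trans _ _ (\int[mu]_(x in ball z0 rad) p%:E)%E); last first.
  apply: ge0_le_integral => //; [exact: measurable_ball|exact: mpdf|].
  by move=> x; rewrite /ball/= distrC lee_fin => /sub[].
rewrite integral_cst; last exact: measurable_ball.
by rewrite [X in (_ * X)%E](lebesgue_measure_ball _ (ltW rad0)) -EFinM.
Qed.

End normal_lower_bound.

Section potential_of_drifted_brownian_motion.
Context d (T : measurableType d) (R : realType) (P : probability T R).
Local Notation mu := (@lebesgue_measure R).
Variables (W : R -> {RV P >-> R}) (nu c r v : R).
Hypotheses (hW : brownian_motion W) (c0 : c != 0) (r0 : 0 < r) (v_gt0 : 0 < v).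
Hypothesis v2 : v ^+ 2 = nu ^+ 2 + 2 * c ^+ 2 * r.

(** The positive root of c^2 q^2 / 2 + nu q = r: with Y = nu t + c W, the process exp (q Y - r t) is
    a martingale. It is [exp_n] for log X and [- exp_m] for - log X. *)
Let q := (v - nu) / c ^+ 2.

Let c2_gt0 : 0 < c ^+ 2. Proof. by rewrite exprn_even_gt0. Qed.

Let q_ge0 : 0 <= q.
Proof.
apply: divr_ge0; last exact: ltW.
have cr := mulr_gt0 c2_gt0 r0.
rewrite subr_ge0; have [n0|n0] := leP nu 0; first by rewrite (le_trans n0)// ltW.
by rewrite -(ler_pXn2r (n := 2))// ?nnegrE ?ltW// v2; lra.
Qed.

(** Only increments have a prescribed law, and [W 0] vanishes merely almost surely; the events for
    [W t] and for [W t - W 0] are therefore compared outside a measurable null set. *)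
Lemma bm_density (t : R) (B : set R) : 0 < t -> measurable B ->
  P [set w | B (W t w)] = normal_prob 0 (Num.sqrt t) B.
Proof.
move=> t0 mB; have [[N [mN N0 subN]] /(_ 0 t (lexx _) t0 B mB) + _ _] := hW.
rewrite subr0 => <-.
have mW : measurable [set w | B (W t w)].
  by rewrite -[X in measurable X]setTI; exact: (measurable_funPT (W t)).
have mD : measurable [set w | B (W t w - W 0 w)].
  rewrite -[X in measurable X]setTI.
  exact: (measurable_funB (measurable_funPT (W t)) (measurable_funPT (W 0))).
have E w : ~ N w -> W 0 w = 0 by move=> Nw; apply: contrapT => H; apply/Nw/subN.
have half (A B' : set T) : measurable A -> measurable B' ->
    (forall w, ~ N w -> A w -> B' w) -> (P A <= P B')%E.
  move=> mA mB' AB; apply: (@le_trans _ _ (P (B' `|` N))).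
    apply: le_measure; rewrite ?inE//; first exact: measurableU.
    by move=> w Aw; have [Nw|Nw] := pselect (N w); [right|left; exact: AB].
  by apply: (le_trans (measureU2 _ _ _)) => //; rewrite [X in (_ + X)%E]N0 adde0.
by apply/eqP; rewrite eq_le; apply/andP; split; apply: half => // w /E /= ->; rewrite subr0.
Qed.

(* Change of drift from [nu] to [v]: the discounted density of the process at time
   [t] is [exp (- q y)] times a Gaussian density centred at [v t]. *)
Let exponent (t z y : R) : 0 < t -> c * z = y - nu * t ->
  r * t + z ^+ 2 / (t *+ 2) = q * y + (v * t - y) ^+ 2 / (2 * c ^+ 2 * t).
Proof.
move=> t0 zE; have t0' : t != 0 by rewrite gt_eqF.
have -> : z = (y - nu * t) / c by rewrite -zE; field.
have -> : r = (v ^+ 2 - nu ^+ 2) / (2 * c ^+ 2) by rewrite v2; field.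
by rewrite /q mulr2n; field; rewrite t0' c0.
Qed.

(** For t <= 2 s^2 / v the Gaussian peak at time t is at least 1 / (s sqrt (4 pi / v)), which
    explains the first factor once v / s is split off. A unit interval for the process has length 1
    / |c| for [W]. The factor exp (- q) pays for levels up to s^2 + 1, and exp (- v / (2 c^2)) is
    the Gaussian factor bounded in [window]. *)
Let K := (v * Num.sqrt (4 * pi / v))^-1 * `|c|^-1 * expR (- q - v / (2 * c ^+ 2)).

Let K_gt0 : 0 < K.
Proof.
rewrite !mulr_gt0 ?expR_gt0// invr_gt0 ?normr_gt0// mulr_gt0// sqrtr_gt0.
by rewrite !mulr_gt0 ?pi_gt0 ?invr_gt0.
Qed.

(** Both s^2 and v t lie above y - 1 and |v t - y| <= s, so (v t - y)^2 <= s^2 <= v t: the exponent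
    is bounded uniformly in [s]. Here [s] is the square root of the level. *)
Let window (s t y : R) : 1 <= s -> s ^+ 2 <= v * t <= s ^+ 2 + s ->
  s ^+ 2 < y < s ^+ 2 + 1 ->
  (v * t - y) ^+ 2 / (2 * c ^+ 2 * t) <= v / (2 * c ^+ 2).
Proof.
move=> s1 /andP[vt1 vt2] /andP[y1 y2].
have s0 : 0 < s by lra.
have t0 : 0 < t by rewrite -(pmulr_rgt0 _ v_gt0) (lt_le_trans _ vt1)// exprn_gt0.
have cc : 0 < 2 * c ^+ 2 by rewrite mulr_gt0.
have ct : 0 < 2 * c ^+ 2 * t by rewrite mulr_gt0.
rewrite ler_pdivrMr// mulrA divfK ?gt_eqF// (le_trans _ vt1)//.
have : `|v * t - y| <= s by rewrite ler_norml; apply/andP; split; lra.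
by move=> le; rewrite -real_normK ?num_real// lerXn2r// ?nnegrE// ltW.
Qed.

Lemma bm_window_prob (s t : R) : 1 <= s -> s ^+ 2 <= v * t <= s ^+ 2 + s ->
  ((K * (v / s) * expR (- q * s ^+ 2))%:E <=
   (expR (- r * t))%:E * P [set w | (s ^+ 2 <= nu * t + c * W t w < s ^+ 2 + 1)%R])%E.
Proof.
move=> s1 svt; have /andP[vt1 vt2] := svt.
have s0 : 0 < s by lra.
have t0 : 0 < t by rewrite -(pmulr_rgt0 _ v_gt0) (lt_le_trans _ vt1)// exprn_gt0.
pose B := [set z : R | s ^+ 2 <= nu * t + c * z < s ^+ 2 + 1].
have mB : measurable B.
  have mf : measurable_fun setT (fun z : R => nu * t + c * z).
    by apply: measurable_funD => //; exact: measurable_funM.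
  have := mf measurableT `[s ^+ 2, s ^+ 2 + 1[%classic (measurable_itv _).
  by rewrite setTI; congr measurable; apply/seteqP; split => z /=; rewrite in_itv.
rewrite (@bm_density t B t0 mB).
have st0 : Num.sqrt t != 0 by rewrite gt_eqF// sqrtr_gt0.
have cn0 : 0 < `|c| by rewrite normr_gt0.
pose p := normal_peak (Num.sqrt t) * expR (r * t - q * (s ^+ 2 + 1) - v / (2 * c ^+ 2)).
have p0 : 0 <= p by rewrite mulr_ge0 ?normal_peak_ge0 ?expR_ge0.
apply: (@le_trans _ _ ((expR (- r * t))%:E * (p * ((2 * `|c|)^-1 *+ 2))%:E)%E).
  rewrite -EFinM lee_fin /p.
  have -> : (2 * `|c|)^-1 *+ 2 = `|c|^-1.
    by rewrite mulr2n; field; rewrite gt_eqF.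
  have -> : r * t - q * (s ^+ 2 + 1) - v / (2 * c ^+ 2) =
      r * t + (- q - v / (2 * c ^+ 2)) + - q * s ^+ 2 by ring.
  have eE : expR (- r * t) = (expR (r * t))^-1 by rewrite mulNr expRN.
  have ert : expR (r * t) != 0 by rewrite gt_eqF// expR_gt0.
  rewrite expRD [expR (r * t + _)]expRD eE.
  rewrite [leRHS](_ : _ = normal_peak (Num.sqrt t) *
    (`|c|^-1 * expR (- q - v / (2 * c ^+ 2)) * expR (- q * s ^+ 2))); last first.
    by field; rewrite ert gt_eqF.
  rewrite [leLHS](_ : _ = (s * Num.sqrt (4 * pi / v))^-1 *
    (`|c|^-1 * expR (- q - v / (2 * c ^+ 2)) * expR (- q * s ^+ 2))); last first.
    rewrite /K; have sq0 : 0 < Num.sqrt (4 * pi / v).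
      by rewrite sqrtr_gt0 !mulr_gt0 ?invr_gt0 ?pi_gt0.
    by field; rewrite !gt_eqF.
  apply: ler_wpM2r; first by rewrite !mulr_ge0 ?expR_ge0// invr_ge0.
  have pi0 := pi_gt0 R.
  rewrite /normal_peak lef_pV2 ?posrE ?sqrtr_gt0; last 2 first.
  - by rewrite mulr_gt0// sqrtr_gt0 !mulr_gt0 ?invr_gt0.
  - by rewrite mulrn_wgt0// mulr_gt0// exprn_gt0// sqrtr_gt0.
  have {1}-> : s = Num.sqrt (s ^+ 2) by rewrite sqrtr_sqr gtr0_norm.
  rewrite -sqrtrM ?sqr_ge0//; apply: ler_wsqrtr.
  rewrite (sqr_sqrtr (ltW t0)) mulr2n.
  have -> : s ^+ 2 * (4 * pi / v) = (s ^+ 2 / v) * 4 * pi by ring.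
  have -> : t * pi + t * pi = (t * 2) * pi by ring.
  rewrite ler_pM2r// mulrAC ler_pdivlMr//.
  have : s <= s ^+ 2 by rewrite expr2 ler_peMl// ltW.
  lra.
apply: lee_pmul; [by rewrite lee_fin expR_ge0| |by []|].
  by rewrite lee_fin mulr_ge0// mulrn_wge0// invr_ge0 mulr_ge0.
(* The map z -> nu t + c z sends the ball of this centre and of radius 1 / (2 |c|) onto the open
   interval from s^2 to s^2 + 1. *)
apply: (@normal_prob_ball _ _ ((s ^+ 2 + 2^-1 - nu * t) / c)) => //.
  by rewrite invr_gt0 mulr_gt0.
move=> z zr.
have {}zr : `|c * z - (s ^+ 2 + 2^-1 - nu * t)| < 2^-1.
  have -> : c * z - (s ^+ 2 + 2^-1 - nu * t) = c * (z - (s ^+ 2 + 2^-1 - nu * t) / c).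
    by field.
  by rewrite normrM mulrC -ltr_pdivlMr// -invfM.
move: zr; rewrite ltr_norml => /andP[z1 z2].
have yI : s ^+ 2 < nu * t + c * z < s ^+ 2 + 1 by apply/andP; split; lra.
split; first by case/andP: yI => /ltW y1 y2; apply/andP.
rewrite normal_pdfE// /p ler_wpM2l ?normal_peak_ge0// /normal_fun ler_expR subr0.
rewrite (sqr_sqrtr (ltW t0)) mulNr.
have := @exponent t z (nu * t + c * z) t0 (ltac:(ring)).
have := @window s t _ s1 svt yI.
have : q * (nu * t + c * z) <= q * (s ^+ 2 + 1) by case/andP: yI => _ /ltW; exact: ler_wpM2l.
lra.
Qed.

Let Z (z : T * R) : R := nu * z.2 + c * W (Num.max 0 z.2) z.1.

Let mZ : measurable_fun setT Z.
Proof.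
apply: measurable_funD; apply: measurable_funM => //.
apply: (@measurable_path _ _ _ (fun t w => W t w)) => [t|]; first exact: measurable_funPT.
by case: hW.
Qed.

(** The indicator confines the integrand to nonnegative times, so that Tonelli's theorem can be
    applied on the whole product space. *)
Let g (f : R -> R) (z : T * R) : R := \1_(`[0%R, +oo[%classic) z.2 * (expR (- r * z.2) * f (Z z)).

Let mg f : measurable_fun setT f -> measurable_fun setT (EFin \o g f).
Proof.
move=> mf; apply/measurable_EFinP; apply: measurable_funM.
  by apply: measurableT_comp => //; exact: measurable_indic.
apply: measurable_funM; last exact: (measurableT_comp mf mZ).
by apply: measurableT_comp => //; exact: measurable_funM.
Qed.

Let g_ge0 f z : (forall x, 0 <= f x) -> (0 <= (g f z)%:E)%E.
Proof. by move=> f0; rewrite lee_fin !mulr_ge0 ?expR_ge0. Qed.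

Let win (s : R) : R -> R := \1_(`[s ^+ 2, s ^+ 2 + 1[%classic).

Let mwin s : measurable_fun setT (win s).
Proof. exact: measurable_indic. Qed.

Let win_ge0 s x : 0 <= win s x. Proof. by []. Qed.

Let tonelli1 (f : R -> R) : measurable_fun setT f -> (forall x, 0 <= f x) ->
  (\int[(P \x mu)%E]_z (g f z)%:E = \int[P]_w \int[mu]_t (g f (w, t))%:E)%E.
Proof.
move=> mf f0; apply: (fubini_tonelli1 (m1 := P) (m2 := mu) (EFin \o g f) (mg mf)).
by move=> z; exact: g_ge0.
Qed.

Let tonelli2 (f : R -> R) : measurable_fun setT f -> (forall x, 0 <= f x) ->
  (\int[(P \x mu)%E]_z (g f z)%:E = \int[mu]_t \int[P]_w (g f (w, t))%:E)%E.
Proof.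
move=> mf f0; apply: (fubini_tonelli2 (m1 := P) (m2 := mu) (EFin \o g f) (mg mf)).
by move=> z; exact: g_ge0.
Qed.

(** The time window has length s / v, and each instant in it contributes at least v / s times the
    bound claimed; the powers of [s] cancel. *)
Lemma potential_window (s : R) : 1 <= s ->
  ((K * expR (- q * s ^+ 2))%:E <= \int[P \x mu]_z (g (win s) z)%:E)%E.
Proof.
move=> s1; have s0 : 0 < s by lra.
rewrite (tonelli2 (mwin s) (win_ge0 s)).
have mG : measurable_fun setT (fun t : R => \int[P]_w (g (win s) (w, t))%:E)%E.
  by apply: (measurable_fun_fubini_tonelli_G (m1 := P) (EFin \o g (win s)) (mg (mwin s))) => z; exact: g_ge0.
set G := (fun t : R => _) in mG *.
pose I := `[s ^+ 2 / v, (s ^+ 2 + s) / v]%classic : set R.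
have G0 t : (0 <= G t)%E by apply: integral_ge0 => w _; exact: g_ge0.
apply: (@le_trans _ _ (\int[mu]_(t in I) G t)%E); last first.
  by apply: ge0_subset_integral; [exact: measurable_itv|exact: measurableT|exact: mG|by []|by []].
apply: (@le_trans _ _ (\int[mu]_(t in I) (K * (v / s) * expR (- q * s ^+ 2))%:E)%E).
  have muI : mu I = (s / v)%:E.
    rewrite /I lebesgue_measure_itv/= lte_fin ltr_pM2r ?invr_gt0//.
    by rewrite ltrDl s0 -EFinD mulrDl addrAC subrr add0r.
  rewrite integral_cst; last exact: measurable_itv.
  rewrite [X in (_ * X)%E]muI -EFinM lee_fin.
  rewrite [leRHS](_ : _ = K * expR (- q * s ^+ 2))//.
  by field; rewrite !gt_eqF.
apply: ge0_le_integral => //.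
- exact: measurable_itv.
- move=> t _; rewrite lee_fin mulr_ge0 ?expR_ge0// mulr_ge0 ?(ltW K_gt0)//.
  by rewrite divr_ge0 ?ltW.
- exact: measurable_funTS.
- move=> t; rewrite /I/= in_itv/= ler_pdivrMr// ler_pdivlMr// mulrC => svt.
  have t0 : 0 < t.
    by case/andP: svt => vt1 _; rewrite -(pmulr_rgt0 _ v_gt0) (lt_le_trans _ vt1)// exprn_gt0.
  apply: (le_trans (bm_window_prob s1 svt)).
  rewrite /G.
  rewrite (_ : (fun x => _) = (fun w => (expR (- r * t))%:E *
     (\1_[set w | (s ^+ 2 <= nu * t + c * W t w < s ^+ 2 + 1)%R] w)%:E)%E); last first.
    apply/funext => w; rewrite /g /Z /win /= -EFinM; congr EFin.
    rewrite indicE mem_set ?mul1r; last by rewrite /= in_itv/= ltW.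
    rewrite !indicE /= max_r ?ltW//; congr (_ * (nat_of_bool _)%:R).
  have mS : measurable [set w | (s ^+ 2 <= nu * t + c * W t w < s ^+ 2 + 1)%R].
    have mf : measurable_fun setT (fun w => nu * t + c * W t w).
      by apply: measurable_funD => //; apply: measurable_funM => //; exact: measurable_funPT.
    have := mf measurableT `[s ^+ 2, s ^+ 2 + 1[%classic (measurable_itv _).
    by rewrite setTI; congr measurable; apply/seteqP; split => z /=; rewrite in_itv.
  rewrite ge0_integralZl_EFin ?expR_ge0//; last first.
    by apply/measurable_EFinP; exact: measurable_indic.
  by rewrite integral_indic// setIT.
Qed.

(** With s^2 = k + 1 the windows are disjoint, so at most one contains [z], and there [a] at the
    left end is at most [a z]. The factor [z < N.+1%:R] carries the induction: the first N windows
    end where the next one starts. *)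
Lemma sum_window_le (a : R -> R) (N : nat) (z : R) :
  (forall x, 0 <= a x) -> nondecreasing_fun a ->
  \sum_(k < N) a k.+1%:R * win (Num.sqrt k.+1%:R) z <= a z * (z < N.+1%:R)%R%:R.
Proof.
move=> a0 ndda; elim: N => [|N IH]; first by rewrite big_ord0 mulr_ge0.
rewrite big_ord_recr /=; apply: (le_trans (lerD IH (lexx _))).
have E2 : N.+2%:R = N.+1%:R + 1 :> R by rewrite natr1.
rewrite /win sqr_sqrtr// indicE E2.
have -> : (z \in `[N.+1%:R, N.+1%:R + 1[%classic) = (N.+1%:R <= z < N.+1%:R + 1).
  by apply/idP/idP; rewrite !inE /= in_itv.
have [zN|zN] := ltP z N.+1%:R.
  by rewrite mulr0 addr0 (lt_trans zN)// ltrDl.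
by rewrite mulr0 add0r /=; apply: ler_wpM2r => //; exact: ndda.
Qed.

(** Two functions are used because |h o exp|, the role of [f], is not monotone; its lower bound [a]
    is the positive part of h o exp or, after reflection, the negative part. *)
Lemma potential_sum (a f : R -> R) : (forall x, 0 <= a x) -> nondecreasing_fun a ->
  (forall x, a x <= f x) -> measurable_fun setT f ->
  (\int[P]_w \int[mu]_(t in `[0%R, +oo[)
     (expR (- r * t) * f (nu * t + c * W t w))%:E < +oo)%E ->
  exists C, forall N, \sum_(k < N) a k.+1%:R * expR (- q * k.+1%:R) <= C.
Proof.
move=> a0 nda af mf; have f0 x : 0 <= f x by exact: le_trans (af x).
rewrite (_ : (\int[P]_w _)%E = (\int[P \x mu]_z (g f z)%:E)%E); last first.
  rewrite (tonelli1 mf f0).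
  apply: eq_integral => w _; rewrite integral_mkcond.
  apply: eq_integral => t _; rewrite patchE /g /Z /= indicE.
  case: ifPn => tI; last by rewrite mul0r.
  by move: tI; rewrite inE /= in_itv/= andbT => t0; rewrite max_r// mul1r.
move=> fin; have K0 := K_gt0.
exists (fine (\int[P \x mu]_z (g f z)%:E)%E / K) => N.
rewrite ler_pdivlMr// -lee_fin fineK; last first.
  by rewrite ge0_fin_numE// integral_ge0// => z _; exact: g_ge0.
apply: (@le_trans _ _ (\int[P \x mu]_z (\sum_(k < N) (a k.+1%:R)%:E * (g (win (Num.sqrt k.+1%:R)) z)%:E))%E).
  rewrite ge0_integral_sum//; last 2 first.
  - by move=> k; exact: (emeasurable_funM (measurable_cst _) (mg (mwin _))).
  - by move=> k z _; apply: mule_ge0; [rewrite lee_fin|exact: g_ge0].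
  rewrite mulr_suml -sumEFin; apply: lee_sum => k _.
  rewrite ge0_integralZl_EFin//; [|by move=> z _; exact: g_ge0|exact: (mg (mwin _))].
  rewrite -mulrA (mulrC (expR _)) EFinM; apply: lee_wpmul2l; first by rewrite lee_fin.
  have := @potential_window (Num.sqrt k.+1%:R); rewrite sqr_sqrtr//; apply.
  by rewrite -[leLHS]sqrtr1 ler_sqrt// ler1n.
apply: ge0_le_integral => //.
- by move=> z _; apply: sume_ge0 => k _; apply: mule_ge0; [rewrite lee_fin|exact: g_ge0].
- apply: emeasurable_sum => k.
  exact: (emeasurable_funM (measurable_cst _) (mg (mwin _))).
- exact: mg.
- move=> z _; rewrite sumEFin lee_fin.
  rewrite (eq_bigr (fun k : 'I_N => \1_(`[0%R, +oo[%classic) z.2 * expR (- r * z.2) *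
     (a k.+1%:R * win (Num.sqrt k.+1%:R) (Z z)))); last by move=> k _; rewrite /g; ring.
  rewrite -mulr_sumr /g mulrA; apply: ler_wpM2l; first by rewrite mulr_ge0 ?expR_ge0.
  apply: (le_trans (sum_window_le N (Z z) a0 nda)); apply: le_trans (af _).
  by rewrite ler_piMr//; case: (_ < _).
Qed.

End potential_of_drifted_brownian_motion.

(** * Integrability of the running payoff *)

Section slabs.
Context {R : realType}.
Local Notation mu := (@lebesgue_measure R).

Lemma integral_slab (a b p M : R) (f : R -> R) : 0 < a -> a <= b -> p != 0 ->
  measurable_fun (`]a, b]%classic : set R) f ->
  (forall s, a <= s <= b -> 0 <= f s <= M) ->
  (\int[mu]_(s in `]a, b]) (s `^ (p - 1) * f s)%:E <= (M * ((b `^ p - a `^ p) / p))%:E)%E.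
Proof.
move=> a0 ab p0 mf fM.
have M0 : 0 <= M.
  have /andP[f0 fa] := fM a (introT andP (conj (lexx a) ab)).
  exact: le_trans fa.
apply: (@le_trans _ _ (\int[mu]_(s in `]a, b]) (M%:E * (s `^ (p - 1))%:E))%E).
  apply: ge0_le_integral => //.
  - move=> s; rewrite /= in_itv/= => /andP[/ltW sa sb].
    by have /andP[f0 _] := fM s (introT andP (conj sa sb)); rewrite lee_fin mulr_ge0// powR_ge0.
  - apply/measurable_EFinP; apply: measurable_funM => //.
    by apply: measurable_funTS; exact: measurable_powR.
  - by apply: emeasurable_funM => //; apply/measurable_EFinP; apply: measurable_funTS; exact: measurable_powR.
  - move=> s; rewrite /= in_itv/= => /andP[/ltW sa sb].
    have /andP[f0 fs] := fM s (introT andP (conj sa sb)).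
    by rewrite -EFinM lee_fin mulrC ler_wpM2r// powR_ge0.
rewrite ge0_integralZl_EFin//; last 2 first.
- by move=> s _; rewrite lee_fin powR_ge0.
- by apply/measurable_EFinP; apply: measurable_funTS; exact: measurable_powR.
rewrite EFinM; apply: lee_wpmul2l; first by rewrite lee_fin.
rewrite -integral_powR//; apply: ge0_subset_integral => //.
- by apply/measurable_EFinP; apply: measurable_funTS; exact: measurable_powR.
- by move=> s _; rewrite lee_fin powR_ge0.
- exact: subset_itv_oc_cc.
Qed.

Lemma integral_bigcup_sum (F J : (set R)^nat) (f : R -> R) (c : nat -> R) (C : R) :
  nondecreasing_seq F -> (forall i, measurable (F i)) -> (forall i, measurable (J i)) ->
  (forall i, measurable_fun (F i) f) -> (forall i x, F i x -> 0 <= f x) ->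
  (\int[mu]_(x in F 0%N) (f x)%:E <= 0)%E ->
  (forall i, F i.+1 = F i `|` J i) -> (forall i, [disjoint F i & J i]) ->
  (forall i, (\int[mu]_(x in J i) (f x)%:E <= (c i)%:E)%E) ->
  (forall N, \sum_(k < N) c k <= C) ->
  (\int[mu]_(x in \bigcup_i F i) (f x)%:E <= C%:E)%E.
Proof.
move=> ndF mF mJ mf f0 F0 FS FJ Jc sumC.
apply: integral_bigcup_le => //.
- by move=> i; apply/measurable_EFinP; exact: mf.
suff H i : (\int[mu]_(x in F i) (f x)%:E <= (\sum_(k < i) c k)%:E)%E.
  by move=> i; apply: (le_trans (H i)); rewrite lee_fin.
elim: i => [|i IH]; first by rewrite big_ord0.
rewrite big_ord_recr /= FS EFinD ge0_integral_setU//.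
- exact: leeD.
- exact: mF.
- exact: mJ.
- by rewrite -FS; apply/measurable_EFinP; exact: mf.
- by move=> x; rewrite -FS => /f0; rewrite lee_fin.
Qed.

Lemma expR_pow (x p : R) : (expR x) `^ p = expR (p * x).
Proof. by rewrite /powR gt_eqF ?expR_gt0// expRK. Qed.

(** On the slab from e^i to e^(i+1), [f] is at most its value at the right end and s^(-q-1) has
    integral at most e^(-qi) / q. The factor e^q / q rewrites this with the weight e^(-q(i+1)) of
    the given sums. *)
Lemma integrable_of_sum_y (f : R -> R) (q C : R) : 0 < q ->
  (forall x, 1 <= x -> 0 <= f x) -> (forall x y, 1 <= x -> x <= y -> f x <= f y) ->
  measurable_fun (`[1, +oo[%classic : set R) f ->
  (forall N, \sum_(k < N) f (expR k.+1%:R) * expR (- q * k.+1%:R) <= C) ->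
  mu.-integrable `[1, +oo[ (EFin \o (fun s : R => s `^ (- q - 1) * f s)).
Proof.
move=> q0 f0 fnd mf sumC.
have e1 (i : nat) : 1 <= expR (i%:R : R) by rewrite -[leLHS]expR0 ler_expR.
have mg : measurable_fun (`[1, +oo[%classic : set R) (fun s : R => s `^ (- q - 1) * f s).
  by apply: measurable_funM => //; apply: measurable_funTS; exact: measurable_powR.
have Eu : `[1, +oo[%classic = \bigcup_i `[1, expR (i%:R : R)]%classic.
  apply/seteqP; split => [y|y [i _]] /=; rewrite !in_itv/= ?andbT; last by case/andP.
  move=> y1; exists (Num.truncn y).+1 => //=; rewrite in_itv/= y1 /=.
  apply: (le_trans _ (expR_ge1Dx _)); rewrite ltW// (lt_le_trans (Num.Theory.truncnS_gt y))//.
  by rewrite lerDr.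
apply/integrableP; split; first exact/measurable_EFinP.
under eq_integral.
  move=> s; rewrite inE /= in_itv/= andbT => s1.
  rewrite ger0_norm; last by rewrite mulr_ge0 ?powR_ge0// f0.
  over.
apply: (@le_lt_trans _ _ (C * (expR q / q))%:E); last by rewrite ltry.
rewrite Eu; apply: (@integral_bigcup_sum _ (fun i => `]expR i%:R, expR i.+1%:R]%classic) _
  (fun i => f (expR i.+1%:R) * expR (- q * i.+1%:R) * (expR q / q))).
- move=> i j ij; apply/subsetPset => y /=; rewrite !in_itv/= => /andP[-> /le_trans yi].
  by rewrite yi// ler_expR ler_nat.
- by move=> i; exact: measurable_itv.
- by move=> i; exact: measurable_itv.
- move=> i; apply: measurable_funS mg => //.
  by move=> y /=; rewrite !in_itv/= andbT => /andP[].
- by move=> i x /=; rewrite in_itv/= => /andP[x1 _]; rewrite mulr_ge0 ?powR_ge0// f0.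
- by rewrite expR0 set_itv1 integral_set1.
- move=> i; rewrite -itv_bndbnd_setU// bnd_simp ?e1// ler_expR ler_nat//.
- move=> i; apply/disj_setPS => y [/=]; rewrite !in_itv/= => /andP[_ yi] /andP[].
  by rewrite ltNge yi.
- move=> i; apply: (le_trans (@integral_slab _ _ _ (f (expR i.+1%:R)) _ _ _ _ _ _)).
  + exact: expR_gt0.
  + by rewrite ler_expR ler_nat.
  + by rewrite oppr_eq0 gt_eqF.
  + apply: measurable_funS mf => // y /=; rewrite !in_itv/= andbT => /andP[/ltW + _].
    exact: le_trans.
  + move=> s /andP[si si1]; have s1 := le_trans (e1 i) si.
    by rewrite f0// fnd.
  + rewrite lee_fin -mulrA; apply: ler_wpM2l; first exact/f0/e1.
    rewrite !expR_pow invrN mulrN -mulNr opprB -[i.+1%:R]natr1 mulrA.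
    apply: ler_wpM2r; first by rewrite invr_ge0 ltW.
    rewrite -expRD (_ : - q * (i%:R + 1) + q = - q * i%:R); last by ring.
    by rewrite lerBlDr lerDl expR_ge0.
- move=> N; rewrite -mulr_suml; apply: ler_wpM2r => //.
  by rewrite divr_ge0 ?expR_ge0 ?ltW.
Qed.

Lemma integrable_of_sum_0 (f : R -> R) (q C : R) : 0 < q ->
  (forall x, 0 < x <= 1 -> 0 <= f x) -> (forall x y, 0 < x -> x <= y -> y <= 1 -> f y <= f x) ->
  measurable_fun (`]0, 1]%classic : set R) f ->
  (forall N, \sum_(k < N) f (expR (- k.+1%:R)) * expR (- q * k.+1%:R) <= C) ->
  mu.-integrable `]0, 1] (EFin \o (fun s : R => s `^ (q - 1) * f s)).
Proof.
move=> q0 f0 fnd mf sumC.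
have e1 (i : nat) : expR (- i%:R : R) <= 1 by rewrite -[leRHS]expR0 ler_expR oppr_le0.
have mg : measurable_fun (`]0, 1]%classic : set R) (fun s : R => s `^ (q - 1) * f s).
  by apply: measurable_funM => //; apply: measurable_funTS; exact: measurable_powR.
have Eu : `]0, 1]%classic = \bigcup_i `]expR (- i%:R : R), 1]%classic.
  apply/seteqP; split => [y|y [i _]] /=; rewrite !in_itv/= ; last first.
    by case/andP => /(lt_trans (expR_gt0 _)) -> ->.
  move=> /andP[y0 y1]; exists (Num.truncn y^-1).+1 => //=; rewrite in_itv/= y1 andbT.
  rewrite expRN -[ltRHS]invrK ltf_pV2 ?posrE ?expR_gt0 ?invr_gt0//.
  apply: (lt_le_trans (Num.Theory.truncnS_gt y^-1)).
  by apply: (le_trans _ (expR_ge1Dx _)); rewrite lerDr.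
apply/integrableP; split; first exact/measurable_EFinP.
under eq_integral.
  move=> s; rewrite inE /= in_itv/= => s1.
  rewrite ger0_norm; last by rewrite mulr_ge0 ?powR_ge0// f0.
  over.
apply: (@le_lt_trans _ _ (C * (expR q / q))%:E); last by rewrite ltry.
rewrite Eu; apply: (@integral_bigcup_sum _ (fun i => `]expR (- i.+1%:R), expR (- i%:R)]%classic) _
  (fun i => f (expR (- i.+1%:R)) * expR (- q * i.+1%:R) * (expR q / q))).
- move=> i j ij; apply/subsetPset => y /=; rewrite !in_itv/= => /andP[yi ->].
  by rewrite (le_lt_trans _ yi)// ler_expR lerN2 ler_nat.
- by move=> i; exact: measurable_itv.
- by move=> i; exact: measurable_itv.
- move=> i; apply: measurable_funS mg => //.
  by move=> y /=; rewrite !in_itv/= => /andP[/(lt_trans (expR_gt0 _)) -> ->].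
- move=> i x /=; rewrite in_itv/= => /andP[x1 x2]; rewrite mulr_ge0 ?powR_ge0// f0//.
  by rewrite x2 (lt_trans _ x1)// expR_gt0.
- by rewrite oppr0 expR0 set_itvoc0 integral_set0.
- move=> i; rewrite setUC -itv_bndbnd_setU// bnd_simp ?e1// ler_expR lerN2 ler_nat//.
- move=> i; apply/disj_setPS => y [/=]; rewrite !in_itv/= => /andP[yi _] /andP[_].
  by rewrite leNgt yi.
- move=> i; apply: (le_trans (@integral_slab _ _ _ (f (expR (- i.+1%:R))) _ _ _ _ _ _)).
  + exact: expR_gt0.
  + by rewrite ler_expR lerN2 ler_nat.
  + by rewrite gt_eqF.
  + apply: measurable_funS mf => // y /=; rewrite !in_itv/= => /andP[yi ye].
    by rewrite (lt_trans _ yi) ?expR_gt0// (le_trans ye).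
  + move=> s /andP[si si1]; have s1 := le_trans si1 (e1 i).
    have s0 := lt_le_trans (expR_gt0 _) si.
    by rewrite f0 ?s0// fnd// expR_gt0.
  + rewrite lee_fin -mulrA; apply: ler_wpM2l; first by rewrite f0// expR_gt0/= e1.
    rewrite !expR_pow -[i.+1%:R]natr1 mulrA.
    apply: ler_wpM2r; first by rewrite invr_ge0 ltW.
    rewrite -expRD (_ : - q * (i%:R + 1) + q = q * - i%:R); last by ring.
    by rewrite lerBlDr lerDl expR_ge0.
- move=> N; rewrite -mulr_suml; apply: ler_wpM2r => //.
  by rewrite divr_ge0 ?expR_ge0 ?ltW.
Qed.

End slabs.

Section integrability.
Context d (T : measurableType d) (R : realType) (P : probability T R).
Local Notation mu := (@lebesgue_measure R).
Variables (W : R -> {RV P >-> R}) (b sigma r : R) (h : R -> R).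
Hypotheses (hsigma : sigma != 0) (hr : 0 < r).

(** Together with [exp_prod], Vieta's relations for the characteristic polynomial sigma^2 k (k - 1)
    + b k - r of the ODE. *)
Lemma exp_sum : exp_m b sigma r + exp_n b sigma r = (sigma ^+ 2 - b) / sigma ^+ 2.
Proof. by rewrite /exp_m /exp_n; field. Qed.

Lemma discr_gt0 : 0 < (b - sigma ^+ 2) ^+ 2 + 4 * sigma ^+ 2 * r.
Proof.
have s2 : 0 < sigma ^+ 2 by rewrite exprn_even_gt0.
by rewrite ltr_wpDl ?sqr_ge0// mulr_gt0// mulr_gt0.
Qed.

Lemma exp_prod : sigma ^+ 2 * exp_m b sigma r * exp_n b sigma r = - r.
Proof.
rewrite /exp_m /exp_n.
have := @sqr_sqrtr R ((b - sigma ^+ 2) ^+ 2 + 4 * sigma ^+ 2 * r).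
set v := Num.sqrt _; have s2 : 0 < sigma ^+ 2 by rewrite exprn_even_gt0.
move=> /(_ (ltW discr_gt0)) v2.
have -> : r = (v ^+ 2 - (b - sigma ^+ 2) ^+ 2) / (4 * sigma ^+ 2) by rewrite v2; field.
by field.
Qed.

Lemma exp_lt : exp_m b sigma r < exp_n b sigma r.
Proof.
have s2 : 0 < sigma ^+ 2 by rewrite exprn_even_gt0.
have v0 : 0 < Num.sqrt ((b - sigma ^+ 2) ^+ 2 + 4 * sigma ^+ 2 * r).
  by rewrite sqrtr_gt0 discr_gt0.
have s20 : 0 < 2 * sigma ^+ 2 by rewrite mulr_gt0.
by rewrite /exp_m /exp_n ltr_pM2r ?invr_gt0//; lra.
Qed.

Lemma exp_signs : exp_m b sigma r < 0 < exp_n b sigma r.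
Proof.
have s2 : 0 < sigma ^+ 2 by rewrite exprn_even_gt0.
have lt := exp_lt; have Pr := exp_prod.
set m := exp_m _ _ _ in lt Pr *; set n := exp_n _ _ _ in lt Pr *.
have mn : m * n < 0.
  by rewrite -(pmulr_rlt0 _ s2) mulrA Pr oppr_lt0.
apply/andP; split; rewrite ltNge; apply/negP => H; move: mn; apply/negP; rewrite -leNgt.
  by rewrite mulr_ge0// (le_trans H)// ltW.
by rewrite mulr_le0// (le_trans _ H)// ltW.
Qed.

Hypotheses (hW : brownian_motion W) (hh : running_payoff b sigma r W h).

Let v := Num.sqrt ((b - sigma ^+ 2) ^+ 2 + 4 * sigma ^+ 2 * r).
Let nu := b - sigma ^+ 2.
Let c := Num.sqrt 2 * sigma.

Let s2 : 0 < sigma ^+ 2. Proof. by rewrite exprn_even_gt0. Qed.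

Let v0 : 0 < v.
Proof. by rewrite sqrtr_gt0 discr_gt0. Qed.

Let c2 : c ^+ 2 = 2 * sigma ^+ 2.
Proof. by rewrite exprMn sqr_sqrtr. Qed.

Let c0 : c != 0.
Proof. by rewrite mulf_neq0// gt_eqF// sqrtr_gt0. Qed.

Let v2 : v ^+ 2 = nu ^+ 2 + 2 * c ^+ 2 * r.
Proof.
by rewrite c2 sqr_sqrtr ?(ltW discr_gt0)// /nu; ring.
Qed.

Let hexp_nd : nondecreasing_fun (h \o expR).
Proof. by case: hh => _ hinc _ _ x y xy; rewrite /= hinc ?expR_gt0// ler_expR. Qed.

Let mhexp (g : R -> R) : measurable_fun setT g -> measurable_fun setT (fun y => `|(h \o expR) (g y)|).
Proof.
move=> mg; apply: measurableT_comp => //; apply: (measurableT_comp _ mg).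
exact: nondecreasing_measurable.
Qed.

Let finiteE : (\int[P]_w \int[mu]_(t in `[0%R, +oo[)
     (expR (- r * t) * `|(h \o expR) (nu * t + c * W t w)|)%:E < +oo)%E.
Proof.
case: hh => _ _ _ /(_ 1 ltr01); apply: le_lt_trans.
rewrite le_eqVlt; apply/orP; left; apply/eqP.
by apply: eq_integral => w _; apply: eq_integral => t _; rewrite /gbm mul1r.
Qed.

Lemma running_payoff_integrabley : mu.-integrable `[1, +oo[
  (EFin \o (fun s : R => s `^ (- exp_n b sigma r - 1) * h s)).
Proof.
have /andP[_ n0] := exp_signs; case: (hh) => _ hinc _ _.
have mh (D : set R) : measurable D -> D `<=` `]0, +oo[%classic -> measurable_fun D h.
  exact: measurable_pos.
have oneS : (`[1, +oo[%classic : set R) `<=` `]0, +oo[.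
  by move=> x /=; rewrite !in_itv/= !andbT; exact: lt_le_trans.
have a0 x : 0 <= Num.max ((h \o expR) x) 0 by rewrite le_max lexx orbT.
have and_ : nondecreasing_fun (fun y => Num.max ((h \o expR) y) 0).
  by move=> x y xy; have := hexp_nd xy; rewrite ge_max !le_max lexx orbT andbT => ->.
have af x : Num.max ((h \o expR) x) 0 <= `|(h \o expR) x|.
  by rewrite ge_max ler_norm normr_ge0.
have [C HC] := @potential_sum _ _ _ _ W nu c r v hW c0 hr v0 v2
  (fun y => Num.max ((h \o expR) y) 0) (fun y => `|(h \o expR) y|)
  a0 and_ af
  (mhexp (@measurable_id _ _ _)) finiteE.
have qE : (v - nu) / c ^+ 2 = exp_n b sigma r.
  by rewrite c2 /nu /exp_n -/v; field.
rewrite qE in HC.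
(* The sums control only the positive part of [h]. The negative part is at most [|h 1|] to the right
   of 1, where the bare power is integrable. *)
have ip : mu.-integrable `[1, +oo[ (EFin \o (fun s : R => s `^ (- exp_n b sigma r - 1) * Num.max (h s) 0)).
  apply: (@integrable_of_sum_y _ (fun s => Num.max (h s) 0) _ C) => //.
  - by move=> x _; rewrite le_max lexx orbT.
  - move=> x y x1 xy; have := hinc _ _ (lt_le_trans ltr01 x1) xy.
    by rewrite ge_max !le_max lexx orbT andbT => ->.
  - by apply: measurable_maxr => //; exact: mh.
have iN : mu.-integrable `[1, +oo[ (EFin \o (fun s : R => `|h 1| * s `^ (- exp_n b sigma r - 1))).
  by apply: integrable_scale => //; apply: powR_integrabley; rewrite ?oppr_lt0.
apply: (le_integrable _ _ _ (integrable_add _ ip iN)) => //.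
- by apply/measurable_EFinP; apply: measurable_funM; [apply: measurable_funTS; exact: measurable_powR|exact: mh].
- move=> s /=; rewrite in_itv/= andbT => s1; rewrite lee_fin normrM (ger0_norm (powR_ge0 _ _)).
  rewrite (mulrC `|h 1|) -mulrDr normrM (ger0_norm (powR_ge0 _ _)).
  apply: ler_wpM2l; first exact: powR_ge0.
  have := hinc _ _ ltr01 s1; have := ler_norm (- h 1); rewrite normrN => h1 h1s.
  have M1 : h s <= Num.max (h s) 0 by rewrite le_max lexx.
  have M2 : 0 <= Num.max (h s) 0 by rewrite le_max lexx orbT.
  have := normr_ge0 (h 1) => M3.
  by rewrite [leRHS]ger0_norm ?addr_ge0// ler_norml; apply/andP; split; lra.
Qed.

(* The reflection [y |-> - y] of [log X] exchanges [0] and [+oo], and [n] and [- m]. *)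
Lemma running_payoff_integrable0 : mu.-integrable `]0, 1]
  (EFin \o (fun s : R => s `^ (- exp_m b sigma r - 1) * h s)).
Proof.
have /andP[m0 _] := exp_signs; case: (hh) => _ hinc _ _.
have q0 : 0 < - exp_m b sigma r by rewrite oppr_gt0.
have mh (D : set R) : measurable D -> D `<=` `]0, +oo[%classic -> measurable_fun D h.
  exact: measurable_pos.
have oneS : (`]0, 1]%classic : set R) `<=` `]0, +oo[.
  by move=> x /=; rewrite !in_itv/= andbT => /andP[].
have c0' : - c != 0 by rewrite oppr_eq0.
have v2' : v ^+ 2 = (- nu) ^+ 2 + 2 * (- c) ^+ 2 * r by rewrite !sqrrN.
have fin : (\int[P]_w \int[mu]_(t in `[0%R, +oo[)
     (expR (- r * t) * `|(h \o expR) (- (- nu * t + - c * W t w))|)%:E < +oo)%E.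
  apply: le_lt_trans finiteE; rewrite le_eqVlt; apply/orP; left; apply/eqP.
  apply: eq_integral => w _; apply: eq_integral => t _.
  by rewrite !mulNr opprD !opprK.
have a0 x : 0 <= Num.max (- (h \o expR) (- x)) 0 by rewrite le_max lexx orbT.
have and_ : nondecreasing_fun (fun y => Num.max (- (h \o expR) (- y)) 0).
  move=> x y xy; have yx : - y <= - x by rewrite lerN2.
  by have := hexp_nd yx; rewrite -lerN2 ge_max !le_max lexx orbT andbT => ->.
have af x : Num.max (- (h \o expR) (- x)) 0 <= `|(h \o expR) (- x)|.
  by rewrite ge_max normr_ge0 andbT -normrN ler_norm.
have mopp : measurable_fun setT (fun y : R => - y) by exact: measurable_funN.
have [C HC] := @potential_sum _ _ _ _ W (- nu) (- c) r v hW c0' hr v0 v2'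
  (fun y => Num.max (- (h \o expR) (- y)) 0) (fun y => `|(h \o expR) (- y)|)
  a0 and_ af
  (mhexp mopp) fin.
have qE : (v - - nu) / (- c) ^+ 2 = - exp_m b sigma r.
  by rewrite sqrrN c2 /nu /exp_m -/v; field.
rewrite qE in HC.
have ip : mu.-integrable `]0, 1] (EFin \o (fun s : R => s `^ (- exp_m b sigma r - 1) * Num.max (- h s) 0)).
  apply: (@integrable_of_sum_0 _ (fun s => Num.max (- h s) 0) _ C) => //.
  - by move=> x _; rewrite le_max lexx orbT.
  - move=> x y x0 xy y1; have := hinc _ _ x0 xy.
    by rewrite -lerN2 ge_max !le_max lexx orbT andbT => ->.
  - by apply: measurable_maxr => //; apply: measurableT_comp => //; exact: mh.
have iN : mu.-integrable `]0, 1] (EFin \o (fun s : R => `|h 1| * s `^ (- exp_m b sigma r - 1))).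
  by apply: integrable_scale => //; exact: powR_integrable0.
apply: (le_integrable _ _ _ (integrable_add _ ip iN)) => //.
- by apply/measurable_EFinP; apply: measurable_funM; [apply: measurable_funTS; exact: measurable_powR|exact: mh].
- move=> s /=; rewrite in_itv/= => /andP[s0 s1]; rewrite lee_fin normrM (ger0_norm (powR_ge0 _ _)).
  rewrite (mulrC `|h 1|) -mulrDr normrM (ger0_norm (powR_ge0 _ _)).
  apply: ler_wpM2l; first exact: powR_ge0.
  have := hinc _ _ s0 s1; have := ler_norm (h 1) => h1 h1s.
  have M1 : - h s <= Num.max (- h s) 0 by rewrite le_max lexx.
  have M2 : 0 <= Num.max (- h s) 0 by rewrite le_max lexx orbT.
  have := normr_ge0 (h 1) => M3.
  by rewrite [leRHS]ger0_norm ?addr_ge0// ler_norml; apply/andP; split; lra.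
Qed.

End integrability.

(** * The Green kernel of the ODE *)

Section kernel.
Context {R : realType} (m n s2 r : R) (h : R -> R).
Local Notation mu := (@lebesgue_measure R).
Hypotheses (m0 : m < 0) (n0 : 0 < n) (mn : s2 * m * n = - r).
Hypothesis h_inc : increasing_on_pos h.
Hypothesis int0 : mu.-integrable `]0, 1] (EFin \o (fun s : R => s `^ (- m - 1) * h s)).
Hypothesis inty : mu.-integrable `[1, +oo[ (EFin \o (fun s : R => s `^ (- n - 1) * h s)).

Local Notation A := (Am m h).
Local Notation B := (Bn n h).
Local Notation N := (s2 * (n - m)).

(** Integrals from z to y of (h(s) - c) / s against y^n s^(-n) - y^m s^(-m) and n y^n s^(-n) - m y^m
    s^(-m). The first weight is positive for s < y and negative for s > y, which offsets the
    orientation, so [green] has the sign of h - c on both sides of z. The second is always positive,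
    so the sign of [dgreen] flips with the side. *)
Definition green (c z y : R) := y `^ n * (B c z - B c y) - y `^ m * (A c y - A c z).
Definition dgreen (c z y : R) := n * y `^ n * (B c z - B c y) - m * y `^ m * (A c y - A c z).
(* Variation of constants: [voc a b] solves [s2 x^2 u'' + b x u' - r u = N h] and
   [dvoc a b] is [x] times its derivative. *)
Definition voc (a b x : R) := x `^ m * (a - A 0 x) + x `^ n * (b - B 0 x).
Definition dvoc (a b x : R) := m * x `^ m * (a - A 0 x) + n * x `^ n * (b - B 0 x).

Let combge := comb_ge0 m0 n0 h_inc int0 inty.
Let combgt := comb_gt0 m0 n0 h_inc int0 inty.
Let m0' : m != 0. Proof. by rewrite lt_eqF. Qed.
Let n0' : n != 0. Proof. by rewrite gt_eqF. Qed.
Let nm : 0 < n - m. Proof. by rewrite subr_gt0 (lt_trans m0). Qed.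
Let rE : r = - (s2 * m * n). Proof. by rewrite mn opprK. Qed.

Let comble (a b be ga c : R) : 0 < a -> a <= b ->
  (forall s, a < s < b -> (be * s `^ (- n) + ga * s `^ (- m)) * (h s - c) <= 0) ->
  be * (B c a - B c b) + ga * (A c b - A c a) <= 0.
Proof.
move=> a0 ab H; have := @combge a b (- be) (- ga) c a0 ab.
rewrite !mulNr -opprD oppr_ge0; apply => s /H.
by rewrite !mulNr -opprD mulNr oppr_ge0.
Qed.

Let comblt (a b be ga c : R) : 0 < a -> a < b ->
  (forall s, a < s < b -> (be * s `^ (- n) + ga * s `^ (- m)) * (h s - c) < 0) ->
  be * (B c a - B c b) + ga * (A c b - A c a) < 0.
Proof.
move=> a0 ab H; have := @combgt a b (- be) (- ga) c a b a0 (lexx _) ab (lexx _).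
rewrite !mulNr -opprD oppr_gt0; apply => s /H.
  by rewrite !mulNr -opprD mulNr oppr_ge0 => /ltW.
by rewrite !mulNr -opprD mulNr oppr_gt0.
Qed.

Let AE (c x : R) : 0 < x -> A c x = A 0 x + c * x `^ (- m) / m.
Proof. by move=> x0; rewrite (AmE m0 h_inc int0 c 0 x0) subr0. Qed.
Let BE (c x : R) : 0 < x -> B c x = B 0 x - c * x `^ (- n) / n.
Proof. by move=> x0; rewrite (BnE n0 h_inc inty c 0 x0) subr0. Qed.

Lemma A_le (c a b : R) : 0 < a -> a <= b -> (forall s, a < s < b -> c <= h s) ->
  A c a <= A c b.
Proof.
move=> a0 ab ch; rewrite -subr_ge0.
have := @combge a b 0 1 c a0 ab; rewrite mul0r add0r mul1r; apply => s /[dup] /ch cs _.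
by rewrite mul0r add0r mul1r mulr_ge0 ?powR_ge0// subr_ge0.
Qed.

Lemma A_ge (c a b : R) : 0 < a -> a <= b -> (forall s, a < s < b -> h s <= c) ->
  A c b <= A c a.
Proof.
move=> a0 ab ch; rewrite -subr_ge0.
have := @combge a b 0 (-1) c a0 ab; rewrite mul0r add0r mulN1r opprB; apply => s /[dup] /ch cs _.
by rewrite mul0r add0r mulN1r mulNr -mulrN opprB mulr_ge0 ?powR_ge0// subr_ge0.
Qed.

Lemma B_le (c a b : R) : 0 < a -> a <= b -> (forall s, a < s < b -> h s <= c) ->
  B c a <= B c b.
Proof.
move=> a0 ab ch; rewrite -subr_ge0.
have := @combge a b (-1) 0 c a0 ab; rewrite mul0r addr0 mulN1r opprB; apply => s /[dup] /ch cs _.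
by rewrite mul0r addr0 mulN1r mulNr -mulrN opprB mulr_ge0 ?powR_ge0// subr_ge0.
Qed.

Lemma B_lt (c a b : R) : 0 < a -> a < b -> (forall s, a < s < b -> h s < c) ->
  B c a < B c b.
Proof.
move=> a0 ab ch; rewrite -subr_gt0.
have := @combgt a b (-1) 0 c a b a0 (lexx _) ab (lexx _); rewrite mul0r addr0 mulN1r opprB.
by apply => s /[dup] /andP[/(lt_trans a0) s0 _] /ch cs; rewrite mul0r addr0 mulN1r mulNr
  -mulrN opprB ?mulr_gt0 ?mulr_ge0 ?powR_gt0 ?powR_ge0// ?subr_gt0 ?subr_ge0// ltW.
Qed.

Let phiR (s y : R) : 0 < s -> s < y -> 0 < y `^ n * s `^ (- n) + - y `^ m * s `^ (- m).
Proof.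
move=> s0 sy; rewrite !powRN mulNr subr_gt0.
apply: (@lt_trans _ _ 1).
  by rewrite ltr_pdivrMr ?powR_gt0// mul1r powR_ltn.
by rewrite ltr_pdivlMr ?powR_gt0// mul1r powR_ltp.
Qed.

Let phiL (s y : R) : 0 < y -> y < s -> 0 < - y `^ n * s `^ (- n) + y `^ m * s `^ (- m).
Proof.
move=> y0 ys; have s0 := lt_trans y0 ys; rewrite !powRN mulNr addrC subr_gt0.
apply: (@lt_trans _ _ 1).
  by rewrite ltr_pdivrMr ?powR_gt0// mul1r powR_ltp.
by rewrite ltr_pdivlMr ?powR_gt0// mul1r powR_ltn.
Qed.

Let greenRE c z y : green c z y = y `^ n * (B c z - B c y) + - y `^ m * (A c y - A c z).
Proof. by rewrite /green mulNr. Qed.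

Let greenLE c z y : green c z y = - y `^ n * (B c y - B c z) + y `^ m * (A c z - A c y).
Proof. rewrite /green; ring. Qed.

Lemma greenR_ge0 c z y : 0 < z -> z <= y -> (forall s, z < s < y -> c <= h s) ->
  0 <= green c z y.
Proof.
move=> z0 zy ch; rewrite greenRE; apply: combge => // s /[dup] /andP[zs sy] /ch cs.
by rewrite mulr_ge0 ?subr_ge0// ltW// phiR// (lt_trans z0).
Qed.

Lemma greenR_gt0 c z y t : 0 < z -> z <= t -> t < y -> (forall s, z < s < y -> c <= h s) ->
  c < h t -> 0 < green c z y.
Proof.
move=> z0 zt ty ch ct; rewrite greenRE; apply: (@combgt z y _ _ c t y) => // s /[dup] /andP[zs sy].
  by move=> /ch cs; rewrite mulr_ge0 ?subr_ge0// ltW// phiR// (lt_trans z0).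
have t0 := lt_le_trans z0 zt; have s0 := lt_trans t0 zs.
by move=> _; rewrite mulr_gt0 ?subr_gt0 ?phiR// (lt_le_trans ct)// h_inc// ltW.
Qed.

Lemma greenR_le0 c z y : 0 < z -> z <= y -> (forall s, z < s < y -> h s <= c) ->
  green c z y <= 0.
Proof.
move=> z0 zy ch; rewrite greenRE; apply: comble => // s /[dup] /andP[zs sy] /ch cs.
by rewrite pmulr_rle0 ?subr_le0// phiR// (lt_trans z0).
Qed.

Lemma greenR_lt0 c z y : 0 < z -> z < y -> (forall s, z < s < y -> h s < c) ->
  green c z y < 0.
Proof.
move=> z0 zy ch; rewrite greenRE; apply: comblt => // s /[dup] /andP[zs sy] /ch cs.
by rewrite pmulr_rlt0 ?subr_lt0// phiR// (lt_trans z0).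
Qed.

Lemma greenL_ge0 c z y : 0 < y -> y <= z -> (forall s, y < s < z -> c <= h s) ->
  0 <= green c z y.
Proof.
move=> z0 zy ch; rewrite greenLE; apply: combge => // s /[dup] /andP[zs sy] /ch cs.
by rewrite mulr_ge0 ?subr_ge0// ltW// phiL.
Qed.

Lemma greenL_le0 c z y : 0 < y -> y <= z -> (forall s, y < s < z -> h s <= c) ->
  green c z y <= 0.
Proof.
move=> z0 zy ch; rewrite greenLE; apply: comble => // s /[dup] /andP[zs sy] /ch cs.
by rewrite pmulr_rle0 ?subr_le0// phiL.
Qed.

Let dphi (s y : R) : 0 < s -> 0 < y -> 0 < n * y `^ n * s `^ (- n) + - (m * y `^ m) * s `^ (- m).
Proof.
move=> s0 y0; rewrite -mulNr; apply: addr_gt0; rewrite !mulr_gt0 ?powR_gt0// oppr_gt0//.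
Qed.

Let dgreenRE c z y : dgreen c z y = n * y `^ n * (B c z - B c y) + - (m * y `^ m) * (A c y - A c z).
Proof. by rewrite /dgreen mulNr. Qed.

Let dgreenLE c z y : - dgreen c z y = n * y `^ n * (B c y - B c z) + - (m * y `^ m) * (A c z - A c y).
Proof. rewrite /dgreen; ring. Qed.

Lemma dgreenR_ge0 c z y : 0 < z -> z <= y -> (forall s, z < s < y -> c <= h s) ->
  0 <= dgreen c z y.
Proof.
move=> z0 zy ch; rewrite dgreenRE; apply: combge => // s /[dup] /andP[zs sy] /ch cs.
have s0 := lt_trans z0 zs.
by rewrite mulr_ge0 ?subr_ge0// ltW// dphi// (lt_trans s0).
Qed.

Lemma dgreenR_le0 c z y : 0 < z -> z <= y -> (forall s, z < s < y -> h s <= c) ->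
  dgreen c z y <= 0.
Proof.
move=> z0 zy ch; rewrite dgreenRE; apply: comble => // s /[dup] /andP[zs sy] /ch cs.
have s0 := lt_trans z0 zs.
by rewrite pmulr_rle0 ?subr_le0// dphi// (lt_trans s0).
Qed.

Lemma dgreenL_le0 c z y : 0 < y -> y <= z -> (forall s, y < s < z -> c <= h s) ->
  dgreen c z y <= 0.
Proof.
move=> z0 zy ch; rewrite -oppr_ge0 dgreenLE; apply: combge => // s /[dup] /andP[zs sy] /ch cs.
by rewrite mulr_ge0 ?subr_ge0// ltW// dphi// (lt_trans z0).
Qed.

Lemma dgreenL_ge0 c z y : 0 < y -> y <= z -> (forall s, y < s < z -> h s <= c) ->
  0 <= dgreen c z y.
Proof.
move=> z0 zy ch; rewrite -oppr_le0 dgreenLE; apply: comble => // s /[dup] /andP[zs sy] /ch cs.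
have s0 := lt_trans z0 zs.
by rewrite pmulr_rle0 ?subr_le0// dphi.
Qed.

Lemma dgreenL_gt0 c z y : 0 < y -> y < z -> (forall s, y < s < z -> h s < c) ->
  0 < dgreen c z y.
Proof.
move=> z0 zy ch; rewrite -oppr_lt0 dgreenLE; apply: comblt => // s /[dup] /andP[zs sy] /ch cs.
have s0 := lt_trans z0 zs.
by rewrite pmulr_rlt0 ?subr_lt0// dphi.
Qed.

Lemma green_shift c c' z y : 0 < z -> 0 < y ->
  green c z y = green c' z y - (c - c') * ((y `^ n / z `^ n - 1) / n - (y `^ m / z `^ m - 1) / m).
Proof.
move=> z0 y0; rewrite /green !(AE c)// !(AE c')// !(BE c)// !(BE c')// !powRN.
by field; rewrite ?m0' ?n0' ?gt_eqF ?powR_gt0.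
Qed.

Lemma dgreen_shift c c' z y : 0 < z -> 0 < y ->
  dgreen c z y = dgreen c' z y - (c - c') * (y `^ n / z `^ n - y `^ m / z `^ m).
Proof.
move=> z0 y0; rewrite /dgreen !(AE c)// !(AE c')// !(BE c)// !(BE c')// !powRN.
by field; rewrite ?m0' ?n0' ?gt_eqF ?powR_gt0.
Qed.

(** The combinations n S - dS and - m S + dS of a solution S and its [dvoc] each retain one of the
    two coefficients; r = - s2 m n turns the factor N v into r v. *)
Let sol_coefs a b z v : 0 < z -> dvoc a b z = 0 -> voc a b z = N * v ->
  a = A 0 z - (r * v / m) / z `^ m /\ b = B 0 z + (r * v / n) / z `^ n.
Proof.
move=> z0 D S.
have zm : z `^ m != 0 by rewrite gt_eqF// powR_gt0.
have zn : z `^ n != 0 by rewrite gt_eqF// powR_gt0.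
have Em : (n - m) * (z `^ m * (a - A 0 z)) = n * (N * v).
  rewrite [LHS](_ : _ = n * voc a b z - dvoc a b z); last by rewrite /voc /dvoc; ring.
  by rewrite D S subr0.
have En : (n - m) * (z `^ n * (b - B 0 z)) = - m * (N * v).
  rewrite [LHS](_ : _ = - m * voc a b z + dvoc a b z); last by rewrite /voc /dvoc; ring.
  by rewrite D S addr0.
split.
  have -> : a = A 0 z + ((n - m) * (z `^ m * (a - A 0 z))) / (n - m) / z `^ m.
    by field; rewrite zm gt_eqF.
  by rewrite Em rE; field; rewrite zm m0' gt_eqF.
have -> : b = B 0 z + ((n - m) * (z `^ n * (b - B 0 z))) / (n - m) / z `^ n.
  by field; rewrite zn gt_eqF.
by rewrite En rE; field; rewrite zn n0' gt_eqF.
Qed.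

(* Two-point formulas: a solution is determined by its value and its derivative
   at [z]; when the derivative vanishes there, its increments are the integral
   of the positive kernel against [h + r * value]. *)
Lemma voc_crit a b z v y : 0 < z -> 0 < y -> dvoc a b z = 0 -> voc a b z = N * v ->
  voc a b y = N * v + green (- (r * v)) z y.
Proof.
move=> z0 y0 D S; have [-> ->] := sol_coefs z0 D S.
rewrite (@green_shift _ 0)// /green /voc rE.
by field; rewrite m0' n0' !gt_eqF ?powR_gt0.
Qed.

Lemma dvoc_crit a b z v y : 0 < z -> 0 < y -> dvoc a b z = 0 -> voc a b z = N * v ->
  dvoc a b y = dgreen (- (r * v)) z y.
Proof.
move=> z0 y0 D S; have [-> ->] := sol_coefs z0 D S.
rewrite (@dgreen_shift _ 0)// /dgreen /dvoc rE.
by field; rewrite m0' n0' !gt_eqF ?powR_gt0.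
Qed.

(** At level 0 the solution is its value at [z] times one homogeneous solution, plus its slope times
    another, plus a kernel term; to the right of [z] all of these are nonnegative. *)
Lemma voc_ge0 a b z y : 0 < z -> z <= y -> 0 <= h z -> 0 <= voc a b z ->
  0 <= dvoc a b z -> 0 <= voc a b y.
Proof.
move=> z0 zy hz S0 D0; have y0 := lt_le_trans z0 zy.
have K0 : 0 <= green 0 z y.
  by apply: greenR_ge0 => // s /andP[/ltW zs _]; rewrite (le_trans hz)// h_inc.
have tn1 : 1 <= y `^ n / z `^ n.
  by rewrite ler_pdivlMr ?powR_gt0// mul1r powR_lep.
have tm1 : y `^ m / z `^ m <= 1.
  by rewrite ler_pdivrMr ?powR_gt0// mul1r powR_len.
have tm0 : 0 < y `^ m / z `^ m by rewrite divr_gt0 ?powR_gt0.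
have -> : voc a b y = (voc a b z * (n * (y `^ m / z `^ m) - m * (y `^ n / z `^ n)) +
     dvoc a b z * (y `^ n / z `^ n - y `^ m / z `^ m)) / (n - m) + green 0 z y.
  rewrite /voc /dvoc /green; field.
  by rewrite !gt_eqF ?powR_gt0.
apply: addr_ge0 => //; apply: divr_ge0; last exact: ltW.
apply: addr_ge0; apply: mulr_ge0 => //.
  have p1 : 0 <= n * (y `^ m / z `^ m) by rewrite mulr_ge0// ltW.
  have p2 : 0 <= - m * (y `^ n / z `^ n).
    by rewrite mulr_ge0 ?oppr_ge0 ?(ltW m0)// (le_trans ler01).
  by move: p2; rewrite mulNr => p2; lra.
by rewrite subr_ge0 (le_trans tm1).
Qed.

Lemma powR_is_derive (x p k : R) : 0 < x ->
  is_derive x 1 (fun y : R => y `^ p * k) (p * x `^ p / x * k).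
Proof.
move=> x0; have -> : (fun y : R => y `^ p * k) = k \*: (fun y : R => y `^ p).
  by apply/funext => y; rewrite /= mulrC.
apply: is_derive_eq (is_deriveZ k (is_derive1_powR p x0)) _.
rewrite /GRing.scale /= mulrC powRD ?(gt_eqF x0) ?implybT// powR_inv1 ?mulrA//.
exact: ltW.
Qed.

Lemma locally_bounded (x : R) : 0 < x -> exists2 M, 0 <= M & exists2 e, 0 < e &
  forall s, `|s - x| < e -> 0 < s /\ `|h s| <= M.
Proof.
move=> x0; exists (`|h (x / 2)| + `|h (2 * x)|) => //.
exists (x / 2); first by rewrite divr_gt0.
move=> s; rewrite ltr_norml => /andP[s1 s3].
have sx : x / 2 <= s by lra.
have s0 : 0 < s by lra.
have h1 : h (x / 2) <= h s by apply: h_inc; lra.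
have h2 : h s <= h (2 * x) by apply: h_inc; lra.
split => //; rewrite ler_norml.
have := ler_norm (- h (x / 2)); have := ler_norm (h (2 * x)); rewrite normrN.
have := normr_ge0 (h (x / 2)); have := normr_ge0 (h (2 * x)).
by move=> *; apply/andP; split; lra.
Qed.

(** What [green] and [dgreen] become when h - c is replaced by 1. At z the first vanishes to second
    order and the second to first order, with slope (n - m) / z, so a jump of [h] affects second
    derivatives only. *)
Let phi z y := (y `^ n / z `^ n - 1) / n - (y `^ m / z `^ m - 1) / m.
Let psi z y := y `^ n / z `^ n - y `^ m / z `^ m.

Let phi_derive (x : R) : 0 < x -> is_derive x 1 (phi x) 0.
Proof.
move=> x0; have -> : phi x = (fun y => y `^ n * ((x `^ n)^-1 / n)) + (fun y => y `^ m * (- (x `^ m)^-1 / m)) + cst (m^-1 - n^-1).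
  by apply/funext => y; rewrite !fctE /phi /=; ring.
apply: is_derive_eq (is_deriveD (is_deriveD (powR_is_derive n _ x0) (powR_is_derive m _ x0)) (is_derive_cst _ _ _)) _.
by field; rewrite m0' n0' !gt_eqF ?powR_gt0.
Qed.

Let psi_derive (x k : R) : 0 < x -> is_derive x 1 (fun y => k * psi x y) (k * (n - m) / x).
Proof.
move=> x0; have -> : (fun y => k * psi x y) = (fun y => y `^ n * (k * (x `^ n)^-1)) + (fun y => y `^ m * (- (k * (x `^ m)^-1))).
  by apply/funext => y; rewrite !fctE /psi /=; ring.
apply: is_derive_eq (is_deriveD (powR_is_derive n _ x0) (powR_is_derive m _ x0)) _.
by field; rewrite !gt_eqF ?powR_gt0.
Qed.

Let betR (s x y : R) : x < s < y -> `|s - x| <= `|y - x|.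
Proof.
move=> /andP[xs sy]; rewrite !ger0_norm ?subr_ge0 ?lerD2r ?(ltW xs) ?(ltW sy)//.
exact: ltW (lt_trans xs sy).
Qed.

Let betL (s x y : R) : y < s < x -> `|s - x| <= `|y - x|.
Proof.
by move=> /andP[ys sx]; rewrite !(distrC _ x) !ger0_norm ?subr_ge0 ?lerD2l ?lerN2 ?(ltW ys) ?(ltW sx)// (ltW (lt_trans ys sx)).
Qed.

Let green0_bound (x y M : R) : 0 < x -> 0 < y ->
  (forall s, `|s - x| <= `|y - x| -> `|h s| <= M) -> `|green 0 x y| <= M * phi x y.
Proof.
move=> x0 y0 hM.
have K c : green c x y = green 0 x y - c * phi x y by rewrite (@green_shift c 0)// subr0.
have hM' s : `|s - x| <= `|y - x| -> - M <= h s /\ h s <= M.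
  by move=> /hM; rewrite ler_norml => /andP.
have : 0 <= green (- M) x y /\ green M x y <= 0.
  case: (leP x y) => xy.
    split; first by apply: greenR_ge0 => // s sI; have [] := hM' s (betR sI).
    by apply: greenR_le0 => // s sI; have [] := hM' s (betR sI).
  split; first by apply: greenL_ge0 (ltW xy) _ => // s sI; have [] := hM' s (betL sI).
  by apply: greenL_le0 (ltW xy) _ => // s sI; have [] := hM' s (betL sI).
rewrite (K (- M)) (K M) ler_norml => -[K1 K2]; apply/andP; split; lra.
Qed.

(** Freezing [A 0] and [B 0] at [x] leaves two powers and the remainder [green 0 x]. As [h] is
    locally bounded, the remainder is at most a constant times [phi x], hence negligible to first
    order even where [h] jumps. *)
Lemma voc_is_derive (a b x : R) : 0 < x -> is_derive x 1 (voc a b) (dvoc a b x / x).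
Proof.
move=> x0; have -> : voc a b = (fun y => y `^ m * (a - A 0 x)) + (fun y => y `^ n * (b - B 0 x)) + green 0 x.
  by apply/funext => y; rewrite !fctE /voc /green /=; ring.
have dk : is_derive x 1 (green 0 x) 0.
  have [M M0 [e e0 HM]] := locally_bounded x0.
  have M1 : 0 < M + 1 by rewrite ltr_wpDl.
  apply: is_derive_near => eps eps0.
  have eM : 0 < eps / (M + 1) by rewrite divr_gt0.
  have := near_is_derive (phi_derive x0) eM.
  have : \forall y \near x, `|y - x| < e.
    by exists e => // y; rewrite /ball_ /= distrC.
  apply: filterS2 => y ye; rewrite mul0r subr0 /phi !divff ?gt_eqF ?powR_gt0// !subrr !mul0r subrr subr0 -/(phi x y) => phile.
  have [y0 _] := HM y ye.
  rewrite subr0 [X in _ - X](_ : green 0 x x = 0) ?subr0; last first.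
    by rewrite /green !subrr !mulr0 subrr.
  apply: (le_trans (@green0_bound x y M x0 y0 _)).
    by move=> s sx; apply: (HM s _).2; exact: le_lt_trans ye.
  apply: (@le_trans _ _ (M * (eps / (M + 1) * `|y - x|))).
    by apply: ler_wpM2l => //; exact: le_trans (ler_norm _) phile.
  rewrite mulrA; apply: ler_wpM2r => //; rewrite mulrCA ler_piMr ?(ltW eps0)//.
  by rewrite ler_pdivrMr// mul1r lerDl.
apply: is_derive_eq (is_deriveD (is_deriveD (powR_is_derive m _ x0) (powR_is_derive n _ x0)) dk) _.
by rewrite addr0 /dvoc; field; rewrite gt_eqF.
Qed.

Lemma voc_continuous (a b x : R) : 0 < x -> {for x, continuous (voc a b)}.
Proof. by move=> x0; exact: is_derive_continuous (voc_is_derive a b x0). Qed.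

(** The same freezing, but the remainder [dgreen 0 x] is now of first order. Continuity of [h]
    compares it with h(x) [psi x], through the levels h(x) - e1 and h(x) + e1. *)
Lemma dvoc_is_derive (a b x : R) : 0 < x -> {for x, continuous h} ->
  is_derive x 1 (dvoc a b) ((m ^+ 2 * x `^ m * (a - A 0 x) + n ^+ 2 * x `^ n * (b - B 0 x) + (n - m) * h x) / x).
Proof.
move=> x0 ch; have -> : dvoc a b = (fun y => y `^ m * (m * (a - A 0 x))) + (fun y => y `^ n * (n * (b - B 0 x))) + dgreen 0 x.
  by apply/funext => y; rewrite !fctE /dvoc /dgreen /=; ring.
have dk : is_derive x 1 (dgreen 0 x) (h x * (n - m) / x).
  apply: is_derive_near => eps eps0.
  have [C C0 HC] : exists2 C, 0 < C & \forall y \near x, `|psi x y| <= C * `|y - x|.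
    exists ((n - m) / x + 1); first by rewrite ltr_wpDl// divr_ge0 ?ltW.
    have := near_is_derive (psi_derive 1 x0) ltr01; apply: filterS => y.
    rewrite /psi !divff ?gt_eqF ?powR_gt0// subrr mulr0 subr0 -/(psi x y) !mul1r => H.
    have -> : psi x y = (psi x y - (n - m) / x * (y - x)) + (n - m) / x * (y - x) by ring.
    apply: (le_trans (ler_normD _ _)); rewrite [leRHS]mulrDl mul1r [leRHS]addrC; apply: lerD => //.
    by rewrite normrM ger0_norm// divr_ge0 ?ltW.
  pose e1 := eps / 2 / C; have e10 : 0 < e1 by rewrite !divr_gt0.
  have e2 : 0 < eps / 2 by rewrite divr_gt0.
  move/cvgrPdist_le : ch => /(_ e1 e10)[e e0 He].
  have := near_is_derive (psi_derive (h x) x0) e2.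
  have : \forall y \near x, `|y - x| < Num.min e (x / 2) /\ `|psi x y| <= C * `|y - x|.
    apply: filterS2 HC _; last first.
      exists (Num.min e (x / 2)); first by rewrite /= lt_min e0 divr_gt0.
      by move=> y yx; exact: yx.
    by move=> y H1 H2; split => //; move: H2; rewrite /= distrC.
  apply: filterS2 => y [+ psile]; rewrite lt_min => /andP[ye yx2].
  rewrite {2}/psi !divff ?gt_eqF ?powR_gt0// subrr mulr0 subr0 => H.
  have y0 : 0 < y by move: yx2; rewrite ltr_norml => /andP[]; lra.
  have -> : dgreen 0 x x = 0 by rewrite /dgreen !subrr !mulr0 subrr.
  rewrite subr0.
  have K c : dgreen c x y = dgreen 0 x y - c * psi x y by rewrite (@dgreen_shift c 0)// subr0.
  have hs s : `|s - x| <= `|y - x| -> h x - e1 <= h s /\ h s <= h x + e1.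
    move=> sx; have /(He s) : ball_ Num.norm x e s.
      by rewrite /ball_ /= distrC; exact: le_lt_trans ye.
    by rewrite /= ler_norml => /andP[]; split; lra.
  have key : `|dgreen 0 x y - h x * psi x y| <= e1 * `|psi x y|.
    case: (leP x y) => xy.
      have p0 : 0 <= psi x y.
        rewrite /psi subr_ge0 (@le_trans _ _ 1)// ?ler_pdivrMr ?ler_pdivlMr ?powR_gt0// mul1r.
          exact: powR_len.
        exact: powR_lep.
      have := @dgreenR_ge0 (h x - e1) x y x0 xy (fun s sI => (hs s (betR sI)).1).
      have := @dgreenR_le0 (h x + e1) x y x0 xy (fun s sI => (hs s (betR sI)).2).
      rewrite (K (h x - e1)) (K (h x + e1)) (ger0_norm p0) ler_norml => K1 K2; apply/andP; split; lra.
    have p0 : psi x y <= 0.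
      rewrite /psi subr_le0 (@le_trans _ _ 1)// ?ler_pdivrMr ?ler_pdivlMr ?powR_gt0// mul1r.
        exact/powR_lep/ltW.
      exact/powR_len/ltW.
    have := @dgreenL_le0 (h x - e1) x y y0 (ltW xy) (fun s sI => (hs s (betL sI)).1).
    have := @dgreenL_ge0 (h x + e1) x y y0 (ltW xy) (fun s sI => (hs s (betL sI)).2).
    rewrite (K (h x - e1)) (K (h x + e1)) (ler0_norm p0) ler_norml => K1 K2; apply/andP; split; lra.
  have -> : dgreen 0 x y - h x * (n - m) / x * (y - x) =
    (dgreen 0 x y - h x * psi x y) + (h x * psi x y - h x * (n - m) / x * (y - x)) by ring.
  apply: (le_trans (ler_normD _ _)); rewrite [eps]splitr mulrDl; apply: lerD => //.
  apply: (le_trans key); rewrite -[leRHS](_ : e1 * (C * `|y - x|) = _); last first.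
    by rewrite /e1; field; rewrite gt_eqF.
  by apply: ler_wpM2l => //; exact: ltW.
apply: is_derive_eq (is_deriveD (is_deriveD (powR_is_derive m _ x0) (powR_is_derive n _ x0)) dk) _.
by field; rewrite gt_eqF.
Qed.

Lemma A_continuous (x : R) : 0 < x -> {for x, continuous (A 0)}.
Proof.
move=> x0; have [M M0 [e e0 HM]] := locally_bounded x0.
have cm := @powR_continuous _ x (- m) x0.
apply/cvgrPdist_le => eps eps0.
have M1 : 0 < (M + 1) / - m by rewrite divr_gt0 ?oppr_gt0// ltr_wpDl.
have e1 : 0 < eps / ((M + 1) / - m) by rewrite divr_gt0.
move/cvgrPdist_le : cm => /(_ _ e1).
have : \forall y \near x, `|y - x| < e by exists e => // y; rewrite /ball_ /= distrC.
apply: filterS2 => y ye dy; have [y0 _] := HM y ye.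
have hs s : `|s - x| <= `|y - x| -> - M <= h s /\ h s <= M.
  by move=> sx; have /(HM s)[_] := le_lt_trans sx ye; rewrite ler_norml => /andP.
have key : `|A 0 x - A 0 y| <= M / - m * `|x `^ (- m) - y `^ (- m)|.
  have AM c t : 0 < t -> A c t = A 0 t - c / - m * t `^ (- m).
    by move=> t0; rewrite (AE c t0) invrN; ring.
  have Mm : M / - m = M * (- m)^-1 by [].
  case: (leP x y) => xy.
    have p0 : x `^ (- m) <= y `^ (- m) by apply: powR_lep; rewrite ?oppr_gt0.
    rewrite (ler0_norm (_ : x `^ (- m) - y `^ (- m) <= 0)) ?subr_le0// ler_norml.
    have := @A_le (- M) x y x0 xy (fun s sI => (hs s (betR sI)).1).
    have := @A_ge M x y x0 xy (fun s sI => (hs s (betR sI)).2).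
    rewrite (AM M x x0) (AM M y y0) (AM (- M) x x0) (AM (- M) y y0) => K1 K2.
    by apply/andP; split; lra.
  have p0 : y `^ (- m) <= x `^ (- m) by apply: powR_lep; rewrite ?oppr_gt0 ?(ltW xy).
  rewrite (ger0_norm (_ : 0 <= x `^ (- m) - y `^ (- m))) ?subr_ge0// ler_norml.
  have := @A_le (- M) y x y0 (ltW xy) (fun s sI => (hs s (betL sI)).1).
  have := @A_ge M y x y0 (ltW xy) (fun s sI => (hs s (betL sI)).2).
  rewrite (AM M x x0) (AM M y y0) (AM (- M) x x0) (AM (- M) y y0) => K1 K2.
  by apply/andP; split; lra.
apply: (le_trans key); apply: (@le_trans _ _ ((M + 1) / - m * (eps / ((M + 1) / - m)))).
  apply: ler_pM => //; first by rewrite divr_ge0 ?oppr_ge0 ?(ltW m0).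
  by rewrite ler_pM2r ?invr_gt0 ?oppr_gt0// lerDl.
by rewrite mulrC divfK// gt_eqF.
Qed.

(** No second estimate is made: [B 0] is solved for in terms of the differentiable [voc 0 0] and the
    continuous [A 0]. *)
Lemma B_continuous (x : R) : 0 < x -> {for x, continuous (B 0)}.
Proof.
move=> x0; pose f y := - ((voc 0 0 y + y `^ m * A 0 y) * y `^ (- n)).
have fB y : 0 < y -> f y = B 0 y.
  by move=> y0; rewrite /f /voc powRN; field; rewrite gt_eqF ?powR_gt0.
apply: (@continuous_ext _ f).
  by exists x => // y; rewrite /ball_ /= ltr_norml => /andP[]; move=> *; apply: fB; lra.
apply: cvgN; apply: cvgM; last exact: powR_continuous.
apply: cvgD; first exact: voc_continuous.
by apply: cvgM; [exact: powR_continuous|exact: A_continuous].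
Qed.

End kernel.

(** * Free boundaries *)

Section free_boundaries.
Context {R : realType} (m n s2 r kap delta : R) (h : R -> R).
Local Notation mu := (@lebesgue_measure R).
Hypotheses (m0 : m < 0) (n0 : 0 < n) (s20 : 0 < s2) (mn : s2 * m * n = - r).
Hypothesis h_inc : increasing_on_pos h.
Hypothesis h_rc : forall x : R, 0 < x -> h y @[y --> x^'+] --> h x.
Hypothesis h_y : h x @[x --> +oo] --> +oo.
Hypothesis int0 : mu.-integrable `]0, 1] (EFin \o (fun s : R => s `^ (- m - 1) * h s)).
Hypothesis inty : mu.-integrable `[1, +oo[ (EFin \o (fun s : R => s `^ (- n - 1) * h s)).
Hypotheses (kap0 : 0 < kap) (delta0 : 0 < delta).

Local Notation A := (Am m h).
Local Notation B := (Bn n h).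
Local Notation N := (s2 * (n - m)).
Local Notation ker := (green m n h).
Local Notation dker := (dgreen m n h).
Local Notation sol := (voc m n h).
Local Notation dsol := (dvoc m n h).

Let greenR_ge0 := greenR_ge0 m0 n0 h_inc int0 inty.
Let greenR_gt0 := greenR_gt0 m0 n0 h_inc int0 inty.
Let greenR_le0 := greenR_le0 m0 n0 h_inc int0 inty.
Let greenR_lt0 := greenR_lt0 m0 n0 h_inc int0 inty.
Let greenL_ge0 := greenL_ge0 m0 n0 h_inc int0 inty.
Let greenL_le0 := greenL_le0 m0 n0 h_inc int0 inty.
Let dgreenL_ge0 := dgreenL_ge0 m0 n0 h_inc int0 inty.
Let dgreenL_gt0 := dgreenL_gt0 m0 n0 h_inc int0 inty.
Let A_le := A_le m0 n0 h_inc int0 inty.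
Let A_ge := A_ge m0 n0 h_inc int0 inty.
Let B_le := B_le m0 n0 h_inc int0 inty.
Let B_lt := B_lt m0 n0 h_inc int0 inty.
Let B_gt0 := Bn_gt0 n0 h_inc inty.
Let voc_is_derive := voc_is_derive m0 n0 h_inc int0 inty.
Let voc_continuous := voc_continuous m0 n0 h_inc int0 inty.

Let m0' : m != 0. Proof. by rewrite lt_eqF. Qed.
Let n0' : n != 0. Proof. by rewrite gt_eqF. Qed.
Let nm : 0 < n - m. Proof. by rewrite subr_gt0 (lt_trans m0). Qed.
Let N0 : 0 < N. Proof. by rewrite mulr_gt0. Qed.
Let r_gt0 : 0 < r.
Proof. by rewrite -[r]opprK -mn oppr_gt0 pmulr_llt0// pmulr_rlt0. Qed.
Let rE : r = - (s2 * m * n). Proof. by rewrite mn opprK. Qed.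

Let voc_crit a b z v y := @voc_crit _ _ _ _ _ h m0 n0 mn h_inc int0 inty a b z v y.
Let dvoc_crit a b z v y := @dvoc_crit _ _ _ _ _ h m0 n0 mn h_inc int0 inty a b z v y.

Let AE (c x : R) : 0 < x -> A c x = A 0 x + c * x `^ (- m) / m.
Proof. by move=> x0; rewrite (AmE m0 h_inc int0 c 0 x0) subr0. Qed.
Let BE (c x : R) : 0 < x -> B c x = B 0 x - c * x `^ (- n) / n.
Proof. by move=> x0; rewrite (BnE n0 h_inc inty c 0 x0) subr0. Qed.

(** * Levels of [h] and the roots of [B] *)

Lemma h_large (c M : R) : exists x, [/\ M <= x, 0 < x & c < h x].
Proof.
move/cvgryPgt : h_y => /(_ c) [k [_ Hk]].
exists (Num.max (Num.max M 1) (k + 1)); split.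
- by rewrite !le_max lexx.
- by rewrite !lt_max ltr01 orbT.
- by apply: Hk; rewrite lt_max ltrDl ltr01 orbT.
Qed.

Lemma h_right (z b c : R) : 0 < z -> z < b -> h z < c ->
  exists2 y, z < y < b & h y < c.
Proof.
move=> z0 zb hc; have hz := h_rc z0.
have H : \forall y \near z^'+, h y < c by exact: cvgr_lt hz _ hc.
near z^'+ => y; exists y; last by near: y.
by apply/andP; split; near: y; [exact: nbhs_right_gt|exact: nbhs_right_lt].
Unshelve. all: by end_near. Qed.

Lemma IVT_sign (f : R -> R) (a b : R) : a <= b ->
  (forall x, a <= x <= b -> {for x, continuous f}) -> f a < 0 -> 0 < f b ->
  exists2 x, a < x < b & f x = 0.
Proof.
move=> ab cf fa fit.
have [||x] := @IVT _ f a b 0 ab.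
- apply: continuous_in_subspaceT => x /[!inE] /=; rewrite in_itv/=; exact: cf.
- by rewrite ge_min (ltW fa)/= le_max (ltW fit) orbT.
rewrite in_itv/= => /andP[ax xb] fx; exists x => //.
rewrite !lt_neqAle ax xb !andbT; apply/andP; split; apply/eqP => E.
  by rewrite E fx ltxx in fa.
by rewrite -E fx ltxx in fit.
Qed.

(** The infimum of the points right of [d] where [h] is at least [c] belongs to this set: otherwise
    right-continuity would keep [h] below [c] a little further. *)
Lemma h_crossing (c d : R) : 0 < d -> exists a, [/\ d <= a, c <= h a
  & forall s, d <= s < a -> h s < c].
Proof.
move=> d0; pose S := [set x | d <= x /\ c <= h x].
have lbS : lbound S d by move=> x [].
have hS : has_inf S.
  split; last by exists d.
  by have [x [dx _ hx]] := h_large c d; exists x; split => //; exact: ltW.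
have da : d <= inf S by apply: lb_le_inf => //; case: hS.
exists (inf S); split => //.
  rewrite leNgt; apply/negP => ha; have a0 := lt_le_trans d0 da.
  have [y /andP[ay _] hy] := h_right a0 (ltr_pwDr ltr01 (lexx _)) ha.
  suff : y <= inf S by rewrite leNgt ay.
  apply: lb_le_inf; first by case: hS.
  move=> x [dx hx]; rewrite leNgt; apply/negP => xy.
  suff : h x < c by rewrite ltNge hx.
  by rewrite (le_lt_trans _ hy)// h_inc ?(lt_le_trans d0)// ltW.
move=> s /andP[ds sa]; rewrite ltNge; apply/negP => hs.
suff : inf S <= s by rewrite leNgt sa.
by apply: ge_inf => //; case: hS.
Qed.

Lemma B_pos (c x : R) : 0 < x -> c <= h x -> 0 < B c x.
Proof.
by move=> x0 cx; apply: B_gt0 => //; have [M [xM _ hM]] := h_large c x; exists M.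
Qed.

Lemma Bc_continuous (c x : R) : 0 < x -> {for x, continuous (B c)}.
Proof.
move=> x0; apply: (@continuous_ext _ (fun t => B 0 t + t `^ (- n) * (- c / n))).
  near=> t; have t0 : 0 < t by near: t; exact: lt_nbhsr.
  by rewrite (BE c t0); ring.
apply: cvgD; first exact: (B_continuous m0 n0 h_inc int0 inty x0).
by apply: cvgM; [exact: powR_continuous|exact: cvg_cst].
Unshelve. all: by end_near. Qed.

Lemma Ac_continuous (c x : R) : 0 < x -> {for x, continuous (A c)}.
Proof.
move=> x0; apply: (@continuous_ext _ (fun t => A 0 t + t `^ (- m) * (c / m))).
  near=> t; have t0 : 0 < t by near: t; exact: lt_nbhsr.
  by rewrite (AE c t0); ring.
apply: cvgD; first exact: (A_continuous m0 n0 h_inc int0 inty x0).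
by apply: cvgM; [exact: powR_continuous|exact: cvg_cst].
Unshelve. all: by end_near. Qed.

Lemma B_root_lt (c d : R) : 0 < d -> B c d = 0 -> h d < c.
Proof. by move=> d0 Bd; rewrite ltNge; apply/negP => /(B_pos d0); rewrite Bd ltxx. Qed.

(** [h] is below [c] at the larger root, hence on the whole interval between the roots, where [B c]
    is then strictly increasing. *)
Lemma B_root_unique (c d d' : R) : 0 < d -> 0 < d' -> B c d = 0 -> B c d' = 0 -> d = d'.
Proof.
move=> d0 d'0 Bd Bd'; wlog dd' : d d' d0 d'0 Bd Bd' / d < d'.
  by move=> WL; case: (ltgtP d d') => // dd'; [exact: WL|apply/esym; exact: WL].
suff : B c d < B c d' by rewrite Bd Bd' ltxx.
apply: B_lt => // s /andP[ds sd].
by rewrite (le_lt_trans _ (B_root_lt d'0 Bd'))// h_inc ?(lt_trans d0)// ltW.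
Qed.

Lemma B_root (c : R) : (exists2 x, 0 < x & h x < c) -> exists2 d, 0 < d & B c d = 0.
Proof.
move=> [x0 x00 hx0]; pose c' := h x0.
have [X [x0X X0 hX]] := h_large c x0.
have BX := B_pos X0 (ltW hX).
(* The sign change: near 0, [B c] is [B c'] minus a multiple of x^(-n), and [B c'] is bounded above
   left of [x0] because h <= c' there. The argument [y^-1] makes the power win. *)
have [y [y1 y0 yn]] := powR_large (B c' x0 * n / (c - c')) (x0 ^-1) n0.
have x1 : y^-1 <= x0 by rewrite -[x0]invrK lef_pV2 ?posrE// invr_gt0.
have B1 : B c y^-1 < 0.
  have y'0 : 0 < y^-1 by rewrite invr_gt0.
  rewrite (BnE n0 h_inc inty c c' y'0) subr_lt0.
  have -> : y^-1 `^ (- n) = y `^ n by rewrite -(powR_inv1 (ltW y0)) -powRrM mulrNN mul1r.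
  apply: (@le_lt_trans _ _ (B c' x0)).
    apply: B_le => // s /andP[ys /ltW sx]; apply: h_inc => //; exact: lt_trans ys.
  by rewrite ltr_pdivlMr// [ltRHS]mulrC -ltr_pdivrMr ?subr_gt0.
have [|d] := IVT_sign (le_trans x1 x0X) _ B1 BX.
  by move=> t /andP[yt _]; apply: Bc_continuous; apply: lt_le_trans yt; rewrite invr_gt0.
by move=> /andP[yd _] Bd; exists d => //; apply: lt_trans yd; rewrite invr_gt0.
Qed.

(** * The solution [W] that starts from the free boundary [delta] *)

Hypothesis Bdelta : B (r * kap) delta = 0.

Local Notation p1 := (A 0 delta + r * kap * delta `^ (- m) / m).
Local Notation W := (sol p1 0).
Local Notation dW := (dsol p1 0).

Lemma W_delta : W delta = - (N * kap).
Proof.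
have := Bdelta; rewrite BE// => /subr0_eq BD.
rewrite /voc BD rE !powRN; field.
by rewrite m0' n0' !gt_eqF ?powR_gt0.
Qed.

Lemma dW_delta : dW delta = 0.
Proof.
have := Bdelta; rewrite BE// => /subr0_eq BD.
rewrite /dvoc BD rE !powRN; field.
by rewrite m0' n0' !gt_eqF ?powR_gt0.
Qed.

(** While h(x) < r kap, the two-point formula from [delta] has an integrand of one sign. Afterwards
    the level c = h(x) is used: h <= c to the left of x bounds [A c], h >= c to the right makes
    [B c] positive, and both terms of [dW] get the right sign. *)
Lemma dW_lt0 (x : R) : delta < x -> dW x < 0.
Proof.
move=> dx; have x0 := lt_trans delta0 dx.
have [hx|hx] := ltP (h x) (r * kap).
  have -> : dW x = dker (r * kap) delta x.
    have := @dvoc_crit p1 0 delta (- kap) x delta0 x0 dW_delta.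
    by rewrite W_delta !mulrN opprK; apply.
  have hs s : delta < s < x -> h s < r * kap.
    by move=> /andP[/(lt_trans delta0) s0 /ltW sx]; rewrite (le_lt_trans _ hx)// h_inc.
  have := B_lt delta0 dx hs; rewrite Bdelta => Bx.
  have Ax := A_ge delta0 (ltW dx) (fun s sI => ltW (hs s sI)).
  rewrite /dker Bdelta sub0r mulrN -opprD oppr_lt0; apply: ltr_pwDl.
    by rewrite !mulr_gt0 ?powR_gt0.
  by rewrite mulr_le0 ?subr_le0// nmulr_rle0 ?powR_ge0.
have -> : dW x = m * x `^ m * (p1 - A (h x) x) - n * x `^ n * B (h x) x.
  rewrite /dvoc (AE (h x))// (BE (h x))// !powRN; field.
  by rewrite m0' n0' !gt_eqF ?powR_gt0.
have Bx : 0 < B (h x) x.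
  apply: B_gt0 => //; have [M [xM _ hM]] := h_large (h x) x.
  by exists M.
have Ax : A (h x) x <= p1.
  apply: (@le_trans _ _ (A (h x) delta)).
    by apply: A_ge (ltW dx) _ => // s /andP[/(lt_trans delta0) s0 /ltW]; exact: h_inc.
  rewrite AE// lerD2l ler_nM2r ?invr_lt0// ler_pM2r ?powR_gt0//.
rewrite subr_lt0; apply: (@le_lt_trans _ _ 0); last by rewrite !mulr_gt0 ?powR_gt0.
by rewrite mulr_le0_ge0 ?subr_ge0// nmulr_rle0 ?powR_ge0.
Qed.

Lemma W_lt (x y : R) : delta <= x -> x < y -> W y < W x.
Proof.
move=> dx xy; rewrite -ltrN2.
apply: (@is_derive_homo _ (- W) (fun t => - (dW t / t))) => // t /andP[xt ty].
  by have t0 := lt_le_trans (lt_le_trans delta0 dx) xt; exact: is_deriveN (voc_is_derive _ _ t0).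
have dt := le_lt_trans dx xt.
by rewrite -mulNr divr_gt0 ?oppr_gt0 ?dW_lt0// (lt_trans delta0).
Qed.

Lemma W_le (x y : R) : delta <= x -> x <= y -> W y <= W x.
Proof. by move=> dx; rewrite le_eqVlt => /orP[/eqP->//|/(W_lt dx)/ltW]. Qed.

(** The solution of the homogeneous ODE with value N and slope 0 at [zeta]; [dhomog] is x times its
    derivative. Both depend on x / zeta only. *)
Definition homog (zeta x : R) := s2 * (n * (x `^ m * zeta `^ (- m)) - m * (x `^ n * zeta `^ (- n))).
Definition dhomog (zeta x : R) := s2 * m * n * (x `^ m * zeta `^ (- m) - x `^ n * zeta `^ (- n)).

Lemma homog_id (x : R) : 0 < x -> homog x x = N.
Proof. by move=> x0; rewrite /homog !powRN !divff ?gt_eqF ?powR_gt0// !mulr1. Qed.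

Lemma dhomog_id (x : R) : 0 < x -> dhomog x x = 0.
Proof. by move=> x0; rewrite /dhomog !powRN !divff ?gt_eqF ?powR_gt0// subrr mulr0. Qed.

(** With t = ln (x / zeta) this is n e^(mt) - m e^(nt) >= n - m; in e^u >= 1 + u for both
    exponentials the linear terms cancel. *)
Lemma homog_ge (zeta x : R) : 0 < zeta -> 0 < x -> N <= homog zeta x.
Proof.
move=> z0 x0; rewrite /homog ler_wpM2l ?(ltW s20)//.
have E p : x `^ p * zeta `^ (- p) = expR (p * (ln x - ln zeta)).
  by rewrite /powR !gt_eqF// -expRD; congr expR; ring.
rewrite !E; move: (ln x - ln zeta) => t.
have e1 := expR_ge1Dx (m * t); have e2 := expR_ge1Dx (n * t).
have f1 : n * (1 + m * t) <= n * expR (m * t) by rewrite ler_pM2l.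
have f2 : m * expR (n * t) <= m * (1 + n * t) by rewrite ler_nM2l.
lra.
Qed.

(** By dependence on x / zeta, the derivative in ln zeta is the opposite of the derivative in ln x,
    that is [- dhomog]. *)
Lemma homog_lt (z z' x : R) : 0 < z -> z < z' -> z' <= x -> homog z' x < homog z x.
Proof.
move=> z0 zz' z'x; rewrite -ltrN2.
pose f (t : R) := t `^ (- m) * (- (s2 * n * x `^ m)) + t `^ (- n) * (s2 * m * x `^ n).
have fE t : - homog t x = f t by rewrite /f /homog; ring.
rewrite !fE; apply: (@is_derive_homo _ f (fun t => dhomog t x / t)) => // t /andP[zt tz].
  have t0 := lt_le_trans z0 zt.
  apply: is_derive_eq (is_deriveD (powR_is_derive _ _ t0) (powR_is_derive _ _ t0)) _.
  by rewrite /dhomog; ring.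
have t0 := lt_trans z0 zt; have tx := lt_le_trans tz z'x.
rewrite divr_gt0// /dhomog !powRN mn nmulr_rgt0 ?oppr_lt0// subr_lt0.
apply: (@lt_trans _ _ 1).
  by rewrite ltr_pdivrMr ?powR_gt0// mul1r powR_ltn.
by rewrite ltr_pdivlMr ?powR_gt0// mul1r powR_ltp.
Qed.

Lemma homog_gt (z x : R) : 0 < z -> z < x -> N < homog z x.
Proof. by move=> z0 zx; rewrite -(@homog_id x (lt_trans z0 zx)) homog_lt. Qed.

Lemma dhomog_gt0 (z x : R) : 0 < z -> z < x -> 0 < dhomog z x.
Proof.
move=> z0 zx; rewrite /dhomog !powRN mn nmulr_rgt0 ?oppr_lt0// subr_lt0.
apply: (@lt_trans _ _ 1).
  by rewrite ltr_pdivrMr ?powR_gt0// mul1r powR_ltn.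
by rewrite ltr_pdivlMr ?powR_gt0// mul1r powR_ltp.
Qed.

Lemma dhomog_ge0 (z x : R) : 0 < z -> z <= x -> 0 <= dhomog z x.
Proof. by move=> z0; rewrite le_eqVlt => /predU1P[<-|/(dhomog_gt0 z0)/ltW//]; rewrite dhomog_id. Qed.

Lemma dhomog_le0 (z x : R) : 0 < x -> x <= z -> dhomog z x <= 0.
Proof.
move=> x0 xz; have z0 := lt_le_trans x0 xz.
rewrite /dhomog !powRN mn nmulr_rle0 ?oppr_lt0// subr_ge0.
apply: (@le_trans _ _ 1).
  by rewrite ler_pdivrMr ?powR_gt0// mul1r powR_lep.
by rewrite ler_pdivlMr ?powR_gt0// mul1r powR_len.
Qed.

(* [W] is [- N w1] right of [delta] and [kap * homog zeta] is [N w0] between [zeta]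
   and [alpha], so that [gap zeta] is [N (w0 - w1)] there; [dgap] is [x] times its
   derivative. Here [kap] is [- K]. *)
Definition gap (zeta : R) := sol (p1 - r * kap * zeta `^ (- m) / m) (r * kap * zeta `^ (- n) / n).
Definition dgap (zeta : R) := dsol (p1 - r * kap * zeta `^ (- m) / m) (r * kap * zeta `^ (- n) / n).

Lemma gapE (zeta x : R) : gap zeta x = kap * homog zeta x + W x.
Proof. by rewrite /gap /homog /voc rE; field; rewrite m0' n0'. Qed.

Lemma dgapE (zeta x : R) : dgap zeta x = kap * dhomog zeta x + dW x.
Proof. by rewrite /dgap /dhomog /dvoc rE; field; rewrite m0' n0'. Qed.

Lemma gap_zeta (zeta : R) : 0 < zeta -> gap zeta zeta = N * kap + W zeta.
Proof. by move=> z0; rewrite gapE homog_id// mulrC. Qed.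

Lemma dgap_zeta (zeta : R) : 0 < zeta -> dgap zeta zeta = dW zeta.
Proof. by move=> z0; rewrite dgapE dhomog_id// mulr0 add0r. Qed.

Lemma gap_delta (zeta : R) : gap zeta delta = kap * (homog zeta delta - N).
Proof. by rewrite gapE W_delta; ring. Qed.

Lemma dgap_delta (zeta : R) : dgap zeta delta = kap * dhomog zeta delta.
Proof. by rewrite dgapE dW_delta addr0. Qed.

Lemma gap_delta_ge0 (zeta : R) : 0 < zeta -> 0 <= gap zeta delta.
Proof. by move=> z0; rewrite gap_delta mulr_ge0 ?(ltW kap0)// subr_ge0 homog_ge. Qed.

Lemma gap_is_derive (zeta x : R) : 0 < x -> is_derive x 1 (gap zeta) (dgap zeta x / x).
Proof. exact: voc_is_derive. Qed.

Lemma gap_within (zeta a b : R) : 0 < a -> {within `[a, b], continuous (gap zeta)}.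
Proof.
move=> a0; apply: continuous_in_subspaceT => x /[!inE] /=; rewrite in_itv/= => /andP[ax _].
exact/voc_continuous/(lt_le_trans a0).
Qed.

Lemma gap_crit (zeta z v y : R) : 0 < z -> 0 < y -> dgap zeta z = 0 -> gap zeta z = N * v ->
  gap zeta y = N * v + ker (- (r * v)) z y.
Proof. exact: voc_crit. Qed.

Lemma dgap_crit (zeta z v y : R) : 0 < z -> 0 < y -> dgap zeta z = 0 -> gap zeta z = N * v ->
  dgap zeta y = dker (- (r * v)) z y.
Proof. exact: dvoc_crit. Qed.

(** If h(z) < - r v, right-continuity keeps this on a short interval to the right, where the kernel
    term would push [gap] below its minimum. *)
Lemma crit_min (zeta z v b : R) : 0 < z -> z < b -> dgap zeta z = 0 -> gap zeta z = N * v ->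
  (forall y, z <= y <= b -> gap zeta z <= gap zeta y) -> - (r * v) <= h z.
Proof.
move=> z0 zb D E mi; rewrite leNgt; apply/negP => hz.
have [y /andP[zy yb] hy] := h_right z0 zb hz.
have : ker (- (r * v)) z y < 0.
  apply: greenR_lt0 => // s /andP[zs sy].
  by rewrite (le_lt_trans _ hy)// h_inc ?(lt_trans z0 zs)// ltW.
have := mi y; rewrite (ltW zy) (ltW yb) => /(_ isT).
by rewrite (gap_crit z0 (lt_trans z0 zy) D E) E lerDl leNgt => /negP.
Qed.

(** Here monotonicity alone propagates the strict inequality to all of ]z, b[, so the kernel can be
    evaluated at [b] itself. *)
Lemma crit_max (zeta z v b : R) : 0 < z -> z < b -> dgap zeta z = 0 -> gap zeta z = N * v ->
  (forall y, z <= y <= b -> gap zeta y <= gap zeta z) -> h z <= - (r * v).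
Proof.
move=> z0 zb D E mi; rewrite leNgt; apply/negP => hz.
have : 0 < ker (- (r * v)) z b.
  apply: (@greenR_gt0 _ _ _ z) => // s /andP[zs sb].
  by rewrite (le_trans (ltW hz))// h_inc// ltW.
have := mi b; rewrite lexx (ltW zb) => /(_ isT).
by rewrite (gap_crit z0 (lt_trans z0 zb) D E) E gerDl leNgt => /negP.
Qed.

Lemma gap_argmin (zeta a b : R) : 0 < a -> a <= b -> exists2 z, a <= z <= b &
  (forall y, a <= y <= b -> gap zeta z <= gap zeta y) /\ (a < z < b -> dgap zeta z = 0).
Proof.
move=> a0 ab; have [z zab mi] := EVT_min ab (@gap_within zeta a b a0).
exists z; first by move: zab; rewrite in_itv.
split=> [y yab|/andP[az zb]]; first by apply: mi; rewrite in_itv.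
have z0 := lt_trans a0 az.
have [_] := gap_is_derive zeta z0.
have := @derive1_at_min _ (gap zeta) a b z ab.
have H0 t : t \in `]a, b[ -> derivable (gap zeta) t 1.
  by rewrite in_itv/= => /andP[/(lt_trans a0) t0 _]; have [] := gap_is_derive zeta t0.
have zI : z \in `]a, b[ by rewrite in_itv/= az.
have mi' t : t \in `]a, b[ -> gap zeta z <= gap zeta t.
  by rewrite in_itv/= => /andP[/ltW at_ /ltW tb]; apply: mi; rewrite in_itv/= at_.
move=> /(_ H0 zI mi')[_ ->] /esym/eqP.
by rewrite mulf_eq0 invr_eq0 (gt_eqF z0) orbF => /eqP.
Qed.

Lemma gap_argmax (zeta a b : R) : 0 < a -> a <= b -> exists2 z, a <= z <= b &
  (forall y, a <= y <= b -> gap zeta y <= gap zeta z) /\ (a < z < b -> dgap zeta z = 0).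
Proof.
move=> a0 ab; have [z zab mi] := EVT_max ab (@gap_within zeta a b a0).
exists z; first by move: zab; rewrite in_itv.
split=> [y yab|/andP[az zb]]; first by apply: mi; rewrite in_itv.
have z0 := lt_trans a0 az.
have [_] := gap_is_derive zeta z0.
have := @derive1_at_max _ (gap zeta) a b z ab.
have H0 t : t \in `]a, b[ -> derivable (gap zeta) t 1.
  by rewrite in_itv/= => /andP[/(lt_trans a0) t0 _]; have [] := gap_is_derive zeta t0.
have zI : z \in `]a, b[ by rewrite in_itv/= az.
have mi' t : t \in `]a, b[ -> gap zeta t <= gap zeta z.
  by rewrite in_itv/= => /andP[/ltW at_ /ltW tb]; apply: mi; rewrite in_itv/= at_.
move=> /(_ H0 zI mi')[_ ->] /esym/eqP.
by rewrite mulf_eq0 invr_eq0 (gt_eqF z0) orbF => /eqP.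
Qed.

(** * Comparison of solutions of the smooth-fit problem *)

Definition fit (zeta alpha K1 : R) :=
  [/\ 0 < zeta, delta < alpha, zeta < alpha, gap zeta alpha = - (N * K1) & dgap zeta alpha = 0].

Lemma fit_eqs (zeta alpha K1 : R) : fit zeta alpha K1 <->
  [/\ 0 < zeta, delta < alpha, zeta < alpha,
      p1 - r * kap * zeta `^ (- m) / m = A (r * K1) alpha
    & r * kap * zeta `^ (- n) / n = B (r * K1) alpha].
Proof.
split=> -[z0 da za]; have a0 := lt_trans z0 za.
  move=> UA dUA; split=> //.
    have E : (n - m) * (alpha `^ m * (p1 - r * kap * zeta `^ (- m) / m - A 0 alpha)) =
        - (n * (N * K1)).
      rewrite [LHS](_ : _ = n * gap zeta alpha - dgap zeta alpha); last first.
        by rewrite /gap /dgap /voc /dvoc; ring.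
      by rewrite UA dUA; ring.
    have am : alpha `^ m != 0 by rewrite gt_eqF// powR_gt0.
    have -> : p1 - r * kap * zeta `^ (- m) / m = A 0 alpha +
       ((n - m) * (alpha `^ m * (p1 - r * kap * zeta `^ (- m) / m - A 0 alpha)))
         / (n - m) / alpha `^ m.
      by move: (p1 - _) => p; field; rewrite am gt_eqF.
    by rewrite E (AE (r * K1))// rE powRN; field; rewrite am m0' gt_eqF.
  have E : (n - m) * (alpha `^ n * (r * kap * zeta `^ (- n) / n - B 0 alpha)) =
      m * (N * K1).
    rewrite [LHS](_ : _ = - m * gap zeta alpha + dgap zeta alpha); last first.
      by rewrite /gap /dgap /voc /dvoc; ring.
    by rewrite UA dUA; ring.
  have an : alpha `^ n != 0 by rewrite gt_eqF// powR_gt0.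
  have -> : r * kap * zeta `^ (- n) / n = B 0 alpha +
     ((n - m) * (alpha `^ n * (r * kap * zeta `^ (- n) / n - B 0 alpha)))
       / (n - m) / alpha `^ n.
    by move: (r * kap * _ / _) => p; field; rewrite an gt_eqF.
  by rewrite E (BE (r * K1))// rE powRN; field; rewrite an n0' gt_eqF.
move=> EA EB; split => //.
  rewrite /gap /voc EA EB AE// BE// !powRN rE; field.
  by rewrite m0' n0' !gt_eqF ?powR_gt0.
rewrite /dgap /dvoc EA EB AE// BE// !powRN rE; field.
by rewrite m0' n0' !gt_eqF ?powR_gt0.
Qed.

Lemma fit_green zeta alpha K1 y : fit zeta alpha K1 -> 0 < y ->
  gap zeta y = - (N * K1) + ker (r * K1) alpha y.
Proof.
move=> [z0 da za E D] y0; have a0 := lt_trans z0 za.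
by rewrite (@gap_crit _ alpha (- K1) _ a0 y0 D) ?mulrN ?opprK.
Qed.

Lemma fit_dgreen zeta alpha K1 y : fit zeta alpha K1 -> 0 < y ->
  dgap zeta y = dker (r * K1) alpha y.
Proof.
move=> [z0 da za E D] y0; have a0 := lt_trans z0 za.
by rewrite (@dgap_crit _ alpha (- K1) _ a0 y0 D) ?mulrN ?opprK.
Qed.

(** Otherwise the integrand seen from [alpha] is nonpositive. If zeta <= delta, [gap] is then
    negative at [delta], against [gap_delta_ge0]; if delta < zeta, its slope at [zeta] is
    nonnegative, against [dW_lt0]. *)
Lemma fit_h_gt zeta alpha K1 : 0 < K1 -> fit zeta alpha K1 ->
  exists2 s, Num.max delta zeta <= s < alpha & r * K1 < h s.
Proof.
move=> K10 H; have [z0 da za _ _] := H.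
apply: contrapT => /forall2NP C.
pose l := Num.max delta zeta; have la : l < alpha by rewrite gt_max da za.
have hs s : l <= s < alpha -> h s <= r * K1.
  by move=> sI; case: (C s) => [//|/negP]; rewrite -leNgt.
have NK : 0 < N * K1 by rewrite mulr_gt0.
have hs' s : l < s < alpha -> h s <= r * K1 by move=> /andP[/ltW ls sa]; rewrite hs// ls.
have [zd|dz] := leP zeta delta.
  have le : l = delta by rewrite /l max_l.
  have := gap_delta_ge0 z0; rewrite (fit_green H delta0) leNgt => /negP; apply.
  rewrite -(opprK (N * K1)) in NK; rewrite oppr_gt0 in NK.
  have : ker (r * K1) alpha delta <= 0.
    by apply: greenL_le0 (ltW da) _ => // t; rewrite -[in delta < t]le; exact: hs'.
  by move: NK; lra.
have le : l = zeta by rewrite /l max_r// ltW.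
have := dW_lt0 dz; rewrite -dgap_zeta// (fit_dgreen H z0) ltNge => /negP; apply.
apply: dgreenL_ge0 (ltW za) _ => // t.
by rewrite -[in zeta < t]le; exact: hs'.
Qed.

(** To the left of [alpha], a minimum at the left end is harmless (nonnegative value at [delta]) or
    impossible (negative slope at [zeta]). An interior minimum below -N K1 would have h > r K1 from
    there on, and then the formula from [alpha] gives a value of at least -N K1. *)
Lemma fit_gap_ge zeta alpha K1 x : 0 < K1 -> fit zeta alpha K1 ->
  Num.max delta zeta <= x -> - (N * K1) <= gap zeta x.
Proof.
move=> K10 H lx; have [z0 da za UA _] := H.
have [s /andP[ls sa] hs] := fit_h_gt K10 H.
have NK : 0 <= N * K1 by rewrite mulr_ge0 ?(ltW N0)// ltW.
have l0 : 0 < Num.max delta zeta by rewrite lt_max delta0.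
have x0 := lt_le_trans l0 lx; have a0 := lt_trans z0 za.
have s0 : 0 < s by exact: lt_le_trans ls.
have ha y : alpha <= y -> r * K1 <= h y.
  by move=> ay; rewrite (le_trans (ltW hs))// h_inc// (le_trans (ltW sa)).
have [ax|xa] := leP alpha x.
  rewrite (fit_green H x0) lerDl greenR_ge0// => t /andP[/ltW + _]; exact: ha.
have [||z /andP[lz za'] [mi D]] := @gap_argmin zeta (Num.max delta zeta) alpha => //.
  by rewrite (le_trans lx)// ltW.
apply: (@le_trans _ _ (gap zeta z)); last by apply: mi; rewrite lx ltW.
move: lz; rewrite le_eqVlt => /predU1P[lz|lz].
  rewrite -lz; have [zd|dz] := leP zeta delta.
    by rewrite (le_trans _ (gap_delta_ge0 z0))// oppr_le0.
  have dz0 : dgap zeta zeta / zeta < 0 by rewrite dgap_zeta// pmulr_llt0 ?invr_gt0//; exact: dW_lt0.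
  have [y /andP[zy ya]] := is_derive_lt0_right (gap_is_derive zeta z0) dz0 za.
  rewrite ltNge => /negP[]; have := mi y; rewrite -lz max_r ?(ltW dz)// => -> //.
  by rewrite !ltW.
move: za'; rewrite le_eqVlt => /predU1P[->|za']; first by rewrite UA.
have z'0 := lt_trans l0 lz.
have {}D : dgap zeta z = 0 by apply: D; rewrite lz za'.
rewrite leNgt; apply/negP => C.
have E : gap zeta z = N * (gap zeta z / N) by rewrite mulrC divfK// gt_eqF.
have := @crit_min zeta z (gap zeta z / N) alpha z'0 za' D E.
have H1 y : z <= y <= alpha -> gap zeta z <= gap zeta y.
  by move=> /andP[zy ya]; apply: mi; rewrite ya (le_trans (ltW lz)).
move=> /(_ H1) hz.
have hz' : r * K1 < h z.
  apply: lt_le_trans hz; rewrite -mulrN ltr_pM2l// ltrNr ltr_pdivrMr// mulNr.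
  by rewrite mulrC.
have : 0 <= ker (r * K1) alpha z.
  apply: greenL_ge0 (ltW za') _ => // t /andP[zt _].
  by rewrite (le_trans (ltW hz'))// h_inc// ltW.
by move: C; rewrite (fit_green H z'0) gtrDl leNgt => ->.
Qed.

Lemma fit_W_ge zeta alpha K1 x : 0 < K1 -> fit zeta alpha K1 ->
  delta <= x <= zeta -> - (N * K1) <= N * kap + W x.
Proof.
move=> K10 H /andP[dx xz]; have [z0 _ _ _ _] := H.
have := fit_gap_ge K10 H (_ : Num.max delta zeta <= zeta); rewrite ge_max lexx andbT.
move=> /(_ (le_trans dx xz)) /le_trans; apply.
by rewrite gap_zeta// lerD2l W_le.
Qed.

(** Both gaps are compared at the first contact point [alpha]: the lower bound holds for [zeta']
    there, and lowering [zeta'] to [zeta] raises the gap. If alpha < zeta', the second pasted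
    solution is still the constant [kap] there and [fit_W_ge] replaces the bound. *)
Lemma fit_lt zeta alpha K1 zeta' alpha' K1' : 0 < K1' ->
  fit zeta alpha K1 -> fit zeta' alpha' K1' -> zeta < zeta' -> K1 < K1'.
Proof.
move=> K10' H H' zz'; have [z0 da za UA _] := H.
suff : - (N * K1') < gap zeta alpha by rewrite UA ltrN2 ltr_pM2l.
have [az'|z'a] := ltP alpha zeta'.
  apply: (@le_lt_trans _ _ (N * kap + W alpha)).
    by apply: fit_W_ge K10' H' _; rewrite !ltW.
  by rewrite gapE ltrD2r mulrC ltr_pM2l// homog_gt.
apply: (@le_lt_trans _ _ (gap zeta' alpha)).
  by apply: fit_gap_ge K10' H' _; rewrite ge_max (ltW da).
by rewrite !gapE ltrD2r ltr_pM2l// homog_lt.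
Qed.

Lemma fit_inj zeta alpha K1 alpha' K1' : 0 < K1 -> 0 < K1' ->
  fit zeta alpha K1 -> fit zeta alpha' K1' -> K1 = K1'.
Proof.
move=> K10 K10' H H'; have [_ da za UA _] := H; have [_ da' za' UA' _] := H'.
have G : - (N * K1) <= gap zeta alpha' by apply: fit_gap_ge K10 H _; rewrite ge_max !ltW.
have G' : - (N * K1') <= gap zeta alpha by apply: fit_gap_ge K10' H' _; rewrite ge_max !ltW.
move: G G'; rewrite UA UA' !lerN2 !ler_pM2l// => G G'.
by apply/eqP; rewrite eq_le G'.
Qed.

Lemma fit_le zeta alpha K1 zeta' alpha' K1' : 0 < K1 -> 0 < K1' ->
  fit zeta alpha K1 -> fit zeta' alpha' K1' -> (zeta < zeta') = (K1 < K1').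
Proof.
move=> K0 K0' H H'; case: (ltgtP zeta zeta') => zz'.
- by rewrite (fit_lt K0' H H').
- by apply/esym/negbTE; rewrite -leNgt ltW// (fit_lt K0 H' H).
- by move: H'; rewrite -zz' => H'; rewrite (fit_inj K0 K0' H H') ltxx.
Qed.

(** Once [zeta] is known the gap is the same function; since h > r K1 from [alpha] on, it stays
    strictly above -N K1 afterwards, so a second contact cannot occur. *)
Lemma fit_unique zeta alpha zeta' alpha' K1 : 0 < K1 ->
  fit zeta alpha K1 -> fit zeta' alpha' K1 -> zeta' = zeta /\ alpha' = alpha.
Proof.
move=> K10 H H'; have zz' : zeta' = zeta.
  apply/eqP; rewrite eq_le !leNgt (fit_le K10 K10 H' H) (fit_le K10 K10 H H').
  by rewrite ltxx.
split => //; rewrite {}zz' in H'.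
wlog aa' : alpha alpha' H H' / alpha < alpha'.
  by move=> WL; case: (ltgtP alpha alpha') => // aa';
    [exact: WL|apply/esym; exact: WL].
have [_ _ za _ _] := H; have [z0 _ _ E _] := H'.
have a0 := lt_trans z0 za; have a'0 := lt_trans a0 aa'.
have [s /andP[ls sa] hs] := fit_h_gt K10 H.
have s0 : 0 < s by rewrite (lt_le_trans _ ls)// lt_max delta0.
have ha y : alpha <= y -> r * K1 < h y.
  by move=> ay; rewrite (lt_le_trans hs)// h_inc// (le_trans (ltW sa)).
have : 0 < ker (r * K1) alpha alpha'.
  apply: (@greenR_gt0 _ _ _ alpha) => //; last exact: ha.
  by move=> t /andP[/ltW /ha /ltW].
by rewrite -(ltrDl (- (N * K1))) -(fit_green H a'0) E ltxx.
Qed.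

(** If zeta <= delta, the gap starts from [delta] with nonnegative value and slope; with h >= 0 from
    there on it never reaches -N K1. *)
Lemma fit_h_ge0 zeta alpha K1 : 0 < K1 -> 0 <= h delta -> fit zeta alpha K1 -> delta < zeta.
Proof.
move=> K10 hd H; have [z0 da za UA _] := H.
rewrite ltNge; apply/negP => zd.
have : 0 <= gap zeta alpha.
  apply: (voc_ge0 m0 n0 h_inc int0 inty delta0 (ltW da) hd).
    exact: gap_delta_ge0.
  by rewrite -/(dgap zeta delta) dgap_delta mulr_ge0 ?(ltW kap0)// dhomog_ge0.
by rewrite UA leNgt oppr_lt0 mulr_gt0.
Qed.

(** A positive interior maximum z would have h <= - r v < 0 up to z. For delta < zeta this makes the
    slope at [zeta] nonnegative, against [dW_lt0]; for delta = zeta the gap starts from zero value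
    and slope, and h <= 0 keeps it nonpositive up to z. *)
Lemma fit_gap_le0 zeta alpha K1 x : 0 < K1 -> fit zeta alpha K1 -> delta <= zeta ->
  zeta <= x <= alpha -> gap zeta x <= 0.
Proof.
move=> K10 H dz xI; have [z0 da za UA _] := H.
have [z /andP[zz' za'] [ma D]] := @gap_argmax zeta zeta alpha z0 (ltW za).
apply: (le_trans (ma _ xI)).
rewrite leNgt; apply/negP => C.
move: zz'; rewrite le_eqVlt => /predU1P[zz'|zz'].
  move: C; rewrite -zz' gap_zeta// ltNge => /negP; apply.
  by have := W_le (lexx delta) dz; rewrite W_delta; lra.
move: za'; rewrite le_eqVlt => /predU1P[zE|za'].
  by move: C; rewrite zE UA oppr_gt0 pmulr_rlt0// ltNge ltW.
have {}D : dgap zeta z = 0 by apply: D; rewrite zz' za'.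
have z'0 := lt_trans z0 zz'.
have E : gap zeta z = N * (gap zeta z / N) by rewrite mulrC divfK// gt_eqF.
have := @crit_max zeta z (gap zeta z / N) alpha z'0 za' D E.
have H1 y : z <= y <= alpha -> gap zeta y <= gap zeta z.
  by move=> /andP[zy ya]; apply: ma; rewrite ya (le_trans (ltW zz')).
move=> /(_ H1) hz.
have hz0 : h z < 0 by rewrite (le_lt_trans hz)// oppr_lt0 mulr_gt0// divr_gt0.
move: dz; rewrite le_eqVlt => /predU1P[dE|dz].
  have Ud : gap zeta delta = N * 0 by rewrite gap_delta -dE homog_id// subrr !mulr0.
  have dUd : dgap zeta delta = 0 by rewrite dgap_delta -dE dhomog_id// mulr0.
  move: C; rewrite (gap_crit delta0 z'0 dUd Ud) !mulr0 oppr0 add0r ltNge => /negP; apply.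
  rewrite dE; apply: greenR_le0 (ltW zz') _ => // s /andP[zs sz].
  by rewrite (le_trans _ (ltW hz0))// h_inc ?(lt_trans z0)// ltW.
have := dW_lt0 dz; rewrite -dgap_zeta// (dgap_crit z'0 z0 D E) ltNge => /negP; apply.
apply: dgreenL_ge0 (ltW zz') _ => // s /andP[zs sz].
by rewrite (le_trans _ hz)// h_inc ?(lt_trans z0)// ltW.
Qed.

(** If h(y) >= - r v, the gap at [alpha] is at least the gap at [y]; as -N K1 is the minimum, v = -
    K1 and the kernel term vanishes, although h exceeds r K1 strictly before [alpha]. *)
Lemma fit_crit_h zeta alpha K1 y v : 0 < K1 -> fit zeta alpha K1 ->
  Num.max delta zeta < y < alpha -> dgap zeta y = 0 -> gap zeta y = N * v ->
  h y < - (r * v).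
Proof.
move=> K10 H /andP[ly ya] D E; rewrite ltNge; apply/negP => hy.
have [z0 da za UA _] := H; have a0 := lt_trans z0 za.
have l0 : 0 < Num.max delta zeta by rewrite lt_max delta0.
have y0 := lt_trans l0 ly.
have Uy := fit_gap_ge K10 H (ltW ly).
have hs t : y < t < alpha -> - (r * v) <= h t.
  by move=> /andP[/ltW yt _]; rewrite (le_trans hy)// h_inc.
have UyA := gap_crit y0 a0 D E.
have kge := greenR_ge0 y0 (ltW ya) hs.
have vE : v = - K1.
  apply/(mulfI (lt0r_neq0 N0)); rewrite -E mulrN; apply/eqP; rewrite eq_le Uy andbT.
  by rewrite -UA UyA E lerDl.
have [s /andP[ls sa] hgt] := fit_h_gt K10 H.
have : 0 < ker (- (r * v)) y alpha.
  apply: (@greenR_gt0 _ _ _ (Num.max s y)) => //; first by rewrite le_max lexx orbT.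
    by rewrite gt_max sa.
  rewrite vE mulrN opprK (lt_le_trans hgt)// h_inc//; first exact: lt_le_trans ls.
  by rewrite le_max lexx.
by rewrite -(ltrDl (N * v)) -UyA UA vE mulrN ltxx.
Qed.

(** At the right one of two critical points, h < - r v there and to the left; seen from it, the
    derivative at the other is strictly positive. *)
Lemma fit_crit_unique zeta alpha K1 y y' : 0 < K1 -> fit zeta alpha K1 ->
  Num.max delta zeta < y < alpha -> Num.max delta zeta < y' < alpha ->
  dgap zeta y = 0 -> dgap zeta y' = 0 -> y = y'.
Proof.
move=> K10 H yI yI' D D'.
wlog yy' : y y' yI yI' D D' / y < y'.
  by move=> WL; case: (ltgtP y y') => // yy'; [exact: WL|apply/esym; exact: WL].
have l0 : 0 < Num.max delta zeta by rewrite lt_max delta0.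
have y0 : 0 < y by apply: lt_trans l0 _; case/andP: yI.
have y'0 := lt_trans y0 yy'.
have E : gap zeta y' = N * (gap zeta y' / N) by rewrite mulrC divfK// gt_eqF.
have hy' := fit_crit_h K10 H yI' D' E.
have : 0 < dker (- (r * (gap zeta y' / N))) y' y.
  apply: dgreenL_gt0 => // s /andP[ys sy].
  by rewrite (le_lt_trans _ hy')// h_inc ?(lt_trans y0)// ltW.
by rewrite -(dgap_crit y'0 y0 D' E) D ltxx.
Qed.

(** For zeta < delta the gap has positive value and slope at [delta] and is negative at [alpha], so
    its maximum between them is positive and interior. *)
Lemma fit_xhat zeta alpha K1 : 0 < K1 -> fit zeta alpha K1 -> zeta < delta ->
  exists x, [/\ delta < x < alpha, dgap zeta x = 0, 0 < gap zeta x,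
    forall y, delta <= y <= alpha -> gap zeta y <= gap zeta x
    & h x < - (r * (gap zeta x / N))].
Proof.
move=> K10 H zd; have [z0 da za UA _] := H.
have U0 : 0 < gap zeta delta by rewrite gap_delta mulr_gt0// subr_gt0 homog_gt.
have dU0 : 0 < dgap zeta delta / delta by rewrite divr_gt0// dgap_delta mulr_gt0// dhomog_gt0.
have [x /andP[dx xa] [ma D]] := @gap_argmax zeta delta alpha delta0 (ltW da).
have Ux : 0 < gap zeta x by rewrite (lt_le_trans U0)// ma// lexx ltW.
have {}xa : x < alpha.
  rewrite lt_neqAle xa andbT; apply/eqP => xE.
  by move: Ux; rewrite xE UA oppr_gt0 pmulr_rlt0// ltNge ltW.
have {}dx : delta < x.
  rewrite lt_neqAle dx andbT; apply/eqP => xE.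
  have [y /andP[dy ya]] := is_derive_gt0_right (gap_is_derive zeta delta0) dU0 da.
  by rewrite ltNge xE ma// !ltW.
have {}D : dgap zeta x = 0 by apply: D; rewrite dx.
exists x; split => //; first by rewrite dx.
apply: (fit_crit_h K10 H) => //; first by rewrite max_l ?(ltW zd)// dx.
by rewrite mulrC divfK// gt_eqF.
Qed.

(** The difference of the gaps for [zeta] and for [delta] is increasing. At [x] it is at least the
    gap for [zeta], since h <= 0 up to [x] makes the other one nonpositive; at [alpha] it is at most
    -N K1 + N K1d. *)
Lemma fit_xhat_le zeta alpha K1 alphad K1d x : 0 < K1 -> 0 < K1d ->
  fit zeta alpha K1 -> fit delta alphad K1d -> zeta < delta -> delta < x < alpha ->
  h x <= 0 -> gap zeta x / N <= K1d - K1.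
Proof.
move=> K10 K1d0 H Hd zd /andP[dx xa] hx; have [z0 da za UA _] := H.
have x0 := lt_trans delta0 dx; have a0 := lt_trans x0 xa.
rewrite ler_pdivrMr//.
have Ud : gap delta delta = N * 0 by rewrite gap_delta homog_id// subrr !mulr0.
have dUd : dgap delta delta = 0 by rewrite dgap_delta dhomog_id// mulr0.
have Ux : gap delta x <= 0.
  rewrite (gap_crit delta0 x0 dUd Ud) !mulr0 oppr0 add0r; apply: greenR_le0 (ltW dx) _ => //.
  move=> s /andP[ds sx].
  by rewrite (le_trans _ hx)// h_inc ?(lt_trans delta0)// ltW.
have Ua : - (N * K1d) <= gap delta alpha by apply: fit_gap_ge K1d0 Hd _; rewrite maxxx ltW.
have inc : homog zeta x - homog delta x <= homog zeta alpha - homog delta alpha.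
  have E t : homog zeta t - homog delta t = s2 * (n * (t `^ m * (zeta `^ (- m) - delta `^ (- m)))
    - m * (t `^ n * (zeta `^ (- n) - delta `^ (- n)))) by rewrite /homog; ring.
  rewrite !E ler_pM2l// lerB//.
    rewrite ler_pM2l// ler_wnM2r ?powR_len ?(ltW xa)// subr_le0.
    by rewrite powR_lep ?oppr_gt0 ?(ltW zd).
  rewrite ler_nM2l// ler_wpM2r ?powR_lep ?(ltW xa)// subr_ge0.
  by rewrite powR_len ?oppr_lt0 ?(ltW zd).
have : kap * (homog zeta x - homog delta x) <= kap * (homog zeta alpha - homog delta alpha) by rewrite ler_pM2l.
move: UA Ua Ux; rewrite !gapE; lra.
Qed.

Lemma fit_exists K1 : 0 < K1 -> exists zeta alpha, fit zeta alpha K1.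
Proof.
move=> K10; pose c := r * K1; have rk : 0 < r * kap by rewrite mulr_gt0.
have [a [da ha hlt]] := h_crossing c delta0; have a0 := lt_le_trans delta0 da.
(* By [fit_eqs] the unknowns must satisfy zeta^(-m) = P(alpha) and zeta^(-n) = Q(alpha); the second
   gives [zeta], and the first becomes f(alpha) = 0. *)
pose P x := m / (r * kap) * (p1 - A c x); pose Q x := n / (r * kap) * B c x.
have Q0 x : a <= x -> 0 < Q x.
  move=> ax; rewrite !mulr_gt0 ?invr_gt0//; apply: B_pos; first exact: lt_le_trans ax.
  by rewrite (le_trans ha)// h_inc.
pose f x := P x - Q x `^ (m / n).
have QK x : a <= x -> (Q x `^ (- n^-1)) `^ (- m) = Q x `^ (m / n).
  by move=> ax; rewrite -powRrM mulrNN mulrC.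
have QK' x : a <= x -> (Q x `^ (- n^-1)) `^ (- n) = Q x.
  by move=> ax; rewrite -powRrM mulrNN mulVf// powRr1//; exact/ltW/Q0.
(* If f(a) >= 0, the contact point z read off from Q(a) would make [homog z delta] smaller than its
   minimum N, because h < c between [delta] and the first crossing [a]. *)
have fa : f a < 0.
  rewrite subr_lt0 ltNge; apply/negP => PQ.
  pose z := Q a `^ (- n^-1); have z0 : 0 < z by apply: powR_gt0; exact: Q0.
  have key : n * delta `^ m * P a - m * delta `^ n * Q a =
      - (m * n * ker c a delta / (r * kap)) + (n - m) * (1 - K1 / kap).
    have := Bdelta; rewrite BE// => /subr0_eq BD.
    rewrite /P /Q /green (AE c delta0) (BE c delta0) BD /c !powRN; field.
    by rewrite m0' n0' !gt_eqF ?powR_gt0.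
  have k0 : ker c a delta <= 0.
    by apply: greenL_le0 => // s /andP[/ltW ds sa]; rewrite ltW// hlt// ds.
  have := homog_ge z0 delta0; rewrite /homog ler_pM2l// QK// QK'//.
  apply/negP; rewrite -ltNge.
  apply: (@le_lt_trans _ _ (n * delta `^ m * P a - m * delta `^ n * Q a)).
    rewrite [m * (_ * _)]mulrA lerD2r mulrA ler_pM2l// mulr_gt0// powR_gt0//.
  rewrite key.
  have h1 : 0 <= m * n * ker c a delta / (r * kap).
    by rewrite divr_ge0 ?(ltW rk)// mulr_le0// nmulr_rle0// ltW.
  have h2 : 0 < (n - m) * (K1 / kap) by rewrite mulr_gt0// divr_gt0.
  by move: h1 h2; lra.
(* X^(-m) separates the two terms. The summand r kap in [c2] gives X^(-n) < Q(X), hence Q(X)^(m/n) <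
   X^(-m); the extra 1 in [c2 + 1] outgrows the constant p1 - A(X0) and gives X^(-m) < P(X). *)
have [X aX fX] : exists2 X, a <= X & 0 < f X.
  pose c2 := c + r * kap.
  have [X0 [aX0 X00 hX0]] := h_large (c2 + 1) a.
  have nm0 : 0 < - m by rewrite oppr_gt0.
  have [X [X0X X0' Xm]] := powR_large ((p1 - A (c2 + 1) X0) * - m) X0 nm0.
  have aX : a <= X by exact: le_trans X0X.
  exists X => //; rewrite subr_gt0.
  have hX s : X0 <= s -> c2 + 1 <= h s by move=> sX; rewrite (le_trans (ltW hX0))// h_inc.
  apply: (@lt_trans _ _ (X `^ (- m))).
    rewrite -QK//; apply: powR_ltp; [by []|by apply: powR_gt0; exact: Q0|].
    have QX : X `^ (- n) < Q X.
      have : 0 < B c2 X by apply: B_pos => //; rewrite (le_trans _ (hX X X0X))// lerDl.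
      rewrite (BnE n0 h_inc inty c2 c X0') /c2 addrAC subrr add0r subr_gt0 /Q.
      rewrite ltr_pdivrMr// => H; rewrite -[X in X < _](mulKf (lt0r_neq0 rk)).
      have -> : n / (r * kap) * B c X = (r * kap)^-1 * (B c X * n) by ring.
      by rewrite ltr_pM2l ?invr_gt0.
    have XE : X = (X `^ (- n)) `^ (- n^-1).
      by rewrite -powRrM mulrNN mulfV// powRr1// ltW.
    by rewrite [ltRHS]XE; apply: powR_ltn; rewrite ?oppr_lt0 ?invr_gt0 ?powR_gt0.
  have AX : A (c2 + 1) X0 <= A (c2 + 1) X.
    by apply: A_le => // s /andP[/ltW /hX].
  have E : A (c2 + 1) X = A c X + (r * kap + 1) * X `^ (- m) / m.
    by rewrite (AmE m0 h_inc int0 (c2 + 1) c X0') /c2; congr (_ + _ * _ / _); ring.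
  have : p1 - A (c2 + 1) X < - (X `^ (- m) / m).
    rewrite -mulrN -invrN ltr_pdivlMr//; apply: le_lt_trans Xm.
    by rewrite ler_pM2r// lerD2l lerN2.
  rewrite E => H; rewrite /P.
  have H' : p1 - A c X < r * kap * X `^ (- m) / m by move: H; lra.
  have -> : X `^ (- m) = m / (r * kap) * (r * kap * X `^ (- m) / m).
    by field; rewrite m0' !gt_eqF.
  by rewrite ltr_nM2l// pmulr_llt0// invr_gt0.
have [|alpha /andP[aal _] fal] := IVT_sign aX _ fa fX.
  move=> t /andP[at_ _]; have t0 := lt_le_trans a0 at_.
  apply: cvgB.
    apply: cvgM; first exact: cvg_cst.
    by apply: cvgB; [exact: cvg_cst|exact: Ac_continuous].
  have cQ : {for t, continuous Q}.
    by apply: cvgM; [exact: cvg_cst|exact: Bc_continuous].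
  by apply: (@continuous_comp _ _ _ Q (fun s => s `^ (m / n))) => //; apply: powR_continuous; exact: Q0.
have dal := le_lt_trans da aal; have al0 := lt_trans delta0 dal.
pose zeta := Q alpha `^ (- n^-1); have z0 : 0 < zeta by apply: powR_gt0; apply: Q0; exact: ltW.
have zm : zeta `^ (- m) = P alpha.
  by rewrite QK ?(ltW aal)//; apply/esym/eqP; rewrite -subr_eq0 -/(f alpha) fal.
have zn : zeta `^ (- n) = Q alpha by rewrite QK' ?(ltW aal).
have Da : dgap zeta alpha = 0.
  rewrite /dgap /dvoc zm zn /P /Q (AE c al0) (BE c al0) /c !powRN; field.
  by rewrite m0' n0' !gt_eqF ?powR_gt0.
have Ua : gap zeta alpha = - (N * K1).
  rewrite /gap /voc zm zn /P /Q (AE c al0) (BE c al0) /c rE !powRN; field.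
  by rewrite m0' n0' !gt_eqF ?powR_gt0.
exists zeta, alpha; split => //.
rewrite ltNge; apply/negP => az.
have k1 : kap * dhomog zeta alpha <= 0 by rewrite pmulr_rle0// dhomog_le0.
by have := ler_ltD k1 (dW_lt0 dal); rewrite -dgapE Da addr0 ltxx.
Qed.

(** For zeta = delta the gap is [ker 0 delta]: it dips below 0 just after [delta], where h < 0, and
    ends up positive because [B 0 delta] is. Its interior minimum is the contact point. *)
Lemma fit_delta : h delta < 0 -> exists K1d alpha, 0 < K1d /\ fit delta alpha K1d.
Proof.
move=> hd.
have Ud : gap delta delta = N * 0 by rewrite gap_delta homog_id// subrr !mulr0.
have dUd : dgap delta delta = 0 by rewrite dgap_delta dhomog_id// mulr0.
have UK y : 0 < y -> gap delta y = ker 0 delta y.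
  by move=> y0; rewrite (gap_crit delta0 y0 dUd Ud) !mulr0 oppr0 add0r.
have Bd : 0 < B 0 delta.
  have := Bdelta; rewrite BE// => /subr0_eq ->.
  by rewrite divr_gt0// !mulr_gt0// powR_gt0.
have [X dX UX] : exists2 X, delta < X & 0 < gap delta X.
  have Bd2 : 0 < B 0 delta / 2 by rewrite divr_gt0.
  have [M [dM _ hM]] := h_large 0 (Num.max delta 1).
  have [z [Mz z0] Bz] := Bn_small n0 h_inc inty M h_y Bd2.
  pose C := `|A 0 z - A 0 delta|.
  (* As [B 0 z] is less than half of [B 0 delta], the growing term is at least X^n times the other
     half and beats the bounded term [C]. *)
  have [X [zX X0 CX]] := powR_large (C / (B 0 delta / 2)) (z + 1) n0.
  have {}zX : z < X by move: zX; lra.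
  have [dz z1] : delta <= z /\ 1 <= z.
    by move: (le_trans dM Mz); rewrite ge_max => /andP[].
  exists X; first exact: le_lt_trans zX.
  rewrite UK//.
  have k0 : 0 <= ker 0 z X.
    apply: greenR_ge0 (ltW zX) _ => // s /andP[/ltW zs _].
    rewrite (le_trans (ltW hM))// h_inc//; last exact: le_trans zs.
    by move: dM; rewrite ge_max => /andP[/(lt_le_trans delta0)].
  have -> : ker 0 delta X = X `^ n * (B 0 delta - B 0 z) - X `^ m * (A 0 z - A 0 delta) + ker 0 z X.
    by rewrite /green; ring.
  apply: ltr_pwDl => //; rewrite subr_gt0; apply: (@le_lt_trans _ _ C).
    apply: (@le_trans _ _ (X `^ m * C)); first by rewrite ler_wpM2l ?powR_ge0// ler_norm.
    rewrite ler_piMl ?normr_ge0//.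
    have := @powR_len _ 1 X m m0 ltr01 (le_trans z1 (ltW zX)).
    by rewrite powR1.
  apply: (@lt_trans _ _ (X `^ n * (B 0 delta / 2))).
    by rewrite -ltr_pdivrMr.
  by rewrite ltr_pM2l ?powR_gt0//; move: Bz; lra.
have [y /andP[dy yX] hy] := h_right delta0 dX hd.
have y0 := lt_trans delta0 dy.
have Uy : gap delta y < 0.
  rewrite UK//; apply: greenR_lt0 => // s /andP[ds sy].
  by rewrite (le_lt_trans _ hy)// h_inc ?(lt_trans delta0)// ltW.
have [z /andP[dz zX] [mi D]] := @gap_argmin delta delta X delta0 (ltW dX).
have Uz : gap delta z < 0 by rewrite (le_lt_trans _ Uy)// mi// !ltW.
have {}dz : delta < z.
  by rewrite lt_neqAle dz andbT; apply/eqP => E; move: Uz; rewrite -E Ud mulr0 ltxx.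
have {}zX : z < X.
  by rewrite lt_neqAle zX andbT; apply/eqP => E; move: Uz; rewrite E ltNge ltW.
exists (- (gap delta z / N)), z; split; first by rewrite oppr_gt0 pmulr_llt0 ?invr_gt0.
split => //; last by apply: D; rewrite dz.
by rewrite mulrN opprK mulrC divfK// gt_eqF.
Qed.

End free_boundaries.

(** * Piecewise solutions and the HJB equation *)

Section piecewise.
Context {R : realType} (h : R -> R).

(** The derivatives are carried as explicit functions, so that pasting stays a pointwise matter. The
    second one is claimed only off [F] and where [h] is continuous. *)
Definition C2h (F : set R) (f f1 f2 : R -> R) :=
  [/\ forall x : R, 0 < x -> is_derive x 1 f (f1 x),
      forall x : R, 0 < x -> {for x, continuous f1}
    & forall x : R, 0 < x -> ~ F x -> {for x, continuous h} ->
        is_derive x 1 f1 (f2 x) /\ {for x, continuous f2}].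

Definition paste (z : R) (f g : R -> R) (x : R) := if x <= z then f x else g x.

Lemma near_pos (x : R) : 0 < x -> \forall y \near x, 0 < y.
Proof. by move=> x0; near=> y; near: y; exact: lt_nbhsr. Unshelve. all: by end_near. Qed.

Lemma near_glue_lt (z : R) f g x : x < z -> \forall y \near x, f y = paste z f g y.
Proof.
move=> xz; near=> y; rewrite /paste ifT//; apply/ltW; near: y; exact: lt_nbhsl.
Unshelve. all: by end_near. Qed.

Lemma near_glue_gt (z : R) f g x : z < x -> \forall y \near x, g y = paste z f g y.
Proof.
move=> xz; near=> y; rewrite /paste ifN// -ltNge; near: y; exact: lt_nbhsr.
Unshelve. all: by end_near. Qed.

Lemma C2h_cst F (c : R) : C2h F (cst c) (cst 0) (cst 0).
Proof.
split=> [x _|x _|x _ _ _]; first exact: is_derive_cst.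
  exact: cvg_cst.
by split; [exact: is_derive_cst|exact: cvg_cst].
Qed.

Lemma C2h_lin F k l f f1 f2 g g1 g2 : C2h F f f1 f2 -> C2h F g g1 g2 ->
  C2h F (fun x => k * f x + l * g x) (fun x => k * f1 x + l * g1 x)
        (fun x => k * f2 x + l * g2 x).
Proof.
have D (x : R) (u v : R -> R) (du dv : R) : is_derive x 1 u du -> is_derive x 1 v dv ->
    is_derive x 1 (fun x => k * u x + l * v x) (k * du + l * dv).
  by move=> Du Dv; exact: is_deriveD (is_deriveZ k Du) (is_deriveZ l Dv).
have C (x : R) (u v : R -> R) : {for x, continuous u} -> {for x, continuous v} ->
    {for x, continuous (fun x => k * u x + l * v x)}.
  by move=> cu cv; apply: cvgD; apply: cvgM => //; exact: cvg_cst.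
move=> [Df Cf Ef] [Dg Cg Eg]; split=> [x x0|x x0|x x0 xF hx].
- by apply: D; [exact: Df|exact: Dg].
- by apply: C; [exact: Cf|exact: Cg].
- have [Ef1 Ef2] := Ef x x0 xF hx; have [Eg1 Eg2] := Eg x x0 xF hx.
  by split; [exact: D|exact: C].
Qed.

(** Values and first derivatives agree at the junction but second derivatives may not, hence the new
    point in the exceptional set. *)
Lemma C2h_glue F z f f1 f2 g g1 g2 : f z = g z -> f1 z = g1 z ->
  C2h F f f1 f2 -> C2h F g g1 g2 ->
  C2h (z |` F) (paste z f g) (paste z f1 g1) (paste z f2 g2).
Proof.
move=> fg fg1 [Df Cf Ef] [Dg Cg Eg]; split=> [x x0|x x0|x x0 xF hx].
- have [xz|zx|xz] := ltgtP x z.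
  + rewrite {2}/paste ltW//; exact: is_derive_ext (near_glue_lt _ _ xz) (Df _ x0).
  + rewrite {2}/paste leNgt zx/=; exact: is_derive_ext (near_glue_gt _ _ zx) (Dg _ x0).
  + rewrite {2}/paste xz lexx; apply: is_derive_glue => //; rewrite -?xz; first exact: Df.
    by rewrite xz fg1 -xz; exact: Dg.
- have [xz|zx|xz] := ltgtP x z.
  + exact: continuous_ext (near_glue_lt _ _ xz) (Cf _ x0).
  + exact: continuous_ext (near_glue_gt _ _ zx) (Cg _ x0).
  + by rewrite xz; apply: continuous_glue => //; rewrite -xz; [exact: Cf|exact: Cg].
- have [xz|zx|xz] := ltgtP x z; last by case: xF; left.
  + have [|E1 E2] := Ef x x0 _ hx; first by move=> Fx; apply: xF; right.
    split; last exact: continuous_ext (near_glue_lt _ _ xz) E2.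
    rewrite {2}/paste ltW//; exact: is_derive_ext (near_glue_lt _ _ xz) E1.
  + have [|E1 E2] := Eg x x0 _ hx; first by move=> Fx; apply: xF; right.
    split; last exact: continuous_ext (near_glue_gt _ _ zx) E2.
    rewrite {2}/paste leNgt zx/=; exact: is_derive_ext (near_glue_gt _ _ zx) E1.
Qed.

Lemma C2h_sub F F' f f1 f2 : F `<=` F' -> C2h F f f1 f2 -> C2h F' f f1 f2.
Proof.
by move=> FF [D C E]; split => // x x0 xF; apply: E => // /FF.
Qed.

Lemma C2h_derive1 F f f1 f2 (x : R) : C2h F f f1 f2 -> 0 < x -> derive1 f x = f1 x.
Proof. by move=> [D _ _] x0; rewrite derive1E; have [_ ->] := D _ x0. Qed.

Lemma C2h_near F f f1 f2 (x : R) : C2h F f f1 f2 -> 0 < x -> \forall y \near x, f1 y = derive1 f y.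
Proof.
by move=> H x0; apply: filterS (near_pos x0) => y y0; rewrite (C2h_derive1 H).
Qed.

Lemma C2h_derive2 F f f1 f2 (x : R) : C2h F f f1 f2 -> 0 < x -> ~ F x ->
  {for x, continuous h} -> is_derive x 1 (derive1 f) (f2 x).
Proof.
move=> H x0 xF hx; apply: is_derive_ext (C2h_near H x0) _.
by case: H => _ _ /(_ x x0 xF hx)[].
Qed.

Lemma C2h_C1 F f f1 f2 : C2h F f f1 f2 -> C1_on_pos f.
Proof.
move=> H x x0; split; first by have [/(_ _ x0)[]] := H.
apply: continuous_ext (C2h_near H x0) _.
by have [_ C _] := H; exact: C.
Qed.

Lemma C2h_C2 F f f1 f2 : C2h F f f1 f2 ->
  C2_off (F `|` [set x | ~ {for x, continuous h}]) f.
Proof.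
move=> H; split.
  by move=> x x0 /not_orP[xF /contrapT hx]; have [] := C2h_derive2 H x0 xF hx.
apply: (@subspace_eq_continuous _ _ _ f2).
  move=> x /[!inE] -[/= x0 /not_orP[xF /contrapT hx]].
  by have [_ <-] := C2h_derive2 H x0 xF hx; rewrite -derive1E.
apply: continuous_in_subspaceT => x /[!inE] -[/= x0 /not_orP[xF /contrapT hx]].
by have [_ _ /(_ x x0 xF hx)[]] := H.
Qed.

Lemma C2h_continuous F f f1 f2 (x : R) : C2h F f f1 f2 -> 0 < x -> {for x, continuous f}.
Proof. by move=> [D _ _] x0; exact: is_derive_continuous (D _ x0). Qed.

Hypothesis h_inc : increasing_on_pos h.
Hypothesis h_rc : forall x : R, 0 < x -> h y @[y --> x^'+] --> h x.

Lemma discontinuities_countable (a b : R) : 0 < a ->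
  countable [set x | a < x < b /\ ~ {for x, continuous h}].
Proof.
move=> a0; have nd : {in `[a, b]%R &, {homo h : x y / (x <= y)%R}}.
  by move=> x y /[!in_itv]/= /andP[ax _] _; apply: h_inc; exact: lt_le_trans ax.
apply: sub_countable (discontinuity_countable nd).
apply: subset_card_le => x [/andP[ax xb] hx]; split; first by rewrite in_itv/= ax.
have x0 := lt_trans a0 ax.
have cl : cvg (h y @[y --> x^'-]).
  apply: nondecreasing_at_left_is_cvgr.
    near=> t => y z; rewrite !in_itv/= => /andP[ty _] _; apply: h_inc; apply: lt_trans ty.
    by near: t; apply: nbhs_left_gt.
  near=> t; exists (h x) => _ [y + <-]; rewrite /= in_itv/= => /andP[ty yx].
  apply: h_inc; last exact: ltW.
  by apply: lt_trans ty; near: t; apply: nbhs_left_gt.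
have cr : cvg (h y @[y --> x^'+]) by apply/cvg_ex; exists (h x); exact: h_rc.
split => //; apply/eqP; rewrite (cvg_lim _ (h_rc x0))// => E.
apply: hx; apply/left_right_continuousP; split; last exact: h_rc.
by rewrite -E.
Unshelve. all: by end_near. Qed.

(** A monotone function has countably many jumps, and a nonempty open interval is not a null set.
    This makes the points where the HJB equation is imposed dense. *)
Lemma exists_continuity_point (F : set R) (a b : R) : finite_set F -> 0 < a -> a < b ->
  exists2 x, a < x < b & ~ F x /\ {for x, continuous h}.
Proof.
move=> finF a0 ab; apply: contrapT => /forall2NP H.
have : countable (`]a, b[%classic : set R).
  apply: (@sub_countable _ _ _ (F `|` [set x | a < x < b /\ ~ {for x, continuous h}])); last first.
    rewrite -bigcup2E; apply: bigcup_countable => // -[|[|i]] _ /=.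
    - exact: finite_set_countable.
    - exact: discontinuities_countable.
    - exact: countable0.
  apply: subset_card_le => x; rewrite /= in_itv/= => xab.
  have [//|/not_andP[/contrapT|]] := H x; first by left.
  by right.
move=> /countable_lebesgue_measure0; rewrite lebesgue_measure_itv/= lte_fin ab -EFinD.
by move=> /eqP; rewrite eqe subr_eq0 (gt_eqF ab).
Qed.

End piecewise.

Section hjb.
Context {R : realType} (m n b sigma r kap delta : R) (h : R -> R).
Local Notation mu := (@lebesgue_measure R).
Local Notation s2 := (sigma ^+ 2).
Hypotheses (m0 : m < 0) (n0 : 0 < n) (s20 : 0 < s2) (mn : s2 * m * n = - r).
Hypothesis mpn : s2 * (m + n) = s2 - b.
Hypothesis h_inc : increasing_on_pos h.
Hypothesis h_rc : forall x : R, 0 < x -> h y @[y --> x^'+] --> h x.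
Hypothesis h_y : h x @[x --> +oo] --> +oo.
Hypothesis int0 : mu.-integrable `]0, 1] (EFin \o (fun s : R => s `^ (- m - 1) * h s)).
Hypothesis inty : mu.-integrable `[1, +oo[ (EFin \o (fun s : R => s `^ (- n - 1) * h s)).
Hypotheses (kap0 : 0 < kap) (delta0 : 0 < delta).
Hypothesis Bdelta : Bn n h (r * kap) delta = 0.

Local Notation A := (Am m h).
Local Notation B := (Bn n h).
Local Notation N := (s2 * (n - m)).
Local Notation sol := (voc m n h).
Local Notation dsol := (dvoc m n h).
Local Notation p1 := (A 0 delta + r * kap * delta `^ (- m) / m).
Local Notation W := (sol p1 0).
Local Notation U := (gap m n r kap delta h).
Local Notation HH := (homog m n s2).

Let nm : 0 < n - m. Proof. by rewrite subr_gt0 (lt_trans m0). Qed.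
Let N0 : 0 < N. Proof. by rewrite mulr_gt0. Qed.
Let N' : N != 0. Proof. by rewrite gt_eqF. Qed.
Let NK x : - N^-1 * - (N * x) = x.
Proof. by rewrite mulrNN mulKf. Qed.
Let r_gt0 : 0 < r.
Proof. by rewrite -[r]opprK -mn oppr_gt0 pmulr_llt0// pmulr_rlt0. Qed.

(** The operator x d/dx applied to [dvoc], at points where [h] is continuous. *)
Definition d2voc (a c x : R) :=
  m ^+ 2 * x `^ m * (a - A 0 x) + n ^+ 2 * x `^ n * (c - B 0 x) + (n - m) * h x.

Lemma C2h_voc F a c : C2h h F (sol a c) (fun x => dsol a c x / x)
  (fun x => (d2voc a c x - dsol a c x) / x ^+ 2).
Proof.
have cc (x k : R) (f : R -> R) : {for x, continuous f} ->
    {for x, continuous (fun y => k * f y)}.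
  by move=> cf; apply: cvgM => //; exact: cvg_cst.
have cA (x k p q : R) : 0 < x -> {for x, continuous (fun y => k * y `^ p * (q - A 0 y))}.
  move=> x0; apply: cvgM; first by exact: (cc x k (fun y => y `^ p) (@powR_continuous _ x p x0)).
  apply: cvgB; [exact: cvg_cst|exact: (A_continuous m0 n0 h_inc int0 inty x0)].
have cB (x k p q : R) : 0 < x -> {for x, continuous (fun y => k * y `^ p * (q - B 0 y))}.
  move=> x0; apply: cvgM; first by exact: (cc x k (fun y => y `^ p) (@powR_continuous _ x p x0)).
  apply: cvgB; [exact: cvg_cst|exact: (B_continuous m0 n0 h_inc int0 inty x0)].
have cd (x : R) : 0 < x -> {for x, continuous (dsol a c)}.
  by move=> x0; apply: cvgD; [exact: cA|exact: cB].
split=> [x x0|x x0|x x0 _ hx].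
- exact: (voc_is_derive m0 n0 h_inc int0 inty).
- by apply: cvgM; [exact: cd|apply: cvgV; [rewrite gt_eqF|exact: cvg_id]].
- split.
    have D := dvoc_is_derive m0 n0 h_inc int0 inty a c x0 hx.
    have x' : id x != 0 by rewrite gt_eqF.
    apply: is_derive_eq (is_deriveM D (is_deriveV x' (is_derive_id x 1))) _.
    by rewrite /GRing.scale /= -/(d2voc a c x) mulr1; field; rewrite gt_eqF.
  apply: cvgM.
    apply: cvgB; last exact: cd.
    by apply: cvgD; [apply: cvgD; [exact: cA|exact: cB]|exact: cc].
  by apply: cvgV; [rewrite sqrf_eq0 gt_eqF|exact: exprn_continuous].
Qed.

Lemma voc_ode a c x : 0 < x ->
  s2 * x ^+ 2 * ((d2voc a c x - dsol a c x) / x ^+ 2) + b * x * (dsol a c x / x)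
    - r * sol a c x = N * h x.
Proof.
move=> x0.
have bE : b = s2 - s2 * (m + n) by rewrite mpn; ring.
have rE : r = - (s2 * m * n) by rewrite mn opprK.
rewrite /d2voc /dvoc /voc bE rE; field.
by rewrite gt_eqF.
Qed.

Lemma C2h_affine F (k c : R) f f1 f2 : C2h h F f f1 f2 ->
  C2h h F (fun x => k * f x + c) (fun x => k * f1 x) (fun x => k * f2 x).
Proof.
move=> H; have := C2h_lin k 1 H (C2h_cst h F c).
by congr C2h; apply/funext => x; rewrite mul1r//= addr0.
Qed.

Variables (zeta alpha K1 : R).
Hypotheses (K10 : 0 < K1) (H : fit m n s2 r kap delta h zeta alpha K1).

Definition v1 := paste delta (cst kap) (fun x => - N^-1 * W x + 0).
Definition v1' := paste delta (cst 0) (fun x => - N^-1 * (dsol p1 0 x / x)).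
Definition v1'' := paste delta (cst 0)
  (fun x => - N^-1 * ((d2voc p1 0 x - dsol p1 0 x) / x ^+ 2)).

Local Notation dU := (dgap m n r kap delta h zeta).
Local Notation d2U := (d2voc (p1 - r * kap * zeta `^ (- m) / m) (r * kap * zeta `^ (- n) / n)).

(** The middle piece is written as a sum of two [voc] terms, so that their regularity applies; the
    contributions of [h] cancel and [kap * homog zeta / N] remains. The summand with [W] is the
    right piece of [v1], used here also below [delta] when zeta < delta. *)
Definition v0 := paste zeta (cst kap) (paste alpha (fun x => N^-1 * U zeta x + - N^-1 * W x)
  (fun x => - N^-1 * W x + - K1)).
Definition v0' := paste zeta (cst 0) (paste alpha
  (fun x => N^-1 * (dU x / x) + - N^-1 * (dsol p1 0 x / x))
  (fun x => - N^-1 * (dsol p1 0 x / x))).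
Definition v0'' := paste zeta (cst 0) (paste alpha
  (fun x => N^-1 * ((d2U x - dU x) / x ^+ 2) + - N^-1 * ((d2voc p1 0 x - dsol p1 0 x) / x ^+ 2))
  (fun x => - N^-1 * ((d2voc p1 0 x - dsol p1 0 x) / x ^+ 2))).

Let zeta0 : 0 < zeta. Proof. by case: H. Qed.
Let da : delta < alpha. Proof. by case: H. Qed.
Let za : zeta < alpha. Proof. by case: H. Qed.
Let UA : U zeta alpha = - (N * K1). Proof. by case: H. Qed.
Let dUA : dU alpha = 0. Proof. by case: H. Qed.
Let Wd : W delta = - (N * kap).
Proof. exact: W_delta. Qed.
Let dWd : dsol p1 0 delta = 0.
Proof. by apply: (@dW_delta _ _ _ s2). Qed.

Let W_le (x y : R) : delta <= x -> x <= y -> W y <= W x.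
Proof. exact: (W_le m0 n0 mn h_inc h_y int0 inty delta0 Bdelta). Qed.
Let gapE x : U zeta x = kap * HH zeta x + W x.
Proof. exact: gapE. Qed.

Let C2v1 : C2h h (delta |` set0) v1 v1' v1''.
Proof.
apply: C2h_glue; last by apply: C2h_affine; exact: C2h_voc.
- by rewrite Wd NK addr0.
- by rewrite dWd mul0r mulr0.
- exact: C2h_cst.
Qed.

Let C2v0 : C2h h (zeta |` (alpha |` set0)) v0 v0' v0''.
Proof.
have sA x : dU x / x - dsol p1 0 x / x = kap * dhomog m n s2 zeta x / x.
  by rewrite (@dgapE _ m n s2 r kap delta h m0 n0 mn zeta x); ring.
apply: C2h_glue; first by rewrite /paste ltW// mulNr -mulrBr gapE homog_id// addrK mulrCA mulVf// mulr1.
- by rewrite /paste ltW// mulNr -mulrBr sA dhomog_id// !(mulr0, mul0r).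
- exact: C2h_cst.
apply: C2h_glue.
- by rewrite UA mulrN mulKf// addrC.
- by rewrite dUA mul0r mulr0 add0r.
- by apply: C2h_lin; exact: C2h_voc.
- by apply: C2h_affine; exact: C2h_voc.
Qed.

Lemma v1_lo x : x <= delta -> v1 x = kap.
Proof. by move=> xd; rewrite /v1 /paste xd. Qed.

Lemma v1_hi x : delta <= x -> v1 x = - N^-1 * W x.
Proof.
rewrite le_eqVlt => /predU1P[<-|dx]; first by rewrite v1_lo// Wd NK.
by rewrite /v1 /paste leNgt dx/= addr0.
Qed.

Lemma v0_lo x : x <= zeta -> v0 x = kap.
Proof. by move=> xd; rewrite /v0 /paste xd. Qed.

Lemma v0_mid x : zeta <= x <= alpha -> v0 x = N^-1 * (kap * HH zeta x).
Proof.
move=> /andP[+ xa]; rewrite le_eqVlt => /predU1P[<-|zx].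
  by rewrite v0_lo// homog_id// mulrCA mulVf// mulr1.
by rewrite /v0 /paste leNgt zx/= xa gapE; ring.
Qed.

Lemma v0_hi x : alpha <= x -> v0 x = - N^-1 * W x - K1.
Proof.
rewrite le_eqVlt => /predU1P[<-|ax].
  rewrite v0_mid ?lexx ?(ltW za)//.
  have : kap * HH zeta alpha = - (N * K1) - W alpha by rewrite -UA gapE; ring.
  by move=> ->; rewrite mulrBr mulrN mulKf// addrC mulNr.
by rewrite /v0 /paste !leNgt ax (lt_trans za ax).
Qed.

(** The predicate [l] bounds the domain on the left: positivity for a whole function, [zeta <= t]
    for the inner junction of [v0]. *)
Lemma glue_homo (l : R -> Prop) (z : R) (f g : R -> R) : l z -> f z = g z ->
  (forall x y, l x -> x <= y -> y <= z -> f x <= f y) ->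
  (forall x y, z <= x -> x <= y -> g x <= g y) ->
  forall x y, l x -> x <= y -> paste z f g x <= paste z f g y.
Proof.
move=> lz fg f_ g_ x y lx xy; rewrite /paste; case: (leP y z) => yz.
  by rewrite (le_trans xy yz) f_.
case: (leP x z) => xz; first by rewrite (le_trans (f_ x z _ _ _))// fg g_// ltW.
by rewrite g_// ltW.
Qed.

Let W_homo c (x y : R) : delta <= x -> x <= y -> - N^-1 * W x + c <= - N^-1 * W y + c.
Proof. by move=> dx xy; rewrite lerD2r ler_nM2l ?W_le// oppr_lt0 invr_gt0. Qed.

Let homog_homo (x y : R) : zeta <= x -> x <= y -> HH zeta x <= HH zeta y.
Proof.
move=> zx; rewrite le_eqVlt => /predU1P[->//|xy].
have E t : HH zeta t = (U zeta - W) t / kap.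
  by rewrite !fctE gapE addrK mulrC mulKf// gt_eqF.
rewrite !E ler_pM2r ?invr_gt0//; apply/ltW.
apply: (@is_derive_homo _ _ (fun t => dU t / t - dsol p1 0 t / t)) => // t /andP[xt ty].
  have t0 : 0 < t by rewrite (lt_le_trans zeta0)// (le_trans zx).
  by apply: is_deriveB; exact: (voc_is_derive m0 n0 h_inc int0 inty).
have zt := le_lt_trans zx xt; have t0 := lt_trans zeta0 zt.
rewrite -mulrBl divr_gt0// (@dgapE _ m n s2 r kap delta h m0 n0 mn zeta t) addrK.
by rewrite mulr_gt0// (@dhomog_gt0 _ m n s2 r).
Qed.

Lemma v1_inc : increasing_on_pos v1.
Proof.
apply: glue_homo => // [|x y dx xy]; first by rewrite Wd NK addr0.
exact: W_homo.
Qed.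

Lemma v0_inc : increasing_on_pos v0.
Proof.
apply: glue_homo => // [|x y zx xy].
  by rewrite /paste ltW// mulNr -mulrBr gapE homog_id// addrK mulrCA mulVf// mulr1.
apply: (@glue_homo (fun t => zeta <= t)) => // {zx xy x y} [|||x y ax xy].
- exact: ltW.
- by rewrite UA mulrN mulKf// addrC.
- move=> x y zx xy _; rewrite !mulNr -!mulrBr !gapE !addrK ler_pM2l ?invr_gt0//.
  by rewrite ler_pM2l// homog_homo.
- by apply: W_homo => //; rewrite (le_trans (ltW da)).
Qed.

Lemma v1_ge x : 0 < x -> kap <= v1 x.
Proof.
move=> x0; have [xd|dx] := leP x delta; first by rewrite v1_lo.
by rewrite -(v1_lo (lexx delta)); apply: v1_inc => //; exact: ltW.
Qed.

Lemma v0_ge x : 0 < x -> kap <= v0 x.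
Proof.
move=> x0; have [xd|dx] := leP x zeta; first by rewrite v0_lo.
by rewrite -(v0_lo (lexx zeta)); apply: v0_inc => //; exact: ltW.
Qed.

Let UN x : delta <= x -> zeta <= x <= alpha -> v0 x - v1 x = N^-1 * U zeta x.
Proof. by move=> dx zx; rewrite v0_mid// v1_hi// gapE; ring. Qed.

Lemma v1_v0_le x : 0 < x -> v1 x - v0 x <= K1.
Proof.
move=> x0; have [ax|xa] := leP alpha x.
  by rewrite v0_hi// v1_hi ?(le_trans (ltW da))//; lra.
have [xd|dx] := leP x delta.
  by rewrite v1_lo// (@le_trans _ _ 0) ?(ltW K10)// subr_le0 v0_ge.
have [xz|zx] := leP x zeta.
  rewrite v0_lo// v1_hi ?(ltW dx)//.
  have := fit_W_ge m0 n0 s20 mn h_inc h_rc h_y int0 inty kap0 delta0 Bdelta K10 H.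
  move=> /(_ x); rewrite xz (ltW dx) => /(_ isT) C.
  have -> : - N^-1 * W x - kap = - N^-1 * (N * kap + W x).
    by move: (W x) => w; rewrite !mulNr [N^-1 * (_ + w)]mulrDr mulKf// opprD addrC.
  by rewrite mulNr lerNl ler_pdivlMl// mulrN.
rewrite -opprB UN ?(ltW dx) ?(ltW zx) ?(ltW xa)//.
rewrite lerNl ler_pdivlMl// mulrN.
by apply: (fit_gap_ge m0 n0 s20 mn h_inc h_rc h_y int0 inty kap0 delta0 Bdelta K10 H); rewrite ge_max !ltW.
Qed.

Lemma v0_v1_le0 x : 0 < x -> delta <= zeta -> v0 x - v1 x <= 0.
Proof.
move=> x0 dz; have [ax|xa] := leP alpha x.
  by rewrite v0_hi// v1_hi ?(le_trans (ltW da))//; move: K10; lra.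
have [xz|zx] := leP x zeta; first by rewrite v0_lo// subr_le0 v1_ge.
rewrite UN ?(le_trans dz) ?(ltW zx) ?(ltW xa)//.
rewrite pmulr_rle0 ?invr_gt0//.
by apply: (fit_gap_le0 m0 n0 s20 mn h_inc h_y int0 inty delta0 Bdelta K10 H dz); rewrite !ltW.
Qed.

Lemma v0_v1_xhat z K0 : zeta < delta -> delta < z < alpha ->
  (forall y, delta <= y <= alpha -> U zeta y <= U zeta z) -> 0 < U zeta z ->
  (forall x, 0 < x -> v0 x - v1 x <= K0) <-> U zeta z / N <= K0.
Proof.
move=> zd /andP[dz za'] ma Uz; have z0 := lt_trans delta0 dz.
split=> [/(_ z z0)|Uk x x0].
  by rewrite UN ?(ltW dz) ?(ltW za') ?(ltW (lt_trans zd dz))// mulrC.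
have K00 : 0 <= K0 by rewrite (le_trans _ Uk)// divr_ge0 ?ltW.
have [ax|xa] := leP alpha x.
  by rewrite v0_hi// v1_hi ?(le_trans (ltW da))//; move: K10; lra.
have [dx|xd] := leP delta x.
  rewrite UN ?dx ?(le_trans (ltW zd)) ?(ltW xa)// (le_trans _ Uk)// mulrC.
  by rewrite ler_pM2r ?invr_gt0// ma// dx ltW.
(* Left of [delta], [v1] is constant and [v0] increasing, so the difference is largest at
   [delta]. *)
apply: (@le_trans _ _ (v0 delta - v1 delta)).
  by rewrite !v1_lo ?(ltW xd)// lerD2r v0_inc// ltW.
rewrite UN ?(ltW zd) ?(ltW da) ?lexx// (le_trans _ Uk)// mulrC.
by rewrite ler_pM2r ?invr_gt0// ma// lexx ltW.
Qed.

(** Whatever [K0] is, on every piece the other terms are nonpositive and one of them vanishes in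
    each equation; only the bound by [K0] remains. *)
Lemma v_HJB K0 : 0 < K0 ->
  solves_HJB b sigma r h (- kap) K1 K0 v1 v0 <-> (forall x, 0 < x -> v0 x - v1 x <= K0).
Proof.
move=> K00; split.
  move=> [_ [_ [F finF [_ _ Heq]]]] x x0; rewrite leNgt; apply/negP => C.
  (* The equation is given only off [F] and the jumps of [h]. By continuity a violation at [x]
     extends to an interval, which contains an admissible point. *)
  have cu : {for x, continuous (fun y => v0 y - v1 y)}.
    by apply: cvgB; [exact: (C2h_continuous C2v0 x0)|exact: (C2h_continuous C2v1 x0)].
  have [e e0 He] : \forall y \near x, K0 < v0 y - v1 y := cvgr_gt _ cu _ C.
  have xe : x < x + e by rewrite ltrDl.
  have [y /andP[xy ye] [yF hy]] := exists_continuity_point h_inc h_rc finF x0 xe.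
  have y0 := lt_trans x0 xy.
  have [|+ _] := Heq y y0; first by move=> [].
  move=> /eqP; rewrite eq_le => /andP[+ _].
  rewrite !ge_max => /and3P[_ + _]; rewrite subr_le0 leNgt He//.
  by rewrite /ball/= distrC gtr0_norm ?subr_gt0// ltrBlDl.
move=> u_le; set F := delta |` (zeta |` (alpha |` set0)).
have C1 : C2h h F v1 v1' v1''.
  by apply: C2h_sub C2v1 => t [->|//]; left.
have C0 : C2h h F v0 v0' v0'' by apply: C2h_sub C2v0 => t Ht; right.
split; first exact: C2h_C1 C1.
split; first exact: C2h_C1 C0.
exists F; first by rewrite !finite_setU; do !split; exact: finite_set1 || exact: finite_set0.
split; [exact: C2h_C2 C1|exact: C2h_C2 C0|].
move=> x x0 /not_orP[xF /contrapT hx].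
have [_ E1] := C2h_derive2 C1 x0 xF hx.
have [_ E0] := C2h_derive2 C0 x0 xF hx.
rewrite -derive1E in E1; rewrite -derive1E in E0.
rewrite E1 E0 (C2h_derive1 C1 x0) (C2h_derive1 C0 x0) opprK.
have xd : x != delta by apply/eqP => xE; apply: xF; left.
have xz : x != zeta by apply/eqP => xE; apply: xF; right; left.
have xa : x != alpha by apply/eqP => xE; apply: xF; right; right; left.
have k1 := v1_ge x0; have k0 := v0_ge x0.
have G (p q t : R) : p <= 0 -> q <= 0 -> t <= 0 -> p = 0 \/ q = 0 \/ t = 0 ->
    Num.max p (Num.max q t) = 0.
  move=> p0 q0 t0 E; apply/eqP; rewrite eq_le !ge_max p0 q0 t0/= !le_max.
  by case: E => [|[]] ->; rewrite lexx ?orbT.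
have LW : s2 * x ^+ 2 * (- N^-1 * ((d2voc p1 0 x - dsol p1 0 x) / x ^+ 2))
   + b * x * (- N^-1 * (dsol p1 0 x / x)) = - h x - r * (N^-1 * W x).
  have := voc_ode p1 0 x0 => /(congr1 (fun t => - N^-1 * t)).
  by rewrite !mulNr mulKf// => <-; ring.
have LU : s2 * x ^+ 2 * (N^-1 * ((d2U x - dU x) / x ^+ 2))
   + b * x * (N^-1 * (dU x / x)) = h x + r * (N^-1 * U zeta x).
  have := voc_ode (p1 - r * kap * zeta `^ (- m) / m) (r * kap * zeta `^ (- n) / n) x0.
  move=> /(congr1 (fun t => N^-1 * t)).
  by rewrite mulKf// => <-; rewrite /gap /dgap; ring.
have LUW : s2 * x ^+ 2 * (N^-1 * ((d2U x - dU x) / x ^+ 2) + - N^-1 * ((d2voc p1 0 x - dsol p1 0 x) / x ^+ 2))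
   + b * x * (N^-1 * (dU x / x) + - N^-1 * (dsol p1 0 x / x))
   - r * (N^-1 * U zeta x - N^-1 * W x) = 0.
  have D (a e p q u w : R) : s2 * x ^+ 2 * (a + p) + b * x * (e + q) - r * (u - w) =
    (s2 * x ^+ 2 * a + b * x * e) + (s2 * x ^+ 2 * p + b * x * q) - r * (u - w) by ring.
  by rewrite D LU LW; ring.
have v0E : zeta <= x <= alpha -> v0 x = N^-1 * U zeta x - N^-1 * W x.
  by move=> zxa; rewrite v0_mid// gapE; ring.
split.
  apply: G.
  - rewrite /v1'' /v1' /paste; case: (leP x delta) => dx.
      rewrite v1_lo// !mulr0 !addr0 sub0r addrC subr_le0.
      rewrite (le_trans (h_inc x0 dx))// ltW//.
      exact: (B_root_lt n0 h_inc h_y inty delta0 Bdelta).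
    by rewrite LW v1_hi ?(ltW dx)// le_eqVlt; apply/orP; left; apply/eqP; ring.
  - by rewrite subr_le0 u_le.
  - by rewrite addrC subr_le0.
  - have [xd'|dx|/eqP] := ltgtP x delta; last by rewrite (negbTE xd).
      by right; right; rewrite v1_lo ?(ltW xd')// addrC subrr.
    left; rewrite /v1'' /v1' /paste !leNgt dx/= LW v1_hi ?(ltW dx)//; ring.
apply: G.
- rewrite /v0'' /v0' /paste; case: (leP x zeta) => zx.
    by rewrite v0_lo// !mulr0 addr0 sub0r oppr_le0 mulr_ge0 ?ltW.
  case: (leP x alpha) => ax.
    by rewrite v0E ?(ltW zx)// LUW.
  (* Beyond [alpha] the operator leaves r K1 - h(x), and [h] has already exceeded r K1 before
     [alpha]. *)
  have ha : r * K1 <= h x.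
    have [s /andP[ls sa] hs] := fit_h_gt m0 n0 s20 mn h_inc h_y int0 inty kap0 delta0 Bdelta K10 H.
    rewrite (le_trans (ltW hs))// h_inc ?(ltW (lt_trans sa ax))//.
    by apply: lt_le_trans ls; rewrite lt_max delta0.
  rewrite LW v0_hi ?(ltW ax)// [leLHS](_ : _ = r * K1 - h x) ?subr_le0//; ring.
- by rewrite subr_le0 v1_v0_le.
- by rewrite addrC subr_le0.
- have [xz'|zx|/eqP] := ltgtP x zeta; last by rewrite (negbTE xz).
    by right; right; rewrite v0_lo ?(ltW xz')// addrC subrr.
  have [xa'|ax|/eqP] := ltgtP x alpha; last by rewrite (negbTE xa).
    by left; rewrite /v0'' /v0' /paste (leNgt x zeta) zx/= (ltW xa') v0E ?(ltW zx) ?(ltW xa').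
  by right; left; rewrite v0_hi ?(ltW ax)// v1_hi ?(ltW (lt_trans da ax))//; ring.
Qed.

End hjb.

(** * Translation of the definitions *)

Section value_at_zero.
Context {R : realType} (h : R -> R).
Hypothesis h_inc : increasing_on_pos h.

(** For an increasing function the limit at 0 from the right is the infimum over the positive reals,
    finite or not. *)
Lemma h_zero_lt (y : R) : (h_zero h < y%:E)%E <-> exists2 x, 0 < x & h x < y.
Proof.
have nd : {in `]0%R, +oo[ &, {homo (EFin \o h) : u v / u <= v >-> (u <= v)%E}}.
  by move=> u v /[!in_itv]/= /andP[u0 _] _ uv; rewrite lee_fin h_inc.
have cv := @nondecreasing_at_right_cvge _ (EFin \o h) 0 +oo%O isT nd.
rewrite /h_zero (cvg_lim _ cv)//; split=> [|[x x0 hx]].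
  move=> /ereal_inf_lt[_ [x + <-]]; rewrite /= in_itv/= andbT lte_fin => x0 hx.
  by exists x.
apply: (@le_lt_trans _ _ (h x)%:E); last by rewrite lte_fin.
by apply: ereal_inf_lbound; exists x => //=; rewrite in_itv/= x0.
Qed.

End value_at_zero.

Section link.
Context {R : realType} (b sigma r kap : R) (h : R -> R).
Local Notation mu := (@lebesgue_measure R).
Local Notation s2 := (sigma ^+ 2).
Local Notation m := (exp_m b sigma r).
Local Notation n := (exp_n b sigma r).
Hypotheses (hsigma : sigma != 0) (hr : 0 < r).
Hypothesis h_inc : increasing_on_pos h.
Hypothesis int0 : mu.-integrable `]0, 1] (EFin \o (fun s : R => s `^ (- m - 1) * h s)).
Hypothesis inty : mu.-integrable `[1, +oo[ (EFin \o (fun s : R => s `^ (- n - 1) * h s)).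

Local Notation A := (Am m h).
Local Notation B := (Bn n h).
Local Notation N := (s2 * (n - m)).
Local Notation U delta := (gap m n r kap delta h).
Local Notation dU delta := (dgap m n r kap delta h).
Local Notation fit delta := (fit m n s2 r kap delta h).
Local Notation p1 delta := (A 0 delta + r * kap * delta `^ (- m) / m).

Let m0 : m < 0. Proof. by have /andP[] := exp_signs b hsigma hr. Qed.
Let n0 : 0 < n. Proof. by have /andP[] := exp_signs b hsigma hr. Qed.
Let s20 : 0 < s2. Proof. by rewrite exprn_even_gt0. Qed.
Let mn : s2 * m * n = - r. Proof. exact: exp_prod. Qed.
Let m0' : m != 0. Proof. by rewrite lt_eqF. Qed.
Let n0' : n != 0. Proof. by rewrite gt_eqF. Qed.
Let nr : n / r = - (s2 * m)^-1.
Proof.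
have G (p q t u : R) : p * q * t = - u -> p * q != 0 -> t != 0 -> t / u = - (p * q)^-1.
  move=> E pq t0; rewrite -[u]opprK -E; field.
  by move: pq; rewrite mulf_eq0 negb_or t0 => /andP[-> ->].
by apply: G mn _ n0'; rewrite mulf_neq0// gt_eqF.
Qed.
Let nm : 0 < n - m. Proof. by rewrite subr_gt0 (lt_trans m0). Qed.
Let N0 : 0 < N. Proof. by rewrite mulr_gt0. Qed.
Let AE (c x : R) : 0 < x -> A c x = A 0 x + c * x `^ (- m) / m.
Proof. by move=> x0; rewrite (AmE m0 h_inc int0 c 0 x0) subr0. Qed.
Let BE (c x : R) : 0 < x -> B c x = B 0 x - c * x `^ (- n) / n.
Proof. by move=> x0; rewrite (BnE n0 h_inc inty c 0 x0) subr0. Qed.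

Let shiftN (p : R) : (fun s : R => s `^ p * (h s + r * - kap)) =
  (fun s : R => s `^ p * (h s - r * kap)).
Proof. by apply/funext => s; rewrite mulrN. Qed.

Let shift0 (p : R) : (fun s : R => s `^ p * h s) = (fun s : R => s `^ p * (h s - 0)).
Proof. by apply/funext => s; rewrite subr0. Qed.

Lemma coef_AE (delta : R) : 0 < delta -> coef_A b sigma r h (- kap) delta = - N^-1 * p1 delta.
Proof. by move=> d0; rewrite /coef_A shiftN -/(A (r * kap) delta) AE. Qed.

Lemma R_hE (x : R) : R_h b sigma r h x = N^-1 * (x `^ m * A 0 x + x `^ n * B 0 x).
Proof. by rewrite /R_h !shift0. Qed.

Lemma w1E (delta : R) : 0 < delta ->
  w1 b sigma r h (- kap) delta = v1 m n sigma r kap delta h.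
Proof.
move=> d0; apply/funext => x; rewrite /w1 /v1 /paste; case: (leP x delta) => _.
  by rewrite opprK.
by rewrite coef_AE// R_hE /voc; field; rewrite m0' hsigma gt_eqF.
Qed.

Let fit_eqs' delta zeta alpha K1 := @fit_eqs _ m n s2 r kap delta h m0 n0 mn h_inc int0 inty zeta alpha K1.

Section system.
Variable delta : R.
Hypothesis delta0 : 0 < delta.

Lemma G1E (K1 zeta alpha : R) : delta < alpha ->
  G1 b sigma r h (- kap) K1 delta zeta alpha =
    m * (A (r * K1) alpha - (p1 delta - r * kap * zeta `^ (- m) / m)).
Proof.
by move=> da; rewrite /G1 (Am_itv m0 h_inc int0 _ delta0 (ltW da)) (AE (r * K1) delta0); field.
Qed.

Lemma G2E (K1 zeta alpha : R) : B (r * kap) delta = 0 -> delta < alpha ->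
  G2 b sigma r h (- kap) K1 delta zeta alpha =
    n * (B (r * K1) alpha - r * kap * zeta `^ (- n) / n).
Proof.
rewrite (BE (r * kap) delta0) => /subr0_eq E da.
by rewrite /G2 (Bn_itv n0 h_inc inty _ delta0 (ltW da)) (BE (r * K1) delta0) E; field.
Qed.

End system.

Lemma solves_systemE (K1 delta zeta alpha : R) :
  solves_system b sigma r h (- kap) K1 delta zeta alpha <->
  [/\ 0 < delta, B (r * kap) delta = 0 & fit delta zeta alpha K1].
Proof.
rewrite /solves_system shiftN -/(B (r * kap) delta) lt_min gt_max; split.
  move=> [/andP[d0 z0] /andP[da za] Bd]; rewrite G1E// G2E// => /eqP E1 /eqP E2.
  split => //; apply/fit_eqs'; split => //; apply/esym/eqP; rewrite -subr_eq0.
    by rewrite mulf_eq0 (negbTE m0') in E1.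
  by rewrite mulf_eq0 (negbTE n0') in E2.
move=> [d0 Bd /fit_eqs'[z0 da za EA EB]].
by split; rewrite ?d0 ?da ?G1E ?G2E// ?EA ?EB subrr mulr0.
Qed.

Section solution.
Variables (delta zeta alpha K1 : R).
Hypotheses (delta0 : 0 < delta) (Bdelta : B (r * kap) delta = 0).
Hypothesis Hfb : fit delta zeta alpha K1.

Lemma Delta1E : Delta1 b sigma r h (- kap) K1 delta alpha =
  r * - kap * zeta `^ (- m) / (s2 * m * (n - m)).
Proof.
have /fit_eqs'[_ _ _ EA _] := Hfb.
rewrite /Delta1 coef_AE// -/(A (r * K1) alpha) -EA; field.
by rewrite m0' hsigma gt_eqF.
Qed.

Lemma Delta2E : Delta2 b sigma r h K1 alpha =
  - (r * - kap * zeta `^ (- n) / (s2 * n * (n - m))).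
Proof.
have /fit_eqs'[_ _ _ _ EB] := Hfb.
rewrite /Delta2 -/(B (r * K1) alpha) -EB; field.
by rewrite n0' hsigma gt_eqF.
Qed.

Lemma w0E : w0 b sigma r h (- kap) K1 delta zeta alpha =
  v0 m n sigma r kap delta h zeta alpha K1.
Proof.
apply/funext => x; rewrite /w0 /v0 /paste; case: (leP x zeta) => _; first by rewrite /= opprK.
case: (leP x alpha) => _.
  rewrite Delta1E Delta2E /gap /voc; field.
  by rewrite m0' n0' hsigma gt_eqF.
by rewrite coef_AE// R_hE /voc; field; rewrite m0' hsigma gt_eqF.
Qed.

Let dU_dker (x : R) : 0 < x -> dU delta zeta x = dgreen m n h (r * K1) alpha x.
Proof. exact: (fit_dgreen m0 n0 mn h_inc int0 inty Hfb). Qed.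

Let U_ker (x : R) : 0 < x -> U delta zeta x = - (N * K1) + green m n h (r * K1) alpha x.
Proof. exact: (fit_green m0 n0 mn h_inc int0 inty Hfb). Qed.

Lemma solves_xhatE (x : R) : 0 < x -> x <= alpha ->
  solves_xhat b sigma r h K1 alpha x <-> dU delta zeta x = 0.
Proof.
move=> x0 xa; rewrite /solves_xhat (Am_itv m0 h_inc int0 _ x0 xa) (Bn_itv n0 h_inc inty _ x0 xa).
rewrite (dU_dker x0).
suff -> : dgreen m n h (r * K1) alpha x = m * x `^ m * (A (r * K1) alpha - A (r * K1) x)
  - n * x `^ n * (B (r * K1) x - B (r * K1) alpha) by [].
by rewrite /dgreen; ring.
Qed.

(** At a critical point the [A] term of the gap is n / m times its [B] term; with n / r = - 1 / (s2
    m), the value of the gap takes the form of [K0_dagger]. *)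
Lemma K0_daggerE (x : R) : 0 < x -> x <= alpha -> dU delta zeta x = 0 ->
  K0_dagger b sigma r h K1 alpha x = U delta zeta x / N.
Proof.
move=> x0 xa; rewrite dU_dker// /dgreen => /subr0_eq E.
rewrite /K0_dagger (Bn_itv n0 h_inc inty _ x0 xa) (U_ker x0) /green.
have -> : x `^ m * (A (r * K1) x - A (r * K1) alpha) =
    n / m * (x `^ n * (B (r * K1) alpha - B (r * K1) x)).
  by rewrite -[LHS](mulKf m0') [m * _]mulrA -E; field.
rewrite [n * _ / r]mulrAC nr; field.
by rewrite m0' hsigma gt_eqF.
Qed.

End solution.

End link.

(** * The theorem *)

Section conclusion.
Context {R : realType} (b sigma r kap delta : R) (h : R -> R).
Local Notation mu := (@lebesgue_measure R).
Local Notation s2 := (sigma ^+ 2).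
Local Notation m := (exp_m b sigma r).
Local Notation n := (exp_n b sigma r).
Hypotheses (hsigma : sigma != 0) (hr : 0 < r).
Hypothesis h_inc : increasing_on_pos h.
Hypothesis h_rc : forall x : R, 0 < x -> h y @[y --> x^'+] --> h x.
Hypothesis h_y : h x @[x --> +oo] --> +oo.
Hypothesis int0 : mu.-integrable `]0, 1] (EFin \o (fun s : R => s `^ (- m - 1) * h s)).
Hypothesis inty : mu.-integrable `[1, +oo[ (EFin \o (fun s : R => s `^ (- n - 1) * h s)).
Hypotheses (kap0 : 0 < kap) (delta0 : 0 < delta).
Hypothesis Bdelta : Bn n h (r * kap) delta = 0.

Local Notation N := (s2 * (n - m)).
Local Notation U := (gap m n r kap delta h).
Local Notation dU := (dgap m n r kap delta h).
Local Notation fit := (fit m n s2 r kap delta h).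

Variables (zeta alpha xhat : R -> R) (K1d : R).
Hypothesis Hza : forall K1, 0 < K1 -> fit (zeta K1) (alpha K1) K1.
Hypothesis HK1d : h delta < 0 -> 0 < K1d /\ exists alphad, fit delta alphad K1d.
Hypothesis Hxhat : forall K1, 0 < K1 -> zeta K1 < delta ->
  [/\ delta < xhat K1 < alpha K1, dU (zeta K1) (xhat K1) = 0, 0 < U (zeta K1) (xhat K1),
    forall y, delta <= y <= alpha K1 -> U (zeta K1) y <= U (zeta K1) (xhat K1)
    & h (xhat K1) < - (r * (U (zeta K1) (xhat K1) / N))].

Let m0 : m < 0. Proof. by have /andP[] := exp_signs b hsigma hr. Qed.
Let n0 : 0 < n. Proof. by have /andP[] := exp_signs b hsigma hr. Qed.
Let s20 : 0 < s2. Proof. by rewrite exprn_even_gt0. Qed.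
Let mn : s2 * m * n = - r. Proof. exact: exp_prod. Qed.
Let mpn : s2 * (m + n) = s2 - b.
Proof. by rewrite exp_sum// mulrC divfK// sqrf_eq0. Qed.
Let nm : 0 < n - m. Proof. by rewrite subr_gt0 (lt_trans m0). Qed.
Let N0 : 0 < N. Proof. by rewrite mulr_gt0. Qed.

Let fbU := @fit_unique _ m n s2 r kap delta h m0 n0 s20 mn h_inc h_rc h_y int0 inty kap0 delta0 Bdelta.
Let fbl := @fit_le _ m n s2 r kap delta h m0 n0 s20 mn h_inc h_rc h_y int0 inty kap0 delta0 Bdelta.
Let fbE := @fit_eqs _ m n s2 r kap delta h m0 n0 mn h_inc int0 inty.
Let zeta0 K1 : 0 < K1 -> 0 < zeta K1. Proof. by move=> /Hza[]. Qed.

Lemma zeta_lt K1 : h delta < 0 -> 0 < K1 -> (zeta K1 < delta) = (K1 < K1d).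
Proof.
by move=> hd K10; have [Kd [ad Hd]] := HK1d hd; exact: fbl (Hza K10) Hd.
Qed.

Lemma zeta_gt K1 : h delta < 0 -> 0 < K1 -> (delta < zeta K1) = (K1d < K1).
Proof.
by move=> hd K10; have [Kd [ad Hd]] := HK1d hd; exact: fbl Hd (Hza K10).
Qed.

Lemma zeta_lt_h K1 : 0 < K1 -> zeta K1 < delta -> h delta < 0.
Proof.
move=> K10; apply: contraLR; rewrite -!leNgt => hd; apply/ltW.
exact: (fit_h_ge0 m0 n0 s20 mn h_inc int0 inty kap0 delta0 Bdelta K10 hd (Hza K10)).
Qed.

Let K0dE K1 : 0 < K1 -> zeta K1 < delta ->
  K0_dagger b sigma r h K1 (alpha K1) (xhat K1) = U (zeta K1) (xhat K1) / N.
Proof.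
move=> K10 zd; have [/andP[dx xa] dUx _ _ _] := Hxhat K10 zd.
by have := K0_daggerE hsigma hr h_inc int0 inty (Hza K10) (lt_trans delta0 dx) (ltW xa) dUx.
Qed.

Lemma K0_dagger_bounds K1 : h delta < 0 -> 0 < K1 -> K1 < K1d ->
  0 < K0_dagger b sigma r h K1 (alpha K1) (xhat K1) <= K1d - K1.
Proof.
move=> hd K10 KK; have zd : zeta K1 < delta by rewrite zeta_lt.
have [Kd [ad Hd]] := HK1d hd.
have [dxa dUx Ux _ hx] := Hxhat K10 zd.
rewrite K0dE// divr_gt0//=.
apply: (fit_xhat_le m0 n0 s20 mn h_inc h_rc h_y int0 inty kap0 delta0 Bdelta K10 Kd (Hza K10) Hd zd dxa).
by rewrite ltW// (lt_trans hx)// oppr_lt0 mulr_gt0// divr_gt0.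
Qed.

Lemma K0_dagger_cvg : h delta < 0 ->
  K0_dagger b sigma r h K1 (alpha K1) (xhat K1) @[K1 --> K1d^'-] --> (0 : R).
Proof.
move=> hd; have [Kd _] := HK1d hd.
apply: (@squeeze_cvgr _ _ _ _ (cst 0) (fun K1 => K1d - K1)).
- near=> K1; have [K10 KK] : 0 < K1 /\ K1 < K1d.
    by split; near: K1; [exact: nbhs_left_gt|exact: nbhs_left_lt].
  by have /andP[/ltW -> ->] := K0_dagger_bounds hd K10 KK.
- exact: cvg_cst.
- rewrite -[X in _ --> X](subrr K1d); apply: cvgB; first exact: cvg_cst.
  exact: cvg_at_left_filter.
Unshelve. all: by end_near. Qed.

Lemma system_unique K1 delta' zeta' alpha' : 0 < K1 ->
  solves_system b sigma r h (- kap) K1 delta' zeta' alpha' ->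
  [/\ delta' = delta, zeta' = zeta K1 & alpha' = alpha K1].
Proof.
move=> K10 /(solves_systemE kap hsigma hr h_inc int0 inty)[d0 Bd H].
have E := B_root_unique m0 n0 h_inc h_y int0 inty delta0 d0 Bdelta Bd.
rewrite -E in H; have [-> ->] := fbU K10 (Hza K10) H.
by split.
Qed.

Lemma system_solved K1 : 0 < K1 ->
  solves_system b sigma r h (- kap) K1 delta (zeta K1) (alpha K1).
Proof.
by move=> K10; apply/(solves_systemE kap hsigma hr h_inc int0 inty); split => //; exact: Hza.
Qed.

Let D1E K1 (K10 : 0 < K1) :=
  Delta1E hsigma hr h_inc int0 inty delta0 (Hza K10).
Let D2E K1 (K10 : 0 < K1) :=
  Delta2E hsigma hr h_inc int0 inty (Hza K10).

(** Compared with G2 = 0 at the true contact point, the equation says zeta(K1)^(-n) = delta^(-n),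
    hence zeta(K1) = delta. *)
Lemma G2_delta_unique K1 : h delta < 0 -> 0 < K1 ->
  G2 b sigma r h (- kap) K1 delta delta (alpha K1) = 0 -> K1 = K1d.
Proof.
move=> hd K10; have [z0 da za _ _] := Hza K10.
have [_ _ _ _ EB] := (fbE _ _ _).1 (Hza K10).
rewrite (G2E hsigma hr h_inc inty delta0 _ _ Bdelta da) -EB => /eqP.
rewrite mulf_eq0 (gt_eqF n0)/= subr_eq0 => /eqP E.
have {}E : zeta K1 `^ (- n) = delta `^ (- n).
  have c0 : r * kap / n != 0 by rewrite gt_eqF// divr_gt0// mulr_gt0.
  by apply: (mulfI c0); move: E; rewrite ![r * kap * _ / n]mulrAC.
have nN : - n < 0 by rewrite oppr_lt0.
apply/eqP; rewrite eq_le !leNgt -zeta_lt// -zeta_gt//; apply/andP; split; apply/negP.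
  by move=> /(powR_ltn nN delta0); rewrite E ltxx.
by move=> /(powR_ltn nN z0); rewrite E ltxx.
Qed.

Lemma G2_delta_solved : h delta < 0 ->
  G2 b sigma r h (- kap) K1d delta delta (alpha K1d) = 0.
Proof.
move=> hd; have [Kd [ad Hd]] := HK1d hd.
have [zE aE] := fbU Kd Hd (Hza Kd).
have := Hza Kd; rewrite zE => H.
have [_ da _ _ EB] := (fbE _ _ _).1 H.
by rewrite (G2E hsigma hr h_inc inty delta0 _ _ Bdelta da) EB subrr mulr0.
Qed.

Lemma coefs_gt0 K1 : 0 < K1 ->
  [/\ 0 < coef_A b sigma r h (- kap) delta,
      0 < Delta1 b sigma r h (- kap) K1 delta (alpha K1)
    & 0 < Delta2 b sigma r h K1 (alpha K1)].
Proof.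
move=> K10; have z0 := zeta0 K10; have rk : r * - kap < 0 by rewrite mulrN oppr_lt0 mulr_gt0.
rewrite (D1E K10) (D2E K10); split.
- rewrite (coef_AE _ hsigma hr h_inc int0 delta0).
  have := AmE m0 h_inc int0 (r * kap) 0 delta0; rewrite subr0 => <-.
  rewrite mulNr oppr_gt0 pmulr_rlt0 ?invr_gt0//.
  apply: (Am_lt0 m0 h_inc int0) => //.
  exact: (B_root_lt n0 h_inc h_y inty delta0 Bdelta).
- rewrite nmulr_rgt0 ?invr_lt0.
    by rewrite -mulrA mulrCA nmulr_rlt0//; exact: N0.
  by rewrite pmulr_llt0 ?powR_gt0.
- rewrite oppr_gt0 pmulr_llt0 ?invr_gt0; last exact: mulr_gt0 (mulr_gt0 s20 n0) nm.
  by rewrite pmulr_llt0 ?powR_gt0.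
Qed.

Let w1E' := w1E kap hsigma hr h_inc int0 delta0.
Let w0E' K1 (K10 : 0 < K1) := w0E hsigma hr h_inc int0 inty delta0 (Hza K10).

Let vHJB K1 K0 (K10 : 0 < K1) :=
  @v_HJB _ m n b sigma r kap delta h m0 n0 s20 mn mpn h_inc h_rc h_y int0 inty kap0 delta0 Bdelta
    (zeta K1) (alpha K1) K1 K10 (Hza K10) K0.

Lemma HJB_iff K1 K0 : 0 < K1 -> 0 < K0 ->
  solves_HJB b sigma r h (- kap) K1 K0 (w1 b sigma r h (- kap) delta)
    (w0 b sigma r h (- kap) K1 delta (zeta K1) (alpha K1)) <->
  (zeta K1 < delta -> K0_dagger b sigma r h K1 (alpha K1) (xhat K1) <= K0).
Proof.
move=> K10 K00; rewrite w1E' (w0E' K10) (vHJB K10 K00).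
have [zd|dz] := ltP (zeta K1) delta.
  have [dxa dUx Ux mx hx] := Hxhat K10 zd.
  rewrite (K0dE K10 zd).
  rewrite (v0_v1_xhat m0 n0 s20 mn h_inc h_y int0 inty kap0 delta0 Bdelta K10 (Hza K10) K0 zd dxa mx Ux).
  by split => // ->.
split => // _ x x0; apply: le_trans (ltW K00).
by apply: (v0_v1_le0 m0 n0 s20 mn h_inc h_y int0 inty) => //; exact: Hza.
Qed.

(** The first alternative suffices because h(xhat) < - r K0-dagger: if K0 < K0-dagger, then h(0) <=
    h(xhat) < - r K0. The others follow the position of [zeta K1] relative to [delta]. *)
Lemma HJB_cases K1 K0 : 0 < K1 -> 0 < K0 ->
  (zeta K1 < delta -> K0_dagger b sigma r h K1 (alpha K1) (xhat K1) <= K0) <->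
  [\/ ((- r * K0)%:E <= h_zero h)%E,
      (h_zero h < (- r * K0)%:E)%E /\ 0 <= h delta,
      [/\ (h_zero h < (- r * K0)%:E)%E, h delta < 0 & K1d <= K1]
    | [/\ (h_zero h < (- r * K0)%:E)%E, h delta < 0, K1 < K1d
        & K0_dagger b sigma r h K1 (alpha K1) (xhat K1) <= K0]].
Proof.
move=> K10 K00; split=> [le|].
  have [hK|hK] := leP (- r * K0)%:E (h_zero h); first by constructor 1.
  have [hd|hd] := leP 0 (h delta); first by constructor 2.
  have [KK|KK] := leP K1d K1; first by constructor 3.
  by constructor 4; split => //; apply: le; rewrite zeta_lt.
move=> C zd; have hd := zeta_lt_h K10 zd.
have KK : K1 < K1d by rewrite -zeta_lt.
case: C => [h0|[_]|[_ _]|[]//]; last 2 first.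
- by rewrite leNgt hd.
- by rewrite leNgt KK.
have [/andP[dx _] _ _ _ hx] := Hxhat K10 zd.
rewrite K0dE// leNgt; apply/negP => C.
suff : (h_zero h < (- r * K0)%:E)%E by rewrite ltNge h0.
apply/(h_zero_lt h_inc); exists (xhat K1); first exact: lt_trans dx.
by apply: (lt_trans hx); rewrite mulNr ltrN2 ltr_pM2l.
Qed.

Lemma zeta_position K1 : 0 < K1 ->
  [/\ h delta < 0 -> K1 < K1d -> 0 < zeta K1 < delta,
      h delta < 0 -> K1 = K1d -> 0 < zeta K1 /\ zeta K1 = delta
    & 0 <= h delta \/ (h delta < 0 /\ K1d < K1) -> 0 < delta < zeta K1].
Proof.
move=> K10; have z0 := zeta0 K10; split=> [hd KK|hd KE|].
- by rewrite z0 zeta_lt.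
- split => //; have [Kd [ad Hd]] := HK1d hd.
  by have [] := fbU Kd Hd (Hza Kd); rewrite KE.
- rewrite delta0 => -[hd|[hd KK]]; last by rewrite zeta_gt.
  exact: (fit_h_ge0 m0 n0 s20 mn h_inc int0 inty kap0 delta0 Bdelta K10 hd (Hza K10)).
Qed.

End conclusion.

(** Independence of data is expressed by the order of quantifiers: [delta] and [K1d] precede [K1]
    and [K0], while [zeta], [alpha] and [xhat] are functions of [K1] alone. The left side of the
    equivalence quantifies over its own solution of the system, so it makes sense also where none
    exists. *)
Theorem lemma7 (R : realType) (d : measure_display) (T : measurableType d)
  (P : probability T R) (W : R -> {RV P >-> R})
  (b sigma r K : R) (h : R -> R)
  (hsigma : sigma != 0) (hr : 0 < r)
  (hW : brownian_motion W)
  (hh : running_payoff b sigma r W h) :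
  exists (delta : R) (zeta alpha : R -> R) (K1d : R) (xhat : R -> R),
    (K < 0 -> (h_zero h < (- r * K)%:E)%E ->
      [/\ forall K1 : R, 0 < K1 ->
            [/\ solves_system b sigma r h K K1 delta (zeta K1) (alpha K1),
                forall delta' zeta' alpha' : R,
                  solves_system b sigma r h K K1 delta' zeta' alpha' ->
                  [/\ delta' = delta, zeta' = zeta K1 & alpha' = alpha K1],
                Delta1 b sigma r h K K1 delta (alpha K1) =
                  r * K * zeta K1 `^ (- exp_m b sigma r) /
                  (sigma ^+ 2 * exp_m b sigma r *
                     (exp_n b sigma r - exp_m b sigma r))
              & Delta2 b sigma r h K1 (alpha K1) =
                  - (r * K * zeta K1 `^ (- exp_n b sigma r) /
                     (sigma ^+ 2 * exp_n b sigma r *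
                        (exp_n b sigma r - exp_m b sigma r)))],
          h delta < 0 ->
            [/\ 0 < K1d,
                G2 b sigma r h K K1d delta delta (alpha K1d) = 0
              & forall K1 : R, 0 < K1 ->
                  G2 b sigma r h K K1 delta delta (alpha K1) = 0 -> K1 = K1d],
          h delta < 0 -> forall K1 : R, 0 < K1 -> K1 < K1d ->
            [/\ delta < xhat K1 < alpha K1,
                solves_xhat b sigma r h K1 (alpha K1) (xhat K1),
                forall x : R, delta < x < alpha K1 ->
                  solves_xhat b sigma r h K1 (alpha K1) x -> x = xhat K1
              & 0 < K0_dagger b sigma r h K1 (alpha K1) (xhat K1)],
          h delta < 0 ->
            K0_dagger b sigma r h K1 (alpha K1) (xhat K1)
              @[K1 --> K1d^'-] --> (0 : R)
        & forall K1 : R, 0 < K1 ->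
            [/\ h delta < 0 -> K1 < K1d -> 0 < zeta K1 < delta,
                h delta < 0 -> K1 = K1d -> 0 < zeta K1 /\ zeta K1 = delta
              & 0 <= h delta \/ (h delta < 0 /\ K1d < K1) ->
                0 < delta < zeta K1]]) /\
    forall K1 K0 : R, 0 < K1 -> 0 < K0 ->
      ((exists delta' zeta' alpha' : R,
          [/\ solves_system b sigma r h K K1 delta' zeta' alpha',
              [/\ 0 < coef_A b sigma r h K delta',
                  0 < Delta1 b sigma r h K K1 delta' alpha'
                & 0 < Delta2 b sigma r h K1 alpha'],
              increasing_on_pos (w1 b sigma r h K delta'),
              increasing_on_pos (w0 b sigma r h K K1 delta' zeta' alpha')
            & solves_HJB b sigma r h K K1 K0
                (w1 b sigma r h K delta')
                (w0 b sigma r h K K1 delta' zeta' alpha')])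
       <->
       [/\ K < 0, (h_zero h < (- r * K)%:E)%E
         & [\/ ((- r * K0)%:E <= h_zero h)%E,
               (h_zero h < (- r * K0)%:E)%E /\ 0 <= h delta,
               [/\ (h_zero h < (- r * K0)%:E)%E, h delta < 0 & K1d <= K1]
             | [/\ (h_zero h < (- r * K0)%:E)%E, h delta < 0, K1 < K1d
                 & K0_dagger b sigma r h K1 (alpha K1) (xhat K1) <= K0]]]).
Proof.
have [kap KE] : exists kap, K = - kap by exists (- K); rewrite opprK.
subst K; have [h_rc h_inc h_y _] := hh.
have inty := running_payoff_integrabley hsigma hr hW hh.
have int0 := running_payoff_integrable0 hsigma hr hW hh.
set m := exp_m b sigma r in int0 *; set n := exp_n b sigma r in inty *.
have /andP[m0 n0] : (m < 0) && (0 < n) by exact: exp_signs.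
have s20 : 0 < sigma ^+ 2 by rewrite exprn_even_gt0.
have mn : sigma ^+ 2 * m * n = - r by exact: exp_prod.
have rK : - r * - kap = r * kap by rewrite mulrNN.
(* As m < 0, [Delta1] has the sign opposite to K, so its positivity gives K < 0. A root of [B] at
   level - r K has h below that level, hence h(0) < - r K. *)
have necessary K1 delta' zeta' alpha' :
    solves_system b sigma r h (- kap) K1 delta' zeta' alpha' ->
    0 < Delta1 b sigma r h (- kap) K1 delta' alpha' ->
    0 < kap /\ (h_zero h < (- r * - kap)%:E)%E.
  move=> /(solves_systemE kap hsigma hr h_inc int0 inty)[d0 Bd H] D1.
  split; last first.
    apply/(h_zero_lt h_inc); exists delta' => //; rewrite rK.
    exact: (B_root_lt n0 h_inc h_y inty d0 Bd).
  have [z0 _ _ _ _] := H.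
  move: D1; rewrite (Delta1E hsigma hr h_inc int0 inty d0 H) -/m -/n.
  have N0 : (sigma ^+ 2 * m * (n - m))^-1 < 0.
    by rewrite invr_lt0 -mulrA mulrCA nmulr_rlt0// mulr_gt0// subr_gt0 (lt_trans m0).
  rewrite nmulr_lgt0// pmulr_llt0 ?powR_gt0// pmulr_rlt0// oppr_lt0//.
have [/andP[kap0 /asboolP hk]|] := boolP ((0 < kap) && `[< (h_zero h < (- r * - kap)%:E)%E >]); last first.
  move=> C; have {}C : ~ (0 < kap /\ (h_zero h < (- r * - kap)%:E)%E).
    by move=> [k0 k1]; move: C; rewrite k0/= => /asboolP.
  (* If K >= 0 or h(0) >= - r K, both sides of the equivalence are false and the other claims are
     vacuous, so any witnesses do. *)
  exists 0, (cst 0), (cst 0), 0, (cst 0); split.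
    by rewrite oppr_lt0 => k0 k1; case: C.
  move=> K1 K0 K10 K00; split.
    by move=> [d' [z' [a' [/necessary nec [_ D1 _] _ _ _]]]]; case: C; exact: nec.
  by rewrite oppr_lt0 => -[k0 k1 _]; case: C.
have [delta delta0 Bdelta] : exists2 delta, 0 < delta & Bn n h (r * kap) delta = 0.
  apply: (B_root m0 n0 h_inc h_y int0 inty).
  by move: hk; rewrite rK => /(h_zero_lt h_inc).
pose isfit := fit m n (sigma ^+ 2) r kap delta h.
have [za Hza] : {za : R -> R * R & forall K1, 0 < K1 -> isfit (za K1).1 (za K1).2 K1}.
  (* The boundaries become total functions of [K1]; the value at nonpositive [K1] is a dummy. *)
  apply: (@choice _ _ (fun K1 za => 0 < K1 -> isfit za.1 za.2 K1)) => K1.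
  have [K10|] := boolP (0 < K1); last by exists (0, 0).
  have [z [a H]] := fit_exists m0 n0 s20 mn h_inc h_rc h_y int0 inty kap0 delta0 Bdelta K10.
  by exists (z, a).
pose zeta K1 := (za K1).1; pose alpha K1 := (za K1).2.
have [K1d HK1d] : exists K1d, h delta < 0 -> 0 < K1d /\ exists alphad, isfit delta alphad K1d.
  have [hd|] := boolP (h delta < 0); last by exists 0.
  have [Kd [ad [K1d0 Hd]]] := fit_delta m0 n0 s20 mn h_inc h_rc h_y int0 inty kap0 delta0 Bdelta hd.
  by exists Kd => _; split => //; exists ad.
pose U := gap m n r kap delta h; pose dU := dgap m n r kap delta h.
have [xhat Hxhat] : {xhat : R -> R & forall K1, 0 < K1 -> zeta K1 < delta ->
  [/\ delta < xhat K1 < alpha K1, dU (zeta K1) (xhat K1) = 0, 0 < U (zeta K1) (xhat K1),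
    forall y, delta <= y <= alpha K1 -> U (zeta K1) y <= U (zeta K1) (xhat K1)
    & h (xhat K1) < - (r * (U (zeta K1) (xhat K1) / (sigma ^+ 2 * (n - m))))]}.
  apply: (@choice _ _ (fun K1 x => 0 < K1 -> zeta K1 < delta ->
    [/\ delta < x < alpha K1, dU (zeta K1) x = 0, 0 < U (zeta K1) x,
    forall y, delta <= y <= alpha K1 -> U (zeta K1) y <= U (zeta K1) x
    & h x < - (r * (U (zeta K1) x / (sigma ^+ 2 * (n - m))))])) => K1.
  have [K10|] := boolP (0 < K1); last by exists 0.
  have [zd|] := boolP (zeta K1 < delta); last by exists 0.
  have [x Hx] := fit_xhat m0 n0 s20 mn h_inc h_rc h_y int0 inty kap0 delta0 Bdelta K10 (Hza _ K10) zd.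
  by exists x.
have zlt := zeta_lt hsigma hr h_inc h_rc h_y int0 inty kap0 delta0 Bdelta Hza HK1d.
exists delta, zeta, alpha, K1d, xhat; split.
  move=> _ _; split.
  - move=> K1 K10; split.
    + exact: (system_solved hsigma hr h_inc int0 inty delta0 Bdelta Hza).
    + move=> d' z' a'.
      exact: (system_unique hsigma hr h_inc h_rc h_y int0 inty kap0 delta0 Bdelta Hza).
    + exact: (Delta1E hsigma hr h_inc int0 inty delta0 (Hza _ K10)).
    + exact: (Delta2E hsigma hr h_inc int0 inty (Hza _ K10)).
  - move=> hd; have [Kd _] := HK1d hd; split => //.
      exact: (G2_delta_solved hsigma hr h_inc h_rc h_y int0 inty kap0 delta0 Bdelta Hza HK1d hd).
    move=> K1 K10.
    exact: (G2_delta_unique hsigma hr h_inc h_rc h_y int0 inty kap0 delta0 Bdelta Hza HK1d hd).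
  - move=> hd K1 K10 KK; have zd : zeta K1 < delta by rewrite zlt.
    have [dxa dUx _ _ _] := Hxhat K1 K10 zd; have /andP[dx xa] := dxa.
    have xE x : delta < x < alpha K1 -> solves_xhat b sigma r h K1 (alpha K1) x <-> dU (zeta K1) x = 0.
      move=> /andP[dx' xa'].
      exact: (solves_xhatE hsigma hr h_inc int0 inty (Hza _ K10) (lt_trans delta0 dx') (ltW xa')).
    split => //; first by apply/(xE _ dxa).
      move=> x dxa' /(xE _ dxa') dUx'.
      have mx : Num.max delta (zeta K1) = delta by rewrite max_l// ltW.
      apply: (fit_crit_unique m0 n0 s20 mn h_inc h_rc h_y int0 inty kap0 delta0 Bdelta K10 (Hza _ K10) _ _ dUx' dUx);
        by rewrite -/(zeta K1) mx.
    by have /andP[] := K0_dagger_bounds hsigma hr h_inc h_rc h_y int0 inty kap0 delta0 Bdelta Hza HK1d Hxhat hd K10 KK.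
  - exact: (K0_dagger_cvg hsigma hr h_inc h_rc h_y int0 inty kap0 delta0 Bdelta Hza HK1d Hxhat).
  - exact: (zeta_position hsigma hr h_inc h_rc h_y int0 inty kap0 delta0 Bdelta Hza HK1d).
move=> K1 K0 K10 K00.
have HJB := HJB_iff hsigma hr h_inc h_rc h_y int0 inty kap0 delta0 Bdelta Hza Hxhat K10 K00.
have cases := HJB_cases hsigma hr h_inc h_rc h_y int0 inty kap0 delta0 Bdelta Hza HK1d Hxhat K10 K00.
split.
  move=> [d' [z' [a' [sol _ _ _ hjb]]]].
  have [E1 E2 E3] := system_unique hsigma hr h_inc h_rc h_y int0 inty kap0 delta0 Bdelta Hza K10 sol.
  by move: hjb; rewrite E1 E2 E3 oppr_lt0 => /HJB /cases.
rewrite oppr_lt0 => -[_ _ /cases /HJB hjb].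
exists delta, (zeta K1), (alpha K1); split => //.
- exact: (system_solved hsigma hr h_inc int0 inty delta0 Bdelta Hza).
- exact: (coefs_gt0 hsigma hr h_inc h_y int0 inty kap0 delta0 Bdelta Hza).
- rewrite (w1E kap hsigma hr h_inc int0 delta0).
  exact: (v1_inc m0 n0 s20 mn h_inc h_y int0 inty delta0 Bdelta).
- rewrite (w0E hsigma hr h_inc int0 inty delta0 (Hza _ K10)).
  by apply: (v0_inc m0 n0 s20 mn h_inc h_y int0 inty) => //; exact: Hza.
Qed.
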